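(* Let $(\mathcal{T}(n))_{n\ge1}$ be the delayed attachment tree process with $\beta\in[0,1)$ and attachment function $f(k)=k+\alpha$ ($k\ge1$) for a constant $\alpha>-1$. Assume the delay distribution $\mu$ satisfies $$\lim_{n\to\infty}\mathbb{E}\Big[\frac{n^\beta\xi\,\mathbf 1\{n-n^\beta\xi\ge1\}}{\lfloor n-n^\beta\xi\rfloor_+}\Big]=0\quad\text{and}\quad\sum_{n=1}^\infty\frac1n\,\mathbb{E}\Big[\frac{n^\beta\xi\,\mathbf 1\{n-n^\beta\xi\ge1\}}{\lfloor n-n^\beta\xi\rfloor_+}\Big]<\infty.$$ Let $X:=\xi^{1/(1-\beta)}$, $\theta:=1/(2+\alpha)$, and $M(\rho,n):=\deg(v_1,n)$ be the root degree. (i) If $\mathbb{E}[X^{1-\theta}]<\infty$, then there is a finite non-negative random variable $W_\infty$ (depending on $\alpha,\beta,\mu$) with $\mathbb{P}(W_\infty>0)>0$ such that $M(\rho,n)/n^\theta\to W_\infty$ almost surely and in $L^2$. (ii) If $\mathbb{E}[X]=\infty$, then for every $\varepsilon>0$, $$\lim_{n\to\infty}\mathbb{P}\big(M(\rho,n)\ge(1-\varepsilon)\,\mathbb{E}[X\wedge n]\big)=1.$$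
   Context: Model. Fix $\beta\in[0,1)$, a probability distribution $\mu$ on $[0,\infty)$ (the delay distribution) and a function $f:\{1,2,\dots\}\to(0,\infty)$ (the attachment function); $\xi$ denotes a generic random variable with law $\mu$. For $x\in\mathbb{R}$ let $\lfloor x\rfloor_+:=\max\{\lfloor x\rfloor,1\}$. A sequence of random rooted trees $(\mathcal{T}(n))_{n\ge1}$ is grown as follows; $\mathcal{T}(n)$ has vertex set $\{v_1,\dots,v_n\}$ and root $\rho=v_1$. - $\mathcal{T}(1)$ consists of $v_1$ alone, and $\mathcal{T}(2)$ consists of $v_1,v_2$ with $v_1$ the parent of $v_2$. - For $j\ge i$, $\deg(v_i,j)$ is the number of children of $v_i$ in $\mathcal{T}(j)$ plus one (so $\deg(v_i,i)=1$), and $\deg(v_i,j):=0$ for $j<i$. - For $n\ge2$, given $\mathcal{T}(1),\dots,\mathcal{T}(n)$, draw $\xi_{n+1}\sim\mu$ independently of everything before and put $m:=\lfloor n-n^{\beta}\xi_{n+1}\rfloor_+$. The new vertex $v_{n+1}$ chooses its parent $v\in\mathcal{T}(m)$ with probability $f(\deg(v,m))/\sum_{u\in\mathcal{T}(m)}f(\deg(u,m))$, and $\mathcal{T}(n+1)$ is $\mathcal{T}(n)$ together with this new vertex and edge. - $\mathcal{F}_n$ denotes the $\sigma$-field generated by $\mathcal{T}(1),\dots,\mathcal{T}(n)$ and $\xi_2,\dots,\xi_n$. *)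

(* Defs.v *)
From HB Require Import structures.
From mathcomp Require Import all_boot all_order all_algebra.
From mathcomp Require Import all_classical all_reals all_analysis.
Set Implicit Arguments. Unset Strict Implicit. Unset Printing Implicit Defensive.
Import Order.TTheory GRing.Theory Num.Theory.
Import numFieldNormedType.Exports.
Local Open Scope classical_set_scope.
Local Open Scope ring_scope.

Section DelayedTree.
Variable R : realType.

(* floor_+(n - n^beta * x) = max(floor(n - n^beta x), 1), as a nat
   (n - n^beta x <= n when x >= 0; truncn of a negative number is 0). *)
Definition lagged_time (beta : R) (n : nat) (x : R) : nat :=
  maxn 1 (Num.truncn (n%:R - (n%:R `^ beta) * x)).

(* A tree on vertices v_1,...,v_j is encoded by its parent list
   [:: parent(v_2); ...; parent(v_j)] (vertex v_i is the natural number i).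
   deg(v_i, j) = number of children + 1 for 1 <= i <= j, and 0 otherwise. *)
Definition tdeg (p : seq nat) (j i : nat) : nat :=
  if (1 <= i <= j)%N then (count (pred1 i) (take j.-1 p)).+1 else 0%N.

(* Parent choice in T(m) by inverse transform sampling from u in [0,1):
   vertex i is chosen with probability f(deg(v_i,m)) / sum_u f(deg(u,m)). *)
Definition choose_parent (f : nat -> R) (p : seq nat) (m : nat) (u : R) : nat :=
  let w := fun i => f (tdeg p m i) in
  let S := \sum_(1 <= i < m.+1) w i in
  minn m (find (fun i => u * S < \sum_(1 <= j < i.+1) w j) (iota 1 m)).+1.

(* Parent list of T(n), given the delays xs (xs k = xi_k) and the uniform
   variables us (us k drives the parent choice of v_k). *)
Fixpoint tree_parents (f : nat -> R) (beta : R) (xs us : nat -> R) (n : nat)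
  : seq nat :=
  match n with
  | 0 => [::]
  | S n' =>
    if (n' <= 1)%N then (if n' == 1%N then [:: 1%N] else [::])
    else
      let p := tree_parents f beta xs us n' in
      let m := lagged_time beta n' (xs n) in
      rcons p (choose_parent f (take m.-1 p) m (us n))
  end.

Definition proc_deg f beta xs us (i n : nat) : nat :=
  tdeg (tree_parents f beta xs us n) n i.

End DelayedTree.

Definition mutually_independent {d} {Omega : measurableType d} {R : realType}
  (P : probability Omega R) (I : eqType) (X : I -> Omega -> R) : Prop :=
  forall (s : seq I) (B : I -> set R), uniq s ->
    (forall i, measurable (B i)) ->
    P (\bigcap_(i in [set` s]) (X i @^-1` B i)) =
    (\prod_(i <- s) P (X i @^-1` B i))%E.

(* Main.v *)
(**
The root is chosen at step [n -> n+1] with probability [(M m + alpha) / s m], where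
[m] is the lagged time and [s m = m (2 + alpha) - 1] is the total weight of the tree at
time [m]; hence the root degree [M] satisfies a closed recursion driven by independent
pairs (delay, uniform variable).

(i) Let [c] solve [c (n+1) = c n (1 + 1 / s n)], so that [c n ~ const n^theta], and let
[Y n = (M n + alpha) / c n].  Then [Y (n+1) - Y n] is [1 / c (n+1)] times a martingale
difference, whose variance is of order [c n / n], plus a drift created by the delay.
The hypotheses make the L2-norms of the drifts summable: lags [m >= 2] are controlled by
the assumption on the expected relative delay, and lags [m = 1] by the moment
[E X^(1-theta)].  So [Y] is Cauchy in L2, and along [n = k^p] with [p] large it
converges almost surely; monotonicity of [M] fills the gaps.  As [c m / s m] is
nonincreasing in [m], delays can only raise the mean degree: [E Y] stays bounded below
and the limit is not almost surely zero.

(ii) A delay with [X >= k] at step [k] forces the root to be chosen, so [M n] dominates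
a sum of independent indicators with mean at least [E (min X n) - 2], and Chebyshev's
inequality applies.
*)

(* A delayed step reads the tree at a random earlier time, so the conditional mean [q n] of an
   increment is a mixture of all earlier degrees. Comparing [q n] with the undelayed value
   [Z n / s n] calls for bounds on [Z n - Z k], and these call for moments of [Z]. The estimates are
   therefore bootstrapped: first moments, second moments, differences, drift. The moments come from
   a Gronwall argument whose factors [1 + C sig j] have a bounded product.

   Conditional expectation enters as an identity tested against functions of the degrees up to time
   [n]. Such functions have finitely many values, so the identity is proved by finite sums over
   degree histories and the independence of rectangles.

   Almost sure convergence needs summable norms over blocks, while the noise over a block is
   controlled only in the square. On the block from [k^p] to [(k+1)^p] the root of the variance [t]
   is traded for [k^2 t + k^-2]; a large [p] lets the decay of the noise absorb the factor [k^2]. *)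
Require Import Defs.
From HB Require Import structures.
From mathcomp Require Import all_boot all_order all_algebra.
From mathcomp Require Import all_classical all_reals all_analysis.
From mathcomp Require Import measurable_realfun.
From mathcomp Require Import ring lra zify.
Import Order.TTheory GRing.Theory Num.Theory.
Import numFieldNormedType.Exports.
Local Open Scope classical_set_scope.
Local Open Scope ring_scope.
Set Implicit Arguments.
Unset Strict Implicit.

(** * Real powers and the normalising sequence *)

Section RealPowers.
Context {R : realType}.
Implicit Types (x y t : R) (n : nat).

Lemma eq_ler x y : x = y -> x <= y. Proof. by move=> ->. Qed.

(** Concavity of the power. With [L = ln y], weighting the exponential bounds [h1] by [t] and [h2]
    by [1 - t] cancels [L]. *)
Lemma powR_le_tangent t y : 0 <= t <= 1 -> 0 < y -> y `^ t <= 1 + t * (y - 1).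
Proof.
move=> /andP[t0 t1] y0; rewrite /powR gt_eqF//; set L := ln y.
have yE : y = expR L by rewrite lnK// posrE.
have e0 : 0 < expR (t * L) by exact: expR_gt0.
have h1 : expR (t * L) * (1 + (1 - t) * L) <= y.
  rewrite [leRHS]yE (_ : L = t * L + (1 - t) * L) in |- *; last by ring.
  by rewrite [leRHS]expRD -(_ : L = t * L + (1 - t) * L) ?ler_pM2l ?expR_ge1Dx//; ring.
have h2 : expR (t * L) * (1 - t * L) <= 1.
  have := expR_ge1Dx (- (t * L)).
  by rewrite -(ler_pM2l e0) -expRD subrr expR0.
nra.
Qed.

(** With [u = t (1 - y^-1)], concavity at [y^-1] says that [y ^ t] times [1 - u] is at least 1. As
    [y ^ t >= 1], this gives [y ^ t >= 1 + u]. *)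
Lemma powR_ge_tangent t y : 0 <= t <= 1 -> 1 <= y ->
  1 + t * (1 - y^-1) <= y `^ t.
Proof.
move=> t01 y1; have y0 : 0 < y by lra.
have := @powR_le_tangent t y^-1 t01; rewrite invr_gt0 => /(_ y0).
rewrite -powR_inv1 ?(ltW y0)// -powRrM mulN1r powRN powR_inv1 ?(ltW y0)//.
have p0 : 0 < y `^ t by rewrite powR_gt0.
have i1 : y^-1 <= 1 by rewrite invf_le1.
have i0 : 0 < y^-1 by rewrite invr_gt0.
move: t01 => /andP[t0 t1].
set z := y `^ t in p0 *; have zi : z * z^-1 = 1 by rewrite divff// gt_eqF.
move=> h; have : 1 <= z * (1 + t * (y^-1 - 1)) by rewrite -[leLHS]zi ler_pM2l.
have u0 : 0 <= t * (1 - y^-1) by rewrite mulr_ge0// subr_ge0.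
move: u0; rewrite -(opprB _ 1) mulrN; set u := t * _ => u0 zu.
have z1 : 1 <= z by nra.
nra.
Qed.

Lemma powRB1 t y : 0 < y -> y `^ (t - 1) = y `^ t / y.
Proof.
by move=> y0; rewrite powRB ?(gt_eqF y0) ?implybT// powRr1// ltW.
Qed.

Lemma powR_div t x y : 0 <= x -> 0 <= y -> (x / y) `^ t = x `^ t / y `^ t.
Proof.
by move=> x0 y0; rewrite powRM ?invr_ge0// -powR_inv1// -powRrM mulN1r powRN.
Qed.

(** A discrete integral comparison: the inductive step is the tangent bound with exponent [1 - t] at
    the ratio of two consecutive integers. *)
Lemma sum_powRN_le t n : 0 <= t < 1 ->
  \sum_(1 <= k < n.+1) k%:R `^ (- t) <= (1 - t)^-1 * n%:R `^ (1 - t) :> R.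
Proof.
move=> /andP[t0 t1]; have u0 : 0 < 1 - t by lra.
elim: n => [|n ih].
  by rewrite big_geq// mulr_ge0 ?powR_ge0// invr_ge0 ltW.
rewrite big_nat_recr//=; apply: le_trans (lerD ih (lexx _)) _.
rewrite -(ler_pM2l u0) mulrDr !mulrA !mulfV ?gt_eqF// !mul1r.
have N0 : 0 < n.+1%:R :> R by rewrite ltr0n.
have -> : n.+1%:R `^ (- t) = n.+1%:R `^ (1 - t) / n.+1%:R :> R.
  by rewrite -powRB1//; congr (_ `^ _); ring.
case: n {ih} N0 => [|n] N0.
  by rewrite powR0 ?gt_eqF// add0r powR1 divr1 mulr1; lra.
have := @powR_le_tangent (1 - t) (n.+1%:R / n.+2%:R); rewrite divr_gt0//.
have -> : n.+1%:R / n.+2%:R - 1 = - n.+2%:R^-1 :> R by rewrite -[n.+2%:R]natr1; field.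
rewrite powR_div// => h; have {h} := h _ isT.
rewrite ler_pdivrMr ?powR_gt0//; set a := _ `^ _; set b := _ `^ _ => h.
have {h} : a <= (1 + (1 - t) * - n.+2%:R^-1) * b by apply: h; lra.
have -> : (1 + (1 - t) * - n.+2%:R^-1) * b = b - (1 - t) * (b / n.+2%:R) by ring.
by rewrite lerBrDr.
Qed.

Lemma sum_powRN_bounded t : 0 < t <= 1 ->
  exists C : R, forall n, \sum_(1 <= k < n) k%:R `^ (- 1 - t) <= C.
Proof.
move=> /andP[t0 t1]; exists (1 + t^-1).
(* Strengthened for the induction: the subtracted power plays the part of the tail integral and
   turns each step into a tangent bound. *)
suff h n : t * \sum_(1 <= k < n.+2) k%:R `^ (- 1 - t) <= t + 1 - n.+1%:R `^ (- t).
  have C0 : 0 <= 1 + t^-1 by rewrite addr_ge0// invr_ge0 ltW.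
  case=> [|[|n]]; [by rewrite big_geq|by rewrite big_geq|].
  rewrite -(ler_pM2l t0) mulrDr mulfV ?gt_eqF// mulr1.
  by apply: le_trans (h n) _; rewrite lerBlDr lerDl powR_ge0.
elim: n => [|n ih]; first by rewrite big_nat1 !powR1 mulr1; lra.
rewrite big_nat_recr//= mulrDr; apply: le_trans (lerD ih (lexx _)) _.
suff: n.+2%:R `^ (- t) * (1 + t * n.+2%:R^-1) <= n.+1%:R `^ (- t) :> R.
  have -> : n.+2%:R `^ (-1 - t) = n.+2%:R `^ (- t) / n.+2%:R :> R.
    by rewrite -powRB1//; congr (_ `^ _); ring.
  rewrite mulrDr mulr1 [t * (_ / _)]mulrCA; move: (_ * (_ / _)) => w; lra.
have y1 : 1 <= n.+2%:R / n.+1%:R :> R by rewrite ler_pdivlMr// mul1r ler_nat.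
have := @powR_ge_tangent t _ _ y1; rewrite powR_div// ler_pdivlMr ?powR_gt0// => h.
rewrite !powRN mulrC ler_pdivrMr ?powR_gt0// [leRHS]mulrC ler_pdivlMr ?powR_gt0//.
apply: le_trans (h _); last by lra.
rewrite ler_pM2r ?powR_gt0// lerD2l ler_pM2l// invf_div.
by rewrite lerBrDr -[X in X + _]mul1r -mulrDl nat1r divff.
Qed.

End RealPowers.

Section Normaliser.
Context {R : realType}.
Variable alpha : R.
Hypothesis alpha_gt : -1 < alpha.
Implicit Types k m n : nat.

Definition total_weight k : R := k%:R * (2 + alpha) - 1.

Definition normaliser n : R := \prod_(1 <= k < n) (1 + (total_weight k)^-1).

Local Notation s := total_weight.
Local Notation c := normaliser.
Local Notation theta := ((2 + alpha)^-1).

Lemma total_weight_ge k : (0 < k)%N -> (1 + alpha) * k%:R <= s k.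
Proof.
move=> k0; have : 1 <= k%:R :> R by rewrite ler1n.
by rewrite /total_weight; nra.
Qed.

Lemma total_weight_gt0 k : (0 < k)%N -> 0 < s k.
Proof.
move=> k0; apply: lt_le_trans (total_weight_ge k0).
by rewrite mulr_gt0 ?ltr0n//; move: alpha_gt; lra.
Qed.

Lemma total_weightS k : s k.+1 = s k + (2 + alpha).
Proof. by rewrite /total_weight -natr1; ring. Qed.

Lemma total_weightB k n : s n - s k = (2 + alpha) * (n%:R - k%:R).
Proof. by rewrite /total_weight; ring. Qed.

Lemma total_weight1 : s 1 = 1 + alpha.
Proof. by rewrite /total_weight; ring. Qed.

Lemma normaliser1 : c 1 = 1. Proof. by rewrite /normaliser big_geq. Qed.

Lemma normaliserS n : (0 < n)%N -> c n.+1 = c n * (1 + (s n)^-1).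
Proof. by move=> n0; rewrite /normaliser big_nat_recr. Qed.

Lemma normaliser_ge1 n : 1 <= c n.
Proof.
rewrite /normaliser big_nat; elim/big_ind : _ => //.
  by move=> x y x1 y1; rewrite mulr_ege1.
by move=> k /andP[k0 _]; rewrite lerDl invr_ge0 ltW// total_weight_gt0.
Qed.

Lemma normaliser_gt0 n : 0 < c n.
Proof. by apply: lt_le_trans (normaliser_ge1 n). Qed.

Lemma normaliser_leS n : c n <= c n.+1.
Proof.
case: n => [|n]; first by rewrite normaliser1 /normaliser big_geq.
rewrite [leRHS]normaliserS// ler_peMr ?(ltW (normaliser_gt0 _))// lerDl.
by rewrite invr_ge0 ltW// total_weight_gt0.
Qed.

Lemma normaliser_le m n : (m <= n)%N -> c m <= c n.
Proof. by move=> mn; apply: (homo_leq le_refl le_trans normaliser_leS). Qed.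

(** One step adds 1 to the numerator of [(s k + 1) / s k], the growth factor of [c], but
    [2 + alpha > 1] to that of [s]. *)
Lemma normaliser_div_weight_le m n : (0 < m)%N -> (m <= n)%N ->
  c n / s n <= c m / s m.
Proof.
move=> m0 mn; pose u k := c k.+1 / s k.+1.
have uS k : u k.+1 <= u k.
  rewrite /u normaliserS// -mulrA ler_pM2l ?normaliser_gt0//.
  rewrite ler_pdivrMr ?total_weight_gt0// [s k.+2]total_weightS mulrDr.
  rewrite mulVf ?gt_eqF ?total_weight_gt0// lerD2l ler_peMr ?invr_ge0 ?(ltW (total_weight_gt0 _))//.
  by move: alpha_gt; lra.
case: m n m0 mn => // m [//|n] _ mn.
exact: (@homo_leq _ _ (fun x y : R => y <= x) (@lexx _ _) (fun _ _ _ h1 h2 => le_trans h2 h1) uS).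
Qed.

Lemma theta_gt0 : 0 < theta. Proof. by rewrite invr_gt0; move: alpha_gt; lra. Qed.

Lemma theta_lt1 : theta < 1.
Proof. by rewrite invf_lt1; move: alpha_gt; lra. Qed.

(** Puts [1 / s k] slightly above [theta / k], in a form that the tangent bounds for the exponent
    [theta] can be compared with. *)
Lemma inv_total_weight k : (0 < k)%N -> (s k)^-1 = theta / (k%:R - theta).
Proof.
move=> k0; have t1 := theta_lt1; have t0 := theta_gt0.
have k1 : 1 <= k%:R :> R by rewrite ler1n.
have a2 : 2 + alpha != 0 by rewrite gt_eqF//; move: alpha_gt; lra.
rewrite -[X in X / _]invrK -invfM invrK /total_weight; congr (_^-1).
by rewrite mulrBr divff// mulrC.
Qed.

(** The tangent bound gives [(1 + 1/n) ^ theta <= 1 + theta / n], and [theta / n <= 1 / s n]. *)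
Lemma normaliser_ratio_leS n : (0 < n)%N ->
  c n / n%:R `^ theta <= c n.+1 / n.+1%:R `^ theta.
Proof.
move=> n0; have t1 := theta_lt1; have t0 := theta_gt0.
have n0R : 0 < n%:R :> R by rewrite ltr0n.
have n1 : 1 <= n%:R :> R by rewrite ler1n.
rewrite ler_pdivrMr ?powR_gt0// mulrAC ler_pdivlMr ?powR_gt0//.
rewrite normaliserS// -mulrA ler_pM2l ?normaliser_gt0//.
rewrite -ler_pdivrMr ?powR_gt0// -powR_div//.
apply: le_trans (powR_le_tangent _ _) _; [lra|by rewrite divr_gt0|].
rewrite lerD2l inv_total_weight// ler_pM2l//.
have -> : n.+1%:R / n%:R - 1 = n%:R^-1 :> R by rewrite -natr1; field; rewrite gt_eqF.
by rewrite lef_pV2 ?posrE//; lra.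
Qed.

Lemma normaliser_ge_powR n : (0 < n)%N -> n%:R `^ theta <= c n.
Proof.
elim: n => // -[_ _|n ih _]; first by rewrite powR1 normaliser1.
rewrite -[leLHS]mul1r -ler_pdivlMr ?powR_gt0//.
apply: le_trans (normaliser_ratio_leS _) => //.
by rewrite ler_pdivlMr ?powR_gt0// mul1r ih.
Qed.

(** Comparing [c (n+3)] with [(n+1) ^ theta], two indices behind, leaves room for the lower tangent
    bound: it provides [theta / (n+2)] at each step, which exceeds [theta / (n+3-theta)] because
    [theta < 1]. *)
Lemma normaliser_ratio_bounded n : c n.+3 / n.+3%:R `^ theta <= c 3.
Proof.
have t1 := theta_lt1; have t0 := theta_gt0.
suff h : c n.+3 <= c 3 * n.+1%:R `^ theta.
  rewrite ler_pdivrMr ?powR_gt0//; apply: le_trans h _.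
  rewrite ler_pM2l ?normaliser_gt0// ge0_ler_powR ?nnegrE ?ler_nat//; first exact: ltW.
  by lia.
elim: n => [|n ih]; first by rewrite powR1 mulr1.
rewrite normaliserS//; apply: le_trans (ler_wpM2r _ ih) _.
  by rewrite addr_ge0// invr_ge0 ltW// total_weight_gt0.
rewrite -mulrA ler_pM2l ?normaliser_gt0// mulrC -ler_pdivlMr ?powR_gt0// -powR_div//.
have y1 : 1 <= n.+2%:R / n.+1%:R :> R by rewrite ler_pdivlMr// mul1r ler_nat.
apply: le_trans (powR_ge_tangent _ y1); last by lra.
rewrite lerD2l inv_total_weight// ler_pM2l// invf_div.
have -> : 1 - n.+1%:R / n.+2%:R = n.+2%:R^-1 :> R by rewrite -(nat1r n.+1); field; rewrite nat1r.
by rewrite lef_pV2 ?posrE//; rewrite -(natr1 n.+2); have : 1 <= n.+2%:R :> R by [rewrite ler1n]; lra.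
Qed.

Lemma normaliser_ratio_cvg : exists2 l : R, 1 <= l &
  (fun n => c n / n%:R `^ theta) @ \oo --> l.
Proof.
pose u n := c n.+3 / n.+3%:R `^ theta.
have nu : nondecreasing_seq u.
  by apply/nondecreasing_seqP => n; exact: normaliser_ratio_leS.
have cu : cvgn u.
  apply: nondecreasing_is_cvgn => //; exists (c 3) => _ [n _ <-].
  exact: normaliser_ratio_bounded.
exists (limn u).
  apply: limr_ge => //; near=> n.
  by rewrite ler_pdivlMr ?powR_gt0// mul1r normaliser_ge_powR.
by rewrite -(cvg_shiftn 3); under eq_fun do rewrite addn3.
Unshelve. all: by end_near. Qed.

End Normaliser.

(** * Bounded random variables *)

Section BoundedExpectation.
Context {R : realType} {d : measure_display} {Omega : measurableType d}.
Variable P : probability Omega R.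
Implicit Types (F G H : Omega -> R) (a : R) (A : set Omega).

(** At a fixed time a degree is at most [n], so every variable of the process is bounded. This
    single side condition yields integrability and lets [expect] be real-valued. *)
Definition bounded_rv F :=
  measurable_fun setT F /\ exists C : R, forall w, `|F w| <= C.

Definition expect F : R := fine (\int[P]_w (F w)%:E)%E.

Lemma bounded_rv_cst a : bounded_rv (fun=> a).
Proof. by split => //; exists `|a|. Qed.

Lemma bounded_rvD F G : bounded_rv F -> bounded_rv G ->
  bounded_rv (fun w => F w + G w).
Proof.
move=> [mF [C FC]] [mG [D GD]]; split; first exact: measurable_funD.
exists (C + D) => w; apply: le_trans (ler_normD _ _) _; exact: lerD.
Qed.

Lemma bounded_rvM F G : bounded_rv F -> bounded_rv G ->
  bounded_rv (fun w => F w * G w).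
Proof.
move=> [mF [C FC]] [mG [D GD]]; split; first exact: measurable_funM.
by exists (C * D) => w; rewrite normrM ler_pM.
Qed.

Lemma bounded_rvZ a F : bounded_rv F -> bounded_rv (fun w => a * F w).
Proof. by move=> bF; apply: bounded_rvM => //; exact: bounded_rv_cst. Qed.

Lemma bounded_rvB F G : bounded_rv F -> bounded_rv G ->
  bounded_rv (fun w => F w - G w).
Proof.
move=> bF bG; have := bounded_rvD bF (bounded_rvZ (-1) bG).
by under eq_fun do rewrite mulN1r.
Qed.

Lemma bounded_rvX F n : bounded_rv F -> bounded_rv (fun w => F w ^+ n).
Proof.
move=> bF; elim: n => [|n ih]; first exact: bounded_rv_cst.
by under eq_fun do rewrite exprS; exact: bounded_rvM.
Qed.

Lemma bounded_rv_norm F : bounded_rv F -> bounded_rv (fun w => `|F w|).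
Proof.
move=> [mF [C FC]]; split; first exact: measurableT_comp.
by exists C => w; rewrite normr_id.
Qed.

Lemma bounded_rv_sum I (r : seq I) (Q : pred I) (F : I -> Omega -> R) :
  (forall i, Q i -> bounded_rv (F i)) ->
  bounded_rv (fun w => \sum_(i <- r | Q i) F i w).
Proof.
move=> bF; elim: r => [|i r ih].
  by under eq_fun do rewrite big_nil; exact: bounded_rv_cst.
under eq_fun do rewrite big_cons.
by have [Qi|//] := boolP (Q i); apply: bounded_rvD => //; exact: bF.
Qed.

Lemma bounded_rv_indic A : measurable A -> bounded_rv (\1_A : Omega -> R).
Proof.
move=> mA; split; first exact: measurable_indic.
exists 1 => w; rewrite indicE; case: (_ \in _) => /=; rewrite ?normr1 ?normr0//.
Qed.

Lemma bounded_rv_integrable F : bounded_rv F -> P.-integrable setT (EFin \o F).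
Proof.
move=> [mF [C FC]]; apply: measurable_bounded_integrable => //.
  by rewrite [ltLHS](probability_setT P) ltry.
exists C; split => [|x Cx w _ /=]; first exact: num_real.
by apply: le_trans (FC w) _; exact: ltW.
Qed.

Lemma expectE F : bounded_rv F -> (expect F)%:E = (\int[P]_w (F w)%:E)%E.
Proof.
move=> bF; rewrite /expect fineK//.
exact: (integrable_fin_num measurableT (bounded_rv_integrable bF)).
Qed.

Lemma expect_cst a : expect (fun=> a) = a.
Proof.
by rewrite /expect integral_cst// [X in (_ * X)%E]probability_setT mule1.
Qed.

Lemma expectD F G : bounded_rv F -> bounded_rv G ->
  expect (fun w => F w + G w) = expect F + expect G.
Proof.
move=> bF bG; apply: EFin_inj; rewrite EFinD !expectE//; last exact: bounded_rvD.
under eq_integral do rewrite EFinD.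
by rewrite integralD//; exact: bounded_rv_integrable.
Qed.

Lemma expectZ a F : bounded_rv F -> expect (fun w => a * F w) = a * expect F.
Proof.
move=> bF; apply: EFin_inj; rewrite EFinM !expectE//; last exact: bounded_rvZ.
under eq_integral do rewrite EFinM.
by rewrite integralZl//; exact: bounded_rv_integrable.
Qed.

Lemma expectB F G : bounded_rv F -> bounded_rv G ->
  expect (fun w => F w - G w) = expect F - expect G.
Proof.
move=> bF bG; rewrite -[in RHS]mulN1r -expectZ// -expectD//; last exact: bounded_rvZ.
by congr expect; apply/funext => w; rewrite mulN1r.
Qed.

Lemma expect_sum (I : eqType) (r : seq I) (Q : pred I) (F : I -> Omega -> R) :
  (forall i, Q i -> bounded_rv (F i)) ->
  expect (fun w => \sum_(i <- r | Q i) F i w) = \sum_(i <- r | Q i) expect (F i).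
Proof.
move=> bF; elim: r => [|i r ih].
  by under eq_fun do rewrite big_nil; rewrite expect_cst big_nil.
under eq_fun do rewrite big_cons; rewrite big_cons.
have [Qi|//] := boolP (Q i); rewrite expectD ?ih//; first exact: bF.
exact: bounded_rv_sum.
Qed.

Lemma expect_ge0 F : (forall w, 0 <= F w) -> 0 <= expect F.
Proof. by move=> F0; apply: fine_ge0; apply: integral_ge0 => w _; rewrite lee_fin. Qed.

Lemma expect_le F G : bounded_rv F -> bounded_rv G -> (forall w, F w <= G w) ->
  expect F <= expect G.
Proof.
move=> bF bG FG; rewrite -subr_ge0 -expectB//.
by apply: expect_ge0 => w; rewrite subr_ge0.
Qed.

Lemma expect_indic A : measurable A -> (expect \1_A)%:E = P A.
Proof.
move=> mA; rewrite expectE ?integral_indic ?setIT//.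
exact: bounded_rv_indic.
Qed.

Definition norm2 F : R := Num.sqrt (expect (fun w => F w ^+ 2)).

Lemma norm2_ge0 F : 0 <= norm2 F. Proof. exact: sqrtr_ge0. Qed.

Lemma sqr_norm2 F : norm2 F ^+ 2 = expect (fun w => F w ^+ 2).
Proof. by rewrite sqr_sqrtr// expect_ge0// => w; rewrite sqr_ge0. Qed.

Lemma norm2_le a F : 0 <= a -> expect (fun w => F w ^+ 2) <= a ^+ 2 -> norm2 F <= a.
Proof. by move=> a0 h; rewrite -(ger0_norm a0) -sqrtr_sqr ler_wsqrtr. Qed.

Lemma expectM_le_norm2 F G : bounded_rv F -> bounded_rv G ->
  expect (fun w => F w * G w) <= norm2 F * norm2 G.
Proof.
move=> bF bG; set e := expect _; have [e0|e0] := leP e 0.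
  by apply: le_trans e0 _; rewrite mulr_ge0 ?norm2_ge0.
have q t : 0 <= t ^+ 2 * norm2 F ^+ 2 - 2 * t * e + norm2 G ^+ 2.
  have bFG := bounded_rvM bF bG.
  rewrite !sqr_norm2 /e -!expectZ -?expectB -?expectD //;
    [|by do ?[apply: bounded_rvB|apply: bounded_rvZ|apply: bounded_rvX]..].
  apply: expect_ge0 => w.
  by rewrite (_ : _ + _ = (t * F w - G w) ^+ 2) ?sqr_ge0//; ring.
have f0 := norm2_ge0 F; have g0 := norm2_ge0 G.
have fp : 0 < norm2 F.
  rewrite lt_neqAle f0 andbT; apply/negP => /eqP F0.
  (* If [F] had norm 0 the quadratic would be affine in [t] with slope [- 2 e < 0]; this [t] makes
     it equal to -1. *)
  have := q ((norm2 G ^+ 2 + 1) / (2 * e)); rewrite -F0 expr0n mulr0.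
  have -> : 2 * ((norm2 G ^+ 2 + 1) / (2 * e)) * e = norm2 G ^+ 2 + 1.
    by field; rewrite gt_eqF.
  by lra.
(* The minimiser of the quadratic [q]. *)
have := q (e / norm2 F ^+ 2).
have -> : (e / norm2 F ^+ 2) ^+ 2 * norm2 F ^+ 2 - 2 * (e / norm2 F ^+ 2) * e
   + norm2 G ^+ 2 = norm2 G ^+ 2 - e ^+ 2 / norm2 F ^+ 2.
  by field; rewrite gt_eqF.
rewrite subr_ge0 ler_pdivrMr ?exprn_gt0// -exprMn [X in _ <= X ^+ 2]mulrC.
by rewrite ler_sqr ?nnegrE ?mulr_ge0// ltW.
Qed.

Lemma norm2D F G : bounded_rv F -> bounded_rv G ->
  norm2 (fun w => F w + G w) <= norm2 F + norm2 G.
Proof.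
move=> bF bG; apply: norm2_le; first by rewrite addr_ge0 ?norm2_ge0.
have bFG := bounded_rvM bF bG.
have -> : (fun w => (F w + G w) ^+ 2) =
    (fun w => F w ^+ 2 + (2 * (F w * G w) + G w ^+ 2)) by apply/funext => w; ring.
rewrite expectD; [|exact: bounded_rvX|by apply: bounded_rvD; [exact: bounded_rvZ|exact: bounded_rvX]].
rewrite expectD; [|exact: bounded_rvZ|exact: bounded_rvX].
rewrite expectZ// -!sqr_norm2; have := expectM_le_norm2 bF bG; nra.
Qed.

Lemma norm2Z a F : bounded_rv F -> norm2 (fun w => a * F w) = `|a| * norm2 F.
Proof.
move=> bF; rewrite /norm2; under eq_fun do rewrite exprMn.
by rewrite (expectZ (a ^+ 2) (bounded_rvX 2 bF)) sqrtrM ?sqr_ge0// sqrtr_sqr.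
Qed.

Lemma norm2_cst a : norm2 (fun=> a) = `|a|.
Proof. by rewrite /norm2 expect_cst sqrtr_sqr. Qed.

Lemma norm2B F G : bounded_rv F -> bounded_rv G ->
  norm2 (fun w => F w - G w) <= norm2 F + norm2 G.
Proof.
move=> bF bG; rewrite -[norm2 G]mul1r -(normrN1 R) -norm2Z//.
under eq_fun do rewrite -mulN1r.
by apply: norm2D => //; exact: bounded_rvZ.
Qed.

Lemma norm2_sum (I : eqType) (r : seq I) (Q : pred I) (F : I -> Omega -> R) :
  (forall i, Q i -> bounded_rv (F i)) ->
  norm2 (fun w => \sum_(i <- r | Q i) F i w) <= \sum_(i <- r | Q i) norm2 (F i).
Proof.
move=> bF; elim: r => [|i r ih].
  by under eq_fun do rewrite big_nil; rewrite norm2_cst normr0 big_nil.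
under eq_fun do rewrite big_cons; rewrite big_cons.
have [Qi|//] := boolP (Q i); apply: le_trans (norm2D _ _) _; [exact: bF|exact: bounded_rv_sum|].
by rewrite lerD2l.
Qed.

Lemma norm2_le_mono F G : bounded_rv F -> bounded_rv G ->
  (forall w, `|F w| <= `|G w|) -> norm2 F <= norm2 G.
Proof.
move=> bF bG FG; apply: ler_wsqrtr; apply: expect_le; [exact: bounded_rvX..|].
by move=> w; rewrite -real_normK ?num_real// -[leRHS]real_normK ?num_real// lerXn2r ?nnegrE.
Qed.

Lemma expect_norm_le_norm2 F : bounded_rv F -> expect (fun w => `|F w|) <= norm2 F.
Proof.
move=> bF; have bN := bounded_rv_norm bF.
have := expectM_le_norm2 bN (bounded_rv_cst 1); rewrite norm2_cst normr1 mulr1.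
under eq_fun do rewrite mulr1; move=> /le_trans; apply.
by apply: norm2_le_mono => // w; rewrite normr_id.
Qed.

End BoundedExpectation.

(** * Moments of the root degree *)

Section RootDegree.
Context {R : realType} {d : measure_display} {Omega : measurableType d}.
Variables (P : probability Omega R) (alpha : R).
Variables (M : nat -> Omega -> nat) (pi : nat -> nat -> R).
Hypothesis alpha_gt : -1 < alpha.
Implicit Types (F : Omega -> R) (k m n : nat).

Local Notation s := (total_weight alpha).
Local Notation c := (normaliser alpha).
Local Notation E := (expect P).
Local Notation N2 := (norm2 P).

Definition shifted_degree n w : R := (M n w)%:R + alpha.
Local Notation Z := shifted_degree.

Definition increment n w : R := (M n.+1 w)%:R - (M n w)%:R.

(** The conditional probability that the root is chosen at step [n], given the past: [pi n k] is the
    probability of the lag [k]. *)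
Definition mean_increment n w : R :=
  \sum_(1 <= k < n.+1) pi n k * (Z k w / s k).
Local Notation q := mean_increment.

(** Measurability with respect to the degrees up to time [n], stated pointwise. The martingale
    property of the noise is used only against such test functions, through [increment_mean]. *)
Definition adapted n F :=
  forall w w', (forall k, (k <= n)%N -> M k w = M k w') -> F w = F w'.

(** The mean of [(n - L) / L] over the lags [L >= 2]. At lag 1 this ratio is of order [n], so that
    case is kept apart and paid for by the moment of [X]. *)
Definition lag_defect n : R := \sum_(2 <= k < n.+1) pi n k * ((n%:R - k%:R) / k%:R).

(** Controls the drift relative to [c n]: a lag of 1 costs a bounded amount, any other lag its
    relative shortfall times [c n / n]. *)
Definition drift_bound n : R := pi n 1 / c n + lag_defect n / n%:R.
Local Notation sig := drift_bound.

(** The order of the variance of one noise step of [Y]: [c n / n] divided by [c n ^ 2]. *)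
Definition noise_bound n : R := (n%:R * c n)^-1.
Local Notation del := noise_bound.

Hypothesis pi_ge0 : forall n k, 0 <= pi n k.
Hypothesis pi_sum : forall n, (0 < n)%N -> \sum_(1 <= k < n.+1) pi n k = 1.
Hypothesis M1 : forall w, M 1 w = 1%N.
Hypothesis M_step : forall n w, (0 < n)%N ->
  M n.+1 w = M n w \/ M n.+1 w = (M n w).+1.
Hypothesis M_bounded : forall n, bounded_rv (fun w => (M n w)%:R : R).
Hypothesis increment_mean : forall n F, (0 < n)%N -> bounded_rv F ->
  adapted n F -> E (fun w => F w * increment n w) = E (fun w => F w * q n w).

Variables K K' : R.
Hypothesis drift_sum : forall n, \sum_(1 <= j < n) sig j <= K.
Hypothesis drift_le : forall n, (0 < n)%N -> n%:R * sig n <= K'.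

Let c0 := normaliser_gt0 alpha_gt.
Let s0 := total_weight_gt0 alpha_gt.

Let ap : 0 < 1 + alpha. Proof. by move: alpha_gt; lra. Qed.

Lemma lag_defect_ge0 n : 0 <= lag_defect n.
Proof.
rewrite /lag_defect big_nat sumr_ge0// => k /andP[k2 kn].
by rewrite mulr_ge0// divr_ge0// subr_ge0 ler_nat.
Qed.

Lemma drift_bound_ge0 n : 0 <= sig n.
Proof.
by rewrite addr_ge0// divr_ge0 ?lag_defect_ge0// ltW.
Qed.

Lemma noise_bound_ge0 n : 0 <= del n.
Proof. by rewrite invr_ge0 mulr_ge0// ltW. Qed.

Lemma noise_bound_summable : exists C, forall n, \sum_(1 <= j < n) del j <= C.
Proof.
have t0 := theta_gt0 alpha_gt; have t1 := theta_lt1 alpha_gt.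
have [|C hC] := @sum_powRN_bounded R (2 + alpha)^-1; first lra.
exists C => n; apply: le_trans (hC n); rewrite !big_nat; apply: ler_sum => j /andP[j0 _].
have j0R : 0 < j%:R :> R by rewrite ltr0n.
rewrite -opprD powRN lef_pV2 ?posrE ?mulr_gt0 ?powR_gt0//.
rewrite powRD ?(gt_eqF j0R) ?implybT// powRr1// ler_pM2l//.
exact: normaliser_ge_powR.
Qed.

(** The common form of all averages over the lag: [A] bounds the value at lag 1, [D] is the
    undelayed value, and the excess at any other lag is linear in its relative shortfall. *)
Lemma lag_mean_le n (f : nat -> R) (A B D : R) : (0 < n)%N -> 0 <= D ->
  f 1 <= A ->
  (forall k, (2 <= k <= n)%N -> f k <= B * ((n%:R - k%:R) / k%:R) + D) ->
  \sum_(1 <= k < n.+1) pi n k * f k <= pi n 1 * A + B * lag_defect n + D.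
Proof.
move=> n0 D0 f1 fk; rewrite big_ltn//.
rewrite -addrA; apply: lerD; first exact: ler_wpM2l.
have -> : D = \sum_(1 <= k < n.+1) pi n k * D by rewrite -mulr_suml pi_sum// mul1r.
rewrite /lag_defect mulr_sumr [X in _ + X]big_ltn//.
apply: (@le_trans _ _ (\sum_(2 <= k < n.+1) (B * (pi n k * ((n%:R - k%:R) / k%:R)) + pi n k * D))); last first.
  by rewrite big_split/= lerD2l lerDr mulr_ge0.
rewrite !big_nat; apply: ler_sum => k kn; rewrite mulrCA -mulrDr ler_wpM2l//.
exact: fk.
Qed.

(** From [inv_weight_diff]: [2 + alpha] is the slope of [s], and [s k >= (1 + alpha) k] is used
    twice. By [C0_ge] the same constant also covers [c 1 / s 1 = 1 / (1 + alpha)], the value at lag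
    1. *)
Let C0 : R := (2 + alpha) / (1 + alpha) ^+ 2.

Let C0_ge : (1 + alpha)^-1 <= C0.
Proof.
rewrite /C0 expr2 invfM mulrA ler_pMl ?invr_gt0// ler_pdivlMr// mul1r; lra.
Qed.

Let C0_gt0 : 0 < C0. Proof. by apply: lt_le_trans C0_ge; rewrite invr_gt0. Qed.

Lemma inv_weight_diff k n : (0 < k)%N -> (k <= n)%N ->
  (s k)^-1 - (s n)^-1 <= C0 * ((n%:R - k%:R) / k%:R) / n%:R.
Proof.
move=> k0 kn; have n0 : (0 < n)%N by lia.
have k0R : 0 < k%:R :> R by rewrite ltr0n.
have n0R : 0 < n%:R :> R by rewrite ltr0n.
have -> : (s k)^-1 - (s n)^-1 = (2 + alpha) * (n%:R - k%:R) / (s k * s n).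
  by rewrite -total_weightB; field; rewrite !gt_eqF ?s0.
have -> : C0 * ((n%:R - k%:R) / k%:R) / n%:R =
    (2 + alpha) * (n%:R - k%:R) / (((1 + alpha) * k%:R) * ((1 + alpha) * n%:R)).
  by rewrite /C0; field; rewrite !gt_eqF.
apply: ler_wpM2l.
  by rewrite mulr_ge0 ?subr_ge0 ?ler_nat//; move: alpha_gt; lra.
rewrite lef_pV2 ?posrE ?mulr_gt0 ?s0//; apply: ler_pM;
  by rewrite ?total_weight_ge// ltW// mulr_gt0.
Qed.

(** If degrees were exactly [c k], delays would raise the mean increment above [c n / s n] by no
    more than this; it is the one-step input of the Gronwall arguments. *)
Lemma mean_normaliser_le n : (0 < n)%N ->
  \sum_(1 <= k < n.+1) pi n k * (c k / s k) <= c n / s n + C0 * c n * sig n.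
Proof.
move=> n0; have n0R : 0 < n%:R :> R by rewrite ltr0n.
apply: le_trans (@lag_mean_le n _ C0 (C0 * c n / n%:R) (c n / s n) n0 _ _ _) _.
- by rewrite divr_ge0 ?ltW ?s0.
- by rewrite normaliser1 mul1r total_weight1.
- move=> k /andP[k2 kn]; have k0 : (0 < k)%N by lia.
  rewrite -lerBlDr; apply: (@le_trans _ _ (c n * ((s k)^-1 - (s n)^-1))).
    by rewrite mulrBr lerD2r ler_wpM2r ?invr_ge0 ?(ltW (s0 _))// normaliser_le.
  have := inv_weight_diff k0 kn; rewrite -(ler_pM2l (c0 n)) => /le_trans; apply.
  by apply: eq_ler; ring.
rewrite addrC lerD2l; apply: eq_ler; rewrite /drift_bound.
by field; rewrite !gt_eqF.
Qed.

Definition mean_normaliser_const : R := (1 + alpha)^-1 + C0 * K'.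
Local Notation C3 := mean_normaliser_const.

Lemma mean_normaliser_le' n : (0 < n)%N ->
  \sum_(1 <= k < n.+1) pi n k * (c k / s k) <= C3 * (c n / n%:R).
Proof.
move=> n0; have n0R : 0 < n%:R :> R by rewrite ltr0n.
apply: le_trans (mean_normaliser_le n0) _; rewrite /mean_normaliser_const mulrDl; apply: lerD.
  rewrite mulrCA -invfM ler_pM2l// lef_pV2 ?posrE ?mulr_gt0 ?s0//.
  exact: total_weight_ge.
have -> : C0 * c n * sig n = C0 * (c n / n%:R) * (n%:R * sig n).
  by field; rewrite gt_eqF.
rewrite [leRHS]mulrAC; apply: ler_wpM2l; last exact: drift_le.
by rewrite mulr_ge0 ?(ltW C0_gt0)// divr_ge0// ltW.
Qed.

Let K'_ge0 : 0 <= K'.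
Proof. by apply: le_trans (drift_le (ltn0Sn 0)); rewrite mulr_ge0// drift_bound_ge0. Qed.

Lemma mean_normaliser_const_gt0 : 0 < C3.
Proof. by rewrite ltr_pwDl ?invr_gt0// mulr_ge0// ltW. Qed.

Lemma shifted_degree1 w : Z 1 w = 1 + alpha.
Proof. by rewrite /shifted_degree M1. Qed.

Lemma shifted_degreeS n w : Z n.+1 w = Z n w + increment n w.
Proof. by rewrite /shifted_degree /increment; ring. Qed.

Lemma increment01 n w : (0 < n)%N -> increment n w = 0 \/ increment n w = 1.
Proof.
move=> n0; rewrite /increment; case: (M_step w n0) => ->; first by left; rewrite subrr.
by right; rewrite -natr1; ring.
Qed.

Lemma bounded_shifted_degree n : bounded_rv (Z n).
Proof. by apply: bounded_rvD => //; exact: bounded_rv_cst. Qed.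

Lemma bounded_increment n : bounded_rv (increment n).
Proof. exact: bounded_rvB. Qed.

Lemma bounded_mean_increment n : bounded_rv (q n).
Proof.
apply: bounded_rv_sum => k _; under eq_fun do rewrite mulrCA mulrC.
by apply: bounded_rvZ; exact: bounded_shifted_degree.
Qed.

Let bZ := bounded_shifted_degree.
Let bI := bounded_increment.
Let bq := bounded_mean_increment.

Lemma expect_mean_increment n :
  E (q n) = \sum_(1 <= k < n.+1) pi n k * (E (Z k) / s k).
Proof.
rewrite expect_sum => [|k _]; last first.
  by under eq_fun do rewrite mulrCA mulrC; exact: bounded_rvZ.
apply: eq_bigr => k _; under eq_fun do rewrite mulrCA mulrC.
by rewrite expectZ//; ring.
Qed.

Lemma expect_increment n : (0 < n)%N -> E (increment n) = E (q n).
Proof.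
move=> n0; have := increment_mean n0 (bounded_rv_cst 1) (fun _ _ _ => erefl).
by under eq_fun do rewrite mul1r; under [in RHS]eq_fun do rewrite mul1r.
Qed.

Lemma expect_shifted_degreeS n : (0 < n)%N ->
  E (Z n.+1) = E (Z n) + \sum_(1 <= k < n.+1) pi n k * (E (Z k) / s k).
Proof.
move=> n0; rewrite (_ : Z n.+1 = fun w => Z n w + increment n w); last first.
  by apply/funext => w; exact: shifted_degreeS.
by rewrite expectD// expect_increment// expect_mean_increment.
Qed.

Lemma expect_shifted_degree1 : E (Z 1) = 1 + alpha.
Proof. by rewrite (_ : Z 1 = fun=> 1 + alpha) ?expect_cst//; apply/funext => w; exact: shifted_degree1. Qed.

(* Since [c k / s k] is nonincreasing in [k], delays only increase the mean degree. *)
Lemma expect_shifted_degree_ge n : (0 < n)%N -> (1 + alpha) * c n <= E (Z n).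
Proof.
elim/ltn_ind: n => -[//|[|n]] ih _.
  by rewrite normaliser1 mulr1 expect_shifted_degree1.
rewrite expect_shifted_degreeS// [c n.+2]normaliserS// mulrDr mulr1 mulrDr.
apply: lerD; first exact: ih.
have -> : (1 + alpha) * (c n.+1 / s n.+1) =
    \sum_(1 <= k < n.+2) pi n.+1 k * ((1 + alpha) * (c n.+1 / s n.+1)).
  by rewrite -mulr_suml pi_sum// mul1r.
rewrite !big_nat; apply: ler_sum => k /andP[k0 kn]; apply: ler_wpM2l => //.
apply: (@le_trans _ _ ((1 + alpha) * (c k / s k))).
  by rewrite ler_pM2l// normaliser_div_weight_le.
by rewrite mulrA ler_wpM2r ?invr_ge0 ?(ltW (s0 _))// ih.
Qed.

Lemma prod1D_le_expR (x : nat -> R) m n : (forall j, 0 <= x j) ->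
  \prod_(m <= j < n) (1 + x j) <= expR (\sum_(m <= j < n) x j).
Proof.
move=> x0; rewrite expR_sum; apply: ler_prod => j _.
by rewrite addr_ge0//= expR_ge1Dx.
Qed.

Lemma prod1D_ge1 (x : nat -> R) m n : (forall j, 0 <= x j) ->
  1 <= \prod_(m <= j < n) (1 + x j).
Proof.
move=> x0; elim/big_ind : _ => // [a b a1 b1|j _]; first by rewrite mulr_ege1.
by rewrite lerDl.
Qed.

Lemma prod1D_le (x : nat -> R) m k n : (forall j, 0 <= x j) -> (m <= k <= n)%N ->
  \prod_(m <= j < k) (1 + x j) <= \prod_(m <= j < n) (1 + x j).
Proof.
move=> x0 /andP[mk kn]; rewrite [leRHS](big_cat_nat mk kn)/= ler_peMr//.
  exact: le_trans (prod1D_ge1 _ _ x0).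
exact: prod1D_ge1.
Qed.

(** A discrete Gronwall argument. The induction is strong because a lag can reach any earlier time;
    as the factor [b] is nondecreasing, its value at [n] serves for all those times, and the drift
    sum bounds the product. *)
Lemma expect_shifted_degree_le : exists2 C : R, 0 < C &
  forall n, (0 < n)%N -> E (Z n) <= C * c n.
Proof.
pose x j := C0 * sig j.
have x0 j : 0 <= x j by rewrite mulr_ge0 ?(ltW C0_gt0)// drift_bound_ge0.
pose b n := (1 + alpha) * \prod_(1 <= j < n) (1 + x j).
exists ((1 + alpha) * expR (C0 * K)) => [|n n0]; first by rewrite mulr_gt0// expR_gt0.
apply: (@le_trans _ _ (b n * c n)); last first.
  rewrite ler_pM2r// ler_pM2l//; apply: le_trans (prod1D_le_expR _ _ x0) _.
  by rewrite ler_expR -mulr_sumr ler_pM2l.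
elim/ltn_ind: n n0 => -[//|[|n]] ih _.
  by rewrite /b big_geq// normaliser1 !mulr1 expect_shifted_degree1.
rewrite expect_shifted_degreeS//.
have b0 : 0 <= b n.+1 by rewrite mulr_ge0 ?(ltW ap)// (le_trans ler01)// prod1D_ge1.
apply: (@le_trans _ _ (b n.+1 * c n.+1 + b n.+1 * (c n.+1 / s n.+1 + C0 * c n.+1 * sig n.+1))).
  apply: lerD; first exact: ih.
  apply: le_trans (ler_wpM2l b0 (mean_normaliser_le (ltn0Sn n))).
  rewrite mulr_sumr !big_nat; apply: ler_sum => k /andP[k0 kn].
  rewrite [leRHS]mulrCA; apply: ler_wpM2l => //; rewrite mulrA ler_wpM2r ?invr_ge0 ?(ltW (s0 _))//.
  apply: le_trans (ih _ _ _) _ => //; rewrite ler_pM2r// ler_pM2l//.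
  by apply: prod1D_le => //; lia.
have -> : b n.+2 = b n.+1 * (1 + x n.+1) by rewrite /b big_nat_recr//= mulrA.
rewrite [c n.+2]normaliserS// -mulrDr -[leRHS]mulrA; apply: ler_wpM2l => //.
have -> : c n.+1 + (c n.+1 / s n.+1 + C0 * c n.+1 * sig n.+1) =
  c n.+1 * (1 + (s n.+1)^-1 + x n.+1) by rewrite /x; ring.
rewrite [leRHS]mulrCA ler_pM2l//.
have i0 : 0 <= (s n.+1)^-1 by rewrite invr_ge0 ltW// s0.
have := mulr_ge0 i0 (x0 n.+1); lra.
Qed.

Lemma expect_increment_le : exists2 C : R, 0 < C &
  forall n, (0 < n)%N -> E (increment n) <= C * (c n / n%:R).
Proof.
have [C C_gt0 hC] := expect_shifted_degree_le.
exists (C * C3) => [|n n0]; first by rewrite mulr_gt0// mean_normaliser_const_gt0.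
rewrite expect_increment// expect_mean_increment -mulrA.
apply: le_trans (ler_wpM2l (ltW C_gt0) (mean_normaliser_le' n0)).
rewrite mulr_sumr !big_nat; apply: ler_sum => k /andP[k0 kn].
rewrite [leRHS]mulrCA; apply: ler_wpM2l => //; rewrite mulrA.
by rewrite ler_wpM2r ?invr_ge0 ?(ltW (s0 _))// hC.
Qed.

Lemma norm2_mean_increment_le n (b : R) :
  (forall k, (0 < k <= n)%N -> N2 (Z k) <= b * c k) ->
  N2 (q n) <= b * \sum_(1 <= k < n.+1) pi n k * (c k / s k).
Proof.
move=> hb; apply: le_trans (norm2_sum _ _ _) _ => [k _|].
  by under eq_fun do rewrite mulrCA mulrC; exact: bounded_rvZ.
rewrite mulr_sumr !big_nat; apply: ler_sum => k /andP[k0 kn].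
have i0 : 0 <= pi n k / s k by rewrite divr_ge0 ?(ltW (s0 _)).
under eq_fun do rewrite mulrCA mulrC.
rewrite norm2Z// ger0_norm//; apply: le_trans (ler_wpM2l i0 (hb k _)) _; first lia.
by apply: eq_ler; ring.
Qed.

Lemma adapted_shifted_degree k n : (k <= n)%N -> adapted n (Z k).
Proof. by move=> kn w w' h; rewrite /shifted_degree h. Qed.

Lemma adapted_mean_increment k n : (k <= n)%N -> adapted n (q k).
Proof.
move=> kn w w' h; rewrite /mean_increment !big_nat; apply: eq_bigr => j /andP[_ jk].
by rewrite /shifted_degree h//; lia.
Qed.

Lemma increment_sqr n w : (0 < n)%N -> increment n w ^+ 2 = increment n w.
Proof. by move=> n0; case: (increment01 w n0) => ->; rewrite ?expr0n ?expr1n. Qed.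

(** The same Gronwall scheme for squares. Increments are 0 or 1, so the square of the new degree
    gains only twice the product [Z n] times the increment, plus the increment; Cauchy-Schwarz
    handles the product. *)
Lemma norm2_shifted_degree_le : exists2 C : R, 0 < C &
  forall n, (0 < n)%N -> N2 (Z n) <= C * c n.
Proof.
have [Cv Cv0 hv] := expect_increment_le; have [Cd hd] := noise_bound_summable.
(* The factor [Cv / 2] anticipates the squaring: the mean increment is at most [2 (Cv / 2) (del j)]
   times [c j ^ 2]. *)
pose x j := C0 * sig j + Cv / 2 * del j.
have y0 j : 0 <= C0 * sig j by rewrite mulr_ge0 ?(ltW C0_gt0)// drift_bound_ge0.
have z0 j : 0 <= Cv / 2 * del j by rewrite mulr_ge0 ?noise_bound_ge0// divr_ge0// ltW.
have x0 j : 0 <= x j by rewrite addr_ge0.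
have a2 : 0 < 2 + alpha by move: ap; lra.
(* The initial factor exceeds both [Z 1] and 1; [b >= 1] is what lets [h1] absorb the variance term
   into [(b c) ^ 2]. *)
pose b n := (2 + alpha) * \prod_(1 <= j < n) (1 + x j).
exists ((2 + alpha) * expR (C0 * K + Cv / 2 * Cd)) => [|n n0].
  by rewrite mulr_gt0// expR_gt0.
apply: (@le_trans _ _ (b n * c n)); last first.
  rewrite ler_pM2r// ler_pM2l//; apply: le_trans (prod1D_le_expR _ _ x0) _.
  rewrite ler_expR big_split/= -!mulr_sumr lerD// ler_wpM2l ?(ltW C0_gt0)//.
  by rewrite divr_ge0// ltW.
elim/ltn_ind: n n0 => -[//|[|n]] ih _.
  rewrite /b big_geq// normaliser1 !mulr1 (_ : Z 1 = fun=> 1 + alpha).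
    by rewrite norm2_cst gtr0_norm//; lra.
  by apply/funext => w; exact: shifted_degree1.
have n0 := ltn0Sn n; have n0R : 0 < n.+1%:R :> R by rewrite ltr0n.
have b1 : 1 <= b n.+1 by rewrite mulr_ege1 ?prod1D_ge1//; move: ap; lra.
have b0 : 0 <= b n.+1 by apply: le_trans b1.
have i0 : 0 <= (s n.+1)^-1 by rewrite invr_ge0 ltW// s0.
apply: norm2_le.
  by rewrite mulr_ge0 ?(ltW (c0 _))// mulr_ge0 ?(ltW a2)// (le_trans ler01)// prod1D_ge1.
have -> : (fun w => Z n.+2 w ^+ 2) = (fun w => Z n.+1 w ^+ 2 +
    (2 * (Z n.+1 w * increment n.+1 w) + increment n.+1 w)).
  by apply/funext => w; rewrite -{2}increment_sqr// shifted_degreeS; ring.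
rewrite expectD; [|exact: bounded_rvX|]; last first.
  by apply: bounded_rvD => //; apply: bounded_rvZ; exact: bounded_rvM.
rewrite expectD//; last by apply: bounded_rvZ; exact: bounded_rvM.
rewrite expectZ; last exact: bounded_rvM.
rewrite increment_mean//; last exact: adapted_shifted_degree.
have hZ : N2 (Z n.+1) <= b n.+1 * c n.+1 by exact: ih.
have hq : N2 (q n.+1) <= b n.+1 * (c n.+1 / s n.+1 + C0 * c n.+1 * sig n.+1).
  apply: le_trans (@norm2_mean_increment_le n.+1 (b n.+1) _) _.
    move=> k /andP[k0 kn]; apply: le_trans (ih _ _ _) _ => //.
    by rewrite ler_pM2r// ler_pM2l// prod1D_le// k0.
  by apply: ler_wpM2l => //; exact: mean_normaliser_le.
have -> : b n.+2 = b n.+1 * (1 + x n.+1) by rewrite /b big_nat_recr//= mulrA.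
have hZq : E (fun w => Z n.+1 w * q n.+1 w) <=
    b n.+1 * c n.+1 * (b n.+1 * (c n.+1 / s n.+1 + C0 * c n.+1 * sig n.+1)).
  apply: le_trans (expectM_le_norm2 _ (bZ _) (bq _)) _.
  by apply: ler_pM; rewrite ?norm2_ge0.
have hZ2 : E (fun w => Z n.+1 w ^+ 2) <= (b n.+1 * c n.+1) ^+ 2.
  by rewrite -sqr_norm2 lerXn2r ?nnegrE ?norm2_ge0// mulr_ge0// ltW.
apply: le_trans (lerD hZ2 (lerD (ler_wpM2l _ hZq) (hv _ n0))) _ => //.
have -> : Cv * (c n.+1 / n.+1%:R) = 2 * (Cv / 2 * del n.+1) * c n.+1 ^+ 2.
  by rewrite /noise_bound; field; rewrite !gt_eqF.
rewrite [c n.+2]normaliserS// /x.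
move: (y0 n.+1) (z0 n.+1); move: (Cv / 2 * del n.+1) => z.
have -> : C0 * c n.+1 * sig n.+1 = c n.+1 * (C0 * sig n.+1) by ring.
move: (C0 * sig n.+1) => y {}y0 {}z0.
move: (s n.+1)^-1 i0 (b n.+1) b1 b0 (c n.+1) {hZ hq hZq hZ2} => i i0 bb b1 b0 cc.
have h1 : 2 * z * cc ^+ 2 <= 2 * z * (bb * cc) ^+ 2.
  apply: ler_wpM2l; first by rewrite mulr_ge0.
  by rewrite exprMn ler_peMl ?sqr_ge0// expr_ge1.
(* The left side collects the growth of the squared norm over one step, the right side is the growth
   of [(b c) ^ 2]. *)
have h2 : 1 + 2 * i + 2 * (y + z) <= ((1 + (y + z)) * (1 + i)) ^+ 2.
  have u0 : 0 <= y + z by rewrite addr_ge0.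
  move: (y + z) u0 => u u0.
  apply: (@le_trans _ _ ((1 + 2 * u) * (1 + 2 * i))).
    have := mulr_ge0 u0 i0; lra.
  rewrite exprMn; apply: ler_pM; try lra.
    by rewrite sqrrD; have := sqr_ge0 u; lra.
  by rewrite sqrrD; have := sqr_ge0 i; lra.
have := ler_wpM2l (sqr_ge0 (bb * cc)) h2; lra.
Qed.

Definition noise n w : R := increment n w - q n w.

Lemma bounded_noise n : bounded_rv (noise n).
Proof. exact: bounded_rvB. Qed.

Let bN := bounded_noise.

Lemma bounded_noise_sum (u : nat -> R) k n :
  bounded_rv (fun w => \sum_(k <= j < n) u j * noise j w).
Proof. by apply: bounded_rv_sum => j _; exact: bounded_rvZ. Qed.

Lemma adapted_noise_sum (u : nat -> R) k n :
  adapted n (fun w => \sum_(k <= j < n) u j * noise j w).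
Proof.
move=> w w' h; rewrite !big_nat; apply: eq_bigr => j /andP[_ jn].
rewrite /noise /increment !h//; last by lia.
by rewrite (adapted_mean_increment (ltnW jn) h).
Qed.

(** A variance is at most the second moment, and for a 0-1 increment that is the mean. *)
Lemma expect_noise_sqr n : (0 < n)%N ->
  E (fun w => noise n w ^+ 2) <= E (increment n).
Proof.
move=> n0; have -> : (fun w => noise n w ^+ 2) =
    (fun w => (increment n w - 2 * (q n w * increment n w)) + q n w * q n w).
  by apply/funext => w; rewrite -{1}increment_sqr// /noise; ring.
have bqi := bounded_rvM (bq n) (bI n); have bqq := bounded_rvM (bq n) (bq n).
rewrite expectD//; last by apply: bounded_rvB => //; exact: bounded_rvZ.
rewrite expectB//; last exact: bounded_rvZ.
rewrite expectZ// increment_mean//; last exact: adapted_mean_increment.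
have : 0 <= E (fun w => q n w * q n w) by apply: expect_ge0 => w; rewrite -expr2 sqr_ge0.
lra.
Qed.

(** Orthogonality of martingale differences: the partial sum [S] is adapted, so [increment_mean]
    kills the cross term. *)
Lemma expect_noise_sum_sqr (u : nat -> R) k n : (0 < k)%N -> (k <= n)%N ->
  E (fun w => (\sum_(k <= j < n) u j * noise j w) ^+ 2) <=
  \sum_(k <= j < n) u j ^+ 2 * E (increment j).
Proof.
move=> k0; elim: n => [|n ih]; first by rewrite leqn0 => /eqP kE; rewrite kE in k0.
rewrite leq_eqVlt => /predU1P[<-|kn].
  by under eq_fun do rewrite big_geq// expr0n; rewrite expect_cst big_geq.
have {kn} kn : (k <= n)%N by [].
have n0 : (0 < n)%N by exact: leq_trans kn.
rewrite [leRHS]big_nat_recr//=.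
pose S w := \sum_(k <= j < n) u j * noise j w.
have bS : bounded_rv S by exact: bounded_noise_sum.
have -> : (fun w => (\sum_(k <= j < n.+1) u j * noise j w) ^+ 2) =
    (fun w => S w ^+ 2 + (2 * u n * (S w * increment n w - S w * q n w)
      + u n ^+ 2 * noise n w ^+ 2)).
  by apply/funext => w; rewrite big_nat_recr//= -/(S w) /noise; ring.
have bd : bounded_rv (fun w => S w * increment n w - S w * q n w).
  by apply: bounded_rvB; exact: bounded_rvM.
rewrite expectD; [|exact: bounded_rvX|]; last first.
  by apply: bounded_rvD; apply: bounded_rvZ => //; exact: bounded_rvX.
apply: lerD; first exact: ih.
rewrite expectD; [|exact: bounded_rvZ|by apply: bounded_rvZ; exact: bounded_rvX].
rewrite !expectZ//; last exact: bounded_rvX.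
rewrite expectB; [|exact: bounded_rvM..].
rewrite increment_mean//; last exact: adapted_noise_sum.
rewrite subrr mulr0 add0r; apply: ler_wpM2l; first exact: sqr_ge0.
exact: expect_noise_sqr.
Qed.

Lemma shifted_degree_diff k n w : (k <= n)%N ->
  Z n w - Z k w = \sum_(k <= j < n) noise j w + \sum_(k <= j < n) q j w.
Proof.
move=> kn; rewrite -big_split/= -(telescope_sumr (fun j => Z j w))//; apply: eq_bigr => j _.
by rewrite shifted_degreeS /noise; ring.
Qed.

(** Compares the degree seen through the delay with the current one. With [y = c n (n - k) / k], the
    noise contributes the root of [A y], which is replaced by [(A + 1) (y + 1)] so that the bound is
    affine in the relative shortfall, as [lag_mean_le] requires. *)
Lemma norm2_shifted_degree_diff_le : exists2 C : R, 0 < C &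
  forall k n, (0 < k)%N -> (k <= n)%N ->
  N2 (fun w => Z n w - Z k w) <= C * (c n * ((n%:R - k%:R) / k%:R) + 1).
Proof.
have [C1 C1_gt0 h1] := expect_increment_le.
have [C2 C2_gt0 h2] := norm2_shifted_degree_le.
have C3_gt0 := mean_normaliser_const_gt0.
have [L LE] : exists L, L = (2 + alpha) / (1 + alpha) by eexists.
have L_gt0 : 0 < L by rewrite LE divr_gt0//; move: ap; lra.
exists (C1 * L + 1 + C2 * C3 * L) => [|k n k0 kn].
  have := mulr_gt0 C1_gt0 L_gt0; have := mulr_gt0 (mulr_gt0 C2_gt0 C3_gt0) L_gt0; lra.
have k0R : 0 < k%:R :> R by rewrite ltr0n.
have n0 : (0 < n)%N by exact: leq_trans kn.
(* [c j / j] need not be monotone for general indices, so it is compared with [c j / s j], which is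
   nonincreasing. *)
have hc j : (k <= j < n)%N -> c j / j%:R <= L * (c n / k%:R).
  move=> /andP[kj jn]; have j0 : (0 < j)%N by exact: leq_trans kj.
  have j0R : 0 < j%:R :> R by rewrite ltr0n.
  apply: (@le_trans _ _ ((2 + alpha) * (c j / s j))).
    rewrite mulrCA ler_pM2l// ler_pdivlMr ?s0// mulrC ler_pdivrMr//.
    by rewrite /total_weight mulrC lerBlDr lerDl.
  rewrite LE -mulrA ler_pM2l; last by move: ap; lra.
  apply: le_trans (normaliser_div_weight_le alpha_gt k0 kj) _.
  rewrite mulrCA -invfM; apply: ler_pM; rewrite ?(ltW (c0 _)) ?invr_ge0 ?(ltW (s0 _))//.
    by rewrite normaliser_le//; lia.
  by rewrite lef_pV2 ?posrE ?s0 ?mulr_gt0// total_weight_ge.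
have hsum (B : R) : 0 <= B -> \sum_(k <= j < n) B * (c j / j%:R) <=
    B * L * (c n * ((n%:R - k%:R) / k%:R)).
  move=> B0; apply: (@le_trans _ _ (\sum_(k <= j < n) B * (L * (c n / k%:R)))).
    by rewrite !big_nat; apply: ler_sum => j jkn; rewrite ler_wpM2l// hc.
  by rewrite sumr_const_nat -natrB// -[leLHS]mulr_natr; apply: eq_ler; ring.
have x0 : 0 <= c n * ((n%:R - k%:R) / k%:R).
  by rewrite mulr_ge0 ?(ltW (c0 _))// divr_ge0// subr_ge0 ler_nat.
under eq_fun do rewrite (shifted_degree_diff _ kn).
apply: le_trans (norm2D _ _ _) _.
- by apply: bounded_rv_sum => j _.
- by apply: bounded_rv_sum => j _.
rewrite [leRHS]mulrDl; apply: lerD; last first.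
  apply: le_trans (norm2_sum _ _ _) _ => [j _//|].
  apply: (@le_trans _ _ (\sum_(k <= j < n) C2 * C3 * (c j / j%:R))).
    rewrite !big_nat; apply: ler_sum => j /andP[kj jn].
    have j0 : (0 < j)%N by exact: leq_trans kj.
    apply: le_trans (@norm2_mean_increment_le j C2 _) _.
      by move=> i /andP[i0 _]; exact: h2.
    by rewrite -mulrA ler_pM2l//; exact: mean_normaliser_le'.
  apply: le_trans (hsum _ _) _; first by rewrite mulr_ge0// ltW.
  by rewrite ler_pM2l ?mulr_gt0// lerDl.
have CL : 0 < C1 * L by rewrite mulr_gt0.
apply: norm2_le; first by apply: mulr_ge0; lra.
have := @expect_noise_sum_sqr (fun=> 1) k n k0 kn.
under eq_fun do under eq_bigr do rewrite mul1r.
move=> /le_trans; apply.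
apply: (@le_trans _ _ (\sum_(k <= j < n) C1 * (c j / j%:R))).
  rewrite !big_nat; apply: ler_sum => j /andP[kj jn].
  by rewrite expr1n mul1r h1//; exact: leq_trans kj.
apply: le_trans (hsum _ (ltW C1_gt0)) _.
move: (C1 * L) CL (c n * _) x0 => A A0 y y0.
rewrite exprMn; apply: ler_pM; rewrite ?(ltW A0)//.
  by rewrite sqrrD; have := sqr_ge0 A; lra.
by rewrite sqrrD; have := sqr_ge0 y; lra.
Qed.

Definition drift n w : R := q n w - Z n w / s n.

Lemma bounded_drift n : bounded_rv (drift n).
Proof.
apply: bounded_rvB => //; under eq_fun do rewrite mulrC.
exact: bounded_rvZ.
Qed.

(** At lag 1 both [Z 1 / s 1] and [Z n / s n] are bounded in L2. At other lags the change of weight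
    and the change of degree are treated separately; the additive constant in the degree estimate,
    divided by [s n], is what produces [del n]. *)
Lemma drift_le_bound : exists2 C : R, 0 < C &
  forall n, (0 < n)%N -> N2 (drift n) <= C * c n * (sig n + del n).
Proof.
have [C2 C2_gt0 h2] := norm2_shifted_degree_le.
have [C4 C4_gt0 h4] := norm2_shifted_degree_diff_le.
pose A : R := 2 * C2 / (1 + alpha).
pose B : R := C2 * C0 + C4 / (1 + alpha).
have A0 : 0 < A by rewrite divr_gt0// mulr_gt0.
have B0 : 0 < B by rewrite addr_gt0 ?divr_gt0// mulr_gt0.
exists (A + B) => [|n n0]; first exact: addr_gt0.
have n0R : 0 < n%:R :> R by rewrite ltr0n.
have bz k : bounded_rv (fun w => Z k w / s k - Z n w / s n).
  by apply: bounded_rvB; under eq_fun do rewrite mulrC; exact: bounded_rvZ.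
have -> : drift n = fun w => \sum_(1 <= k < n.+1) pi n k * (Z k w / s k - Z n w / s n).
  apply/funext => w; rewrite /drift /mean_increment.
  under [RHS]eq_bigr do rewrite mulrBr.
  by rewrite sumrB -mulr_suml pi_sum// mul1r.
apply: le_trans (norm2_sum _ _ _) _ => [k _|]; first exact: bounded_rvZ.
under eq_bigr => k _ do rewrite (norm2Z _ _ (bz k)) (ger0_norm (pi_ge0 n k)).
have is0 k : (0 < k)%N -> 0 <= (s k)^-1 by move=> k0; rewrite invr_ge0 ltW// s0.
have hs : (s n)^-1 <= (1 + alpha)^-1 / n%:R.
  by rewrite -invfM lef_pV2 ?posrE ?s0 ?mulr_gt0// total_weight_ge.
apply: le_trans (@lag_mean_le n _ A (B * (c n / n%:R)) (B / n%:R) n0 _ _ _) _.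
- by rewrite divr_ge0// ltW.
- apply: le_trans (norm2B _ _ _) _; [by under eq_fun do rewrite mulrC; exact: bounded_rvZ..|].
  under eq_fun do rewrite mulrC; under [X in _ + norm2 _ X]eq_fun do rewrite mulrC.
  rewrite !norm2Z// !ger0_norm ?is0//.
  have := ler_wpM2l (is0 _ (ltn0Sn 0)) (h2 _ (ltn0Sn 0)).
  have := ler_wpM2l (is0 _ n0) (h2 _ n0).
  have := ler_wpM2l (ltW C2_gt0) (normaliser_div_weight_le alpha_gt (ltn0Sn 0) n0).
  rewrite normaliser1 total_weight1 /A; lra.
- move=> k /andP[k2 kn]; have k0 : (0 < k)%N by exact: ltnW.
  (* First the weight changes at the fixed degree [Z k], then the degree changes at the fixed weight
     [s n]. *)
  have -> : (fun w => Z k w / s k - Z n w / s n) =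
      (fun w => ((s k)^-1 - (s n)^-1) * Z k w - (s n)^-1 * (Z n w - Z k w)).
    by apply/funext => w; ring.
  have bd := bounded_rvB (bZ n) (bZ k).
  apply: le_trans (norm2B _ _ _) _; [exact: bounded_rvZ..|].
  have d0 : 0 <= (s k)^-1 - (s n)^-1.
    rewrite subr_ge0 lef_pV2 ?posrE ?s0// -subr_ge0 total_weightB.
    by rewrite mulr_ge0 ?subr_ge0 ?ler_nat//; move: ap; lra.
  rewrite !norm2Z// !ger0_norm ?is0//.
  have k0R : 0 < k%:R :> R by rewrite ltr0n.
  have x0 : 0 <= (n%:R - k%:R) / k%:R :> R by rewrite divr_ge0// subr_ge0 ler_nat.
  have e1 : ((s k)^-1 - (s n)^-1) * N2 (Z k) <=
      (C0 * ((n%:R - k%:R) / k%:R) / n%:R) * (C2 * c n).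
    apply: ler_pM => //; rewrite ?norm2_ge0 ?inv_weight_diff//.
    by apply: le_trans (h2 _ k0) _; rewrite ler_pM2l// normaliser_le.
  have e2 : (s n)^-1 * N2 (fun w => Z n w - Z k w) <=
      ((1 + alpha)^-1 / n%:R) * (C4 * (c n * ((n%:R - k%:R) / k%:R) + 1)).
    by apply: ler_pM; rewrite ?norm2_ge0 ?is0// h4.
  apply: le_trans (lerD e1 e2) _; rewrite /B.
  move: ((n%:R - k%:R) / k%:R) x0 => x x0.
  have := c0 n; move: (c n) => cn cn0; rewrite -subr_ge0.
  rewrite (_ : _ - _ = C2 * C0 / n%:R); last by ring.
  by rewrite divr_ge0// mulr_ge0// ltW.
rewrite /drift_bound /noise_bound.
have -> : (A + B) * c n * (pi n 1 / c n + lag_defect n / n%:R + (n%:R * c n)^-1) =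
  (A + B) * pi n 1 + (A + B) * (c n / n%:R) * lag_defect n + (A + B) / n%:R.
  by field; rewrite !gt_eqF.
have l0 := lag_defect_ge0 n.
apply: lerD; [apply: lerD|].
- by rewrite mulrC ler_wpM2r// lerDl ltW.
- by rewrite ler_wpM2r// ler_wpM2r ?divr_ge0 ?(ltW (c0 _))// lerDr ltW.
- by rewrite ler_wpM2r ?invr_ge0// lerDr ltW.
Qed.

Definition scaled_degree n w : R := Z n w / c n.

Lemma bounded_scaled_degree n : bounded_rv (scaled_degree n).
Proof.
rewrite /scaled_degree; under eq_fun do rewrite mulrC; exact: bounded_rvZ.
Qed.

(** Since [c (j+1) = c j (1 + 1 / s j)], the normalisation removes exactly the undelayed mean
    [Z j / s j] of the increment. *)
Lemma scaled_degree_diff n m w : (0 < n)%N -> (n <= m)%N ->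
  scaled_degree m w - scaled_degree n w =
  \sum_(n <= j < m) (c j.+1)^-1 * noise j w + \sum_(n <= j < m) (c j.+1)^-1 * drift j w.
Proof.
move=> n0 nm; rewrite -big_split/= -(telescope_sumr (fun j => scaled_degree j w))// !big_nat.
apply: eq_bigr => j /andP[nj _]; have j0 : (0 < j)%N by exact: leq_trans nj.
rewrite /scaled_degree shifted_degreeS /noise /drift normaliserS//.
have sj := s0 j0; have h : 0 < 1 + (s j)^-1 by rewrite addr_gt0// invr_gt0.
field; rewrite !gt_eqF//= addr_gt0//.
Qed.

(** Drifts add up in norm, noises in squared norm by orthogonality; hence the square root on the
    second sum. *)
Lemma norm2_scaled_degree_diff : exists2 C : R, 0 < C &
  forall n m, (0 < n)%N -> (n <= m)%N ->
  N2 (fun w => scaled_degree m w - scaled_degree n w) <=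
  C * \sum_(n <= j < m) (sig j + del j) + Num.sqrt (C * \sum_(n <= j < m) del j).
Proof.
have [C1 C1_gt0 h1] := expect_increment_le.
have [C5 C5_gt0 h5] := drift_le_bound.
exists (C1 + C5) => [|n m n0 nm]; first exact: addr_gt0.
under eq_fun do rewrite scaled_degree_diff//.
apply: le_trans (norm2D _ _ _) _.
- by apply: bounded_rv_sum => j _; exact: bounded_rvZ.
- by apply: bounded_rv_sum => j _; apply: bounded_rvZ; exact: bounded_drift.
rewrite addrC; apply: lerD.
  apply: le_trans (norm2_sum _ _ _) _ => [j _|].
    by apply: bounded_rvZ; exact: bounded_drift.
  rewrite mulr_sumr !big_nat; apply: ler_sum => j /andP[nj _].
  have j0 : (0 < j)%N by exact: leq_trans nj.
  rewrite norm2Z; last exact: bounded_drift.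
  rewrite ger0_norm ?invr_ge0 ?(ltW (c0 _))// mulrC ler_pdivrMr//.
  apply: le_trans (h5 _ j0) _; rewrite mulrAC.
  have sd0 : 0 <= sig j + del j by rewrite addr_ge0 ?drift_bound_ge0 ?noise_bound_ge0.
  apply: ler_pM; rewrite ?(ltW (c0 _)) ?mulr_ge0 ?(ltW C5_gt0)//; last exact: normaliser_leS.
  by rewrite ler_wpM2r// lerDr ltW.
apply: ler_wsqrtr; apply: le_trans (expect_noise_sum_sqr _ n0 nm) _.
rewrite mulr_sumr !big_nat; apply: ler_sum => j /andP[nj _].
have j0 : (0 < j)%N by exact: leq_trans nj.
have j0R : 0 < j%:R :> R by rewrite ltr0n.
apply: (@le_trans _ _ ((c j)^-1 ^+ 2 * (C1 * (c j / j%:R)))).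
  apply: ler_pM; rewrite ?sqr_ge0 ?h1//.
    by apply: expect_ge0 => w; case: (increment01 w j0) => ->.
  by rewrite lerXn2r ?nnegrE ?invr_ge0 ?(ltW (c0 _))// lef_pV2 ?posrE// normaliser_leS.
have -> : (c j)^-1 ^+ 2 * (C1 * (c j / j%:R)) = C1 * del j.
  by rewrite /noise_bound; field; rewrite !gt_eqF.
by rewrite ler_wpM2r ?noise_bound_ge0// lerDl ltW.
Qed.

End RootDegree.

(** * Almost sure and L2 limits *)

Section Sequences.
Context {R : realType}.

Lemma nneg_sum_cauchy (u : nat -> R) (K : R) : (forall j, 0 <= u j) ->
  (forall n, \sum_(1 <= j < n) u j <= K) ->
  forall e : R, 0 < e -> exists2 N, (0 < N)%N &
    forall n m, (N <= n)%N -> (n <= m)%N -> \sum_(n <= j < m) u j <= e.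
Proof.
move=> u0 uK e e0; pose S n := \sum_(1 <= j < n.+1) u j.
have ndS : nondecreasing_seq S.
  by apply/nondecreasing_seqP => n; rewrite /S [leRHS]big_nat_recr//= lerDl.
have cS : cvgn S.
  by apply: nondecreasing_is_cvgn => //; exists K => _ [n _ <-]; exact: uK.
have Sl n : S n <= limn S by exact: nondecreasing_cvgn_le.
have /cvgrPdist_le/(_ _ e0)[N _ hN] := cS.
exists N.+1 => // n m Nn nm.
have := hN N (leqnn N); rewrite /= ger0_norm ?subr_ge0// => {}hN.
apply: le_trans hN.
have [mE|m0] := posnP m; first by rewrite mE big_geq ?subr_ge0//; lia.
apply: (@le_trans _ _ (S m.-1 - S N)); last by rewrite lerB.
have Nm : (N < m)%N by exact: leq_trans nm.
rewrite /S prednK// lerBrDl [leRHS](big_cat_nat (n := N.+1))//= lerD2l.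
by rewrite [leRHS](big_cat_nat (n := n))//= lerDr; exact: sumr_ge0.
Qed.

Lemma sum_blocks (u : nat -> R) (h : nat -> nat) n : {homo h : x y / (x <= y)%N} ->
  \sum_(0 <= k < n) \sum_(h k <= j < h k.+1) u j = \sum_(h 0 <= j < h n) u j.
Proof.
move=> hh; elim: n => [|n ih]; first by rewrite !big_geq.
by rewrite big_nat_recr//= ih -big_cat_nat//; exact: hh.
Qed.

(** Makes the roots of the block variances summable in [k]: the second term is summable by itself,
    and the first is linear in the variance. *)
Lemma sqrtr_le_weighted (t k : R) : 0 <= t -> 0 < k ->
  Num.sqrt t <= k ^+ 2 * t + (k ^+ 2)^-1.
Proof.
move=> t0 k0; have k2 : 0 < k ^+ 2 by rewrite exprn_gt0.
have i0 : 0 < (k ^+ 2)^-1 by rewrite invr_gt0.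
have y0 : 0 <= k ^+ 2 * t by rewrite mulr_ge0// ltW.
have s0 : 0 <= k ^+ 2 * t + (k ^+ 2)^-1 by rewrite addr_ge0// ltW.
rewrite -(ger0_norm s0) -sqrtr_sqr; apply: ler_wsqrtr.
have -> : (k ^+ 2 * t + (k ^+ 2)^-1) ^+ 2 = (k ^+ 2 * t) ^+ 2 + 2 * t + ((k ^+ 2)^-1) ^+ 2.
  by field; rewrite gt_eqF.
have := sqr_ge0 (k ^+ 2 * t); have := sqr_ge0 (k ^+ 2)^-1; lra.
Qed.

Lemma power_bracket p n : (0 < p)%N -> (0 < n)%N ->
  exists k, (k.+1 ^ p <= n < k.+2 ^ p)%N.
Proof.
move=> p0; elim: n => // -[_ _|n ih _].
  by exists 0%N; rewrite exp1n leqnn/= -{1}(expn0 2) ltn_exp2l.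
have [k /andP[k1 k2]] := ih isT.
have [h|h] := ltnP n.+2 (k.+2 ^ p).
  by exists k; rewrite h (leq_trans k1).
exists k.+1; rewrite h/=; apply: leq_ltn_trans k2 _.
by rewrite ltn_exp2r.
Qed.

Lemma powR_expR (x t : R) : expR x `^ t = expR (t * x).
Proof. by rewrite /powR gt_eqF ?expR_gt0// expRK. Qed.

(** Between consecutive powers [a] is squeezed by monotonicity, and the ratio of their
    normalisations tends to 1. *)
Lemma cvg_power_subseq (a : nat -> R) (t l : R) p : (0 < p)%N -> 0 <= t ->
  (forall m n, (m <= n)%N -> a m <= a n) -> (forall n, 0 <= a n) ->
  (fun k => a (k.+1 ^ p)%N / (k.+1 ^ p)%:R `^ t) @ \oo --> l ->
  (fun n => a n / n%:R `^ t) @ \oo --> l.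
Proof.
move=> p0 t0 amono a0; set b := (X in X @ _ --> _ -> _) => bl.
pose h k : R := (k.+1%:R)^-1.
(* Bounds the ratio [((k+2) / (k+1)) ^ (p t)], by [1 + h <= expR h]. *)
pose rho k := expR (t * (p%:R * h k)).
have rho0 k : 0 < rho k by exact: expR_gt0.
have nk0 k : 0 < (k.+1 ^ p)%:R `^ t :> R by rewrite powR_gt0// ltr0n expn_gt0.
have rho_le k : (k.+2 ^ p)%:R `^ t <= (k.+1 ^ p)%:R `^ t * rho k.
  rewrite /rho -powR_expR -powRM ?expR_ge0 ?ler0n//.
  apply: ge0_ler_powR => //; rewrite ?nnegrE ?mulr_ge0 ?expR_ge0 ?ler0n//.
  rewrite !natrX mulrC expRM_natl -exprMn lerXn2r ?nnegrE ?mulr_ge0 ?expR_ge0//.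
  rewrite -[leLHS](mulfVK (_ : k.+1%:R != 0 :> R))// ler_wpM2r//.
  apply: le_trans (expR_ge1Dx _); rewrite -(natr1 k.+1) mulrDl mulfV//.
  by rewrite mul1r.
have rho1 : rho @ \oo --> (1 : R).
  rewrite -(expR0 R); apply: continuous_cvg; first exact: continuous_expR.
  rewrite -(mulr0 t) -(mulr0 p%:R).
  by do 2!apply: cvgMr; exact: cvg_harmonic.
have lo : (fun k => b k / rho k) @ \oo --> l.
  rewrite -[X in _ --> X]divr1; apply: cvgM => //.
  by apply: cvgV => //; exact: oner_neq0.
have hi : (fun k => b k.+1 * rho k) @ \oo --> l.
  rewrite -[X in _ --> X]mulr1; apply: cvgM => //.
  by rewrite -(cvg_shiftS b) in bl.
apply/cvgrPdist_le => e e0.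
move/cvgrPdist_le : lo => /(_ _ e0)[N1 _ h1].
move/cvgrPdist_le : hi => /(_ _ e0)[N2 _ h2].
exists ((N1 + N2).+1 ^ p)%N => // n /= Nn.
have n0 : (0 < n)%N by apply: leq_trans Nn; rewrite expn_gt0.
have [k /andP[k1 k2]] := power_bracket p0 n0.
have Nk : (N1 + N2 <= k)%N.
  by have := leq_ltn_trans Nn k2; rewrite ltn_exp2r// ltnS.
have := h1 k (leq_trans (leq_addr _ _) Nk); rewrite /= ler_distlC => /andP[h1l _].
have := h2 k (leq_trans (leq_addl _ _) Nk); rewrite /= ler_distlC => /andP[_ h2u].
have nt0 : 0 < n%:R `^ t :> R by rewrite powR_gt0// ltr0n.
rewrite ler_distlC; apply/andP; split.
  apply: le_trans h1l _; rewrite /b -mulrA -invfM.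
  apply: ler_pM; [exact: a0|by rewrite invr_ge0 mulr_ge0// ltW|exact: amono|].
  rewrite lef_pV2 ?posrE ?mulr_gt0//; apply: le_trans (rho_le k).
  by rewrite ge0_ler_powR ?nnegrE ?ler_nat// ltnW.
apply: le_trans h2u; rewrite /b -mulrA.
apply: ler_pM; [exact: a0|by rewrite invr_ge0 ltW|exact/amono/ltnW|].
rewrite mulrC ler_pdivlMr// mulrC ler_pdivrMr// mulrC; apply: le_trans (rho_le k) _.
by rewrite ler_pM2r// ge0_ler_powR ?nnegrE ?ler_nat.
Qed.

End Sequences.

Section Limits.
Context {R : realType} {d : measure_display} {Omega : measurableType d}.
Variable P : probability Omega R.
Local Notation E := (expect P).
Local Notation N2 := (norm2 P).

(** By monotone convergence the sum of the absolute values has finite integral, so it is finite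
    almost everywhere. *)
Lemma ae_series_cvg (F : nat -> Omega -> R) (C : R) :
  (forall k, bounded_rv (F k)) ->
  (forall n, \sum_(0 <= k < n) E (fun w => `|F k w|) <= C) ->
  {ae P, forall w, cvgn (series (F^~ w))}.
Proof.
move=> bF hC; pose G w := (\sum_(0 <= k <oo) (`|F k w|)%:E)%E.
have mF k : measurable_fun setT (fun w => (`|F k w|)%:E).
  by apply/measurable_EFinP; have [] := bounded_rv_norm (bF k).
have F0 k w : (0 <= (`|F k w|)%:E)%E by rewrite lee_fin.
have mG : measurable_fun setT G by apply: ge0_emeasurable_sum.
have G0 w : (0 <= G w)%E by exact: nneseries_ge0.
have iG : (\int[P]_w G w <= C%:E)%E.
  rewrite integral_nneseries//; apply: lime_le.
    by apply: is_cvg_nneseries => k _ _; exact: integral_ge0.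
  near=> n; rewrite (eq_bigr (fun k => (E (fun w => `|F k w|))%:E)) => [|k _].
    by rewrite sumEFin lee_fin.
  by rewrite expectE//; exact: bounded_rv_norm.
have intG : P.-integrable setT G.
  apply/integrableP; split => //; under eq_integral do rewrite gee0_abs//.
  by apply: le_lt_trans iG _; rewrite ltry.
have := integrable_ae measurableT intG; apply: filterS => w /(_ I) Gw.
apply: normed_cvg; apply: nondecreasing_is_cvgn.
  by apply/nondecreasing_seqP => n; rewrite /series/= [leRHS]big_nat_recr//= lerDl.
exists (fine (G w)) => _ [n _ <-]; rewrite -lee_fin fineK//.
rewrite /series/= -sumEFin; exact: nneseries_lim_ge.
Unshelve. all: by end_near. Qed.

Lemma L2_limit (X : nat -> Omega -> R) :
  (forall n, bounded_rv (X n)) -> (forall n w, 0 <= X n w) ->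
  {ae P, forall w, cvgn (X^~ w)} ->
  (forall e : R, 0 < e -> exists N, forall n m, (N <= n)%N -> (N <= m)%N ->
     E (fun w => (X n w - X m w) ^+ 2) <= e) ->
  exists W : Omega -> R, [/\ measurable_fun setT W, (forall w, 0 <= W w),
    {ae P, forall w, X^~ w @ \oo --> W w} &
    (fun n => \int[P]_w ((X n w - W w) ^+ 2)%:E)%E @ \oo --> 0%E].
Proof.
(* The upper limit is measurable and non-negative everywhere, also where [X] fails to converge. *)
move=> bX X0 cX hX; pose W w := fine (limn_esup (fun n => (X n w)%:E)).
have mX n : measurable_fun setT (X n) by have [] := bX n.
have mW : measurable_fun setT W.
  apply: (measurableT_comp (fine_measurable measurableT)).
  by apply: measurable_fun_limn_esup => n; exact/measurable_EFinP.
have cW : {ae P, forall w, X^~ w @ \oo --> W w}.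
  apply: filterS cX => w Xw.
  have XE : (fun n => (X n w)%:E) @ \oo --> (limn (X^~ w))%:E.
    by apply: cvg_EFin; [exact: nearW|exact: Xw].
  by rewrite /W; have [_ ->] := cvg_limn_einf_sup XE.
exists W; split => //.
  move=> w; apply: fine_ge0; rewrite limn_esup_lim.
  apply: lime_ge; first exact: is_cvg_esups.
  near=> n; apply: le_trans (ereal_sup_ubound _); last by exists n => /=.
  by rewrite lee_fin.
have bnd e : 0 < e -> exists N, forall n, (N <= n)%N ->
    (\int[P]_w ((X n w - W w) ^+ 2)%:E <= e%:E)%E.
  move=> e0; have [N hN] := hX e e0; exists N => n Nn.
  pose f m w := ((X n w - X m w) ^+ 2)%:E.
  have mf m : measurable_fun setT (f m).
    by apply/measurable_EFinP; apply: measurable_funX; exact: measurable_funB.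
  have f0 m w : (0 <= f m w)%E by rewrite lee_fin sqr_ge0.
  (* Almost everywhere the integrand is the lower limit in [m] of [(X n - X m) ^ 2], so Fatou passes
     the Cauchy bound to [W]. *)
  rewrite (_ : (\int[P]_w _)%E = (\int[P]_w limn_einf (f^~ w))%E); last first.
    apply: ge0_ae_eq_integral => //.
    - by apply/measurable_EFinP; apply: measurable_funX; exact: measurable_funB.
    - rewrite (_ : (fun x => _) = (fun x => - limn_esup (fun m => - f m x))%E); last first.
        by apply/funext => x; rewrite (limn_esupN (f^~ x)) oppeK.
      apply: measurableT_comp => //; apply: measurable_fun_limn_esup => m.
      exact: measurableT_comp.
    - by move=> w _; rewrite lee_fin sqr_ge0.
    - move=> w _; rewrite limn_einf_lim; apply: lime_ge; first exact: is_cvg_einfs.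
      by apply: nearW => m; apply: le_ereal_inf_tmp => _ [k _ <-].
    - apply: filterS cW => w Xw _.
      have fE : f^~ w @ \oo --> ((X n w - W w) ^+ 2)%:E.
        apply: cvg_EFin; first exact: nearW.
        have h : (fun m => X n w - X m w) @ \oo --> X n w - W w.
          by apply: cvgB => //; exact: cvg_cst.
        exact: (cvgM h h).
      by have [-> _] := cvg_limn_einf_sup fE.
  apply: le_trans (fatou _ _ _ _) _ => //.
  rewrite limn_einf_lim; apply: lime_le; first exact: is_cvg_einfs.
  exists N => // m /= Nm.
  apply: (@le_trans _ _ (\int[P]_x f m x)%E); first by apply: ereal_inf_lbound; exists m => /=.
  rewrite -expectE ?lee_fin ?hN//; apply: bounded_rvX; exact: bounded_rvB.
have i0 n : (0 <= \int[P]_w ((X n w - W w) ^+ 2)%:E)%E.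
  by apply: integral_ge0 => w _; rewrite lee_fin sqr_ge0.
have fin n e : (\int[P]_w ((X n w - W w) ^+ 2)%:E <= e%:E)%E ->
    (\int[P]_w ((X n w - W w) ^+ 2)%:E)%E \is a fin_num.
  by move=> h; rewrite ge0_fin_numE// (le_lt_trans h)// ltry.
apply/fine_cvgP; split.
  by have [N hN] := bnd 1 ltr01; exists N => // n /= /hN /fin.
apply/cvgrPdist_le => e e0; have [N hN] := bnd e e0; exists N => // n /= /hN h.
rewrite sub0r normrN ger0_norm ?fine_ge0// -lee_fin fineK//; exact: fin h.
Unshelve. all: by end_near. Qed.

(** If [W] vanished almost surely, the second moments of [X n] would tend to 0, whereas
    [a <= E (X n)] bounds them below by [a ^ 2]. *)
Lemma L2_limit_positive (X : nat -> Omega -> R) (W : Omega -> R) (a : R) :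
  (forall n, bounded_rv (X n)) -> measurable_fun setT W -> (forall w, 0 <= W w) ->
  (fun n => \int[P]_w ((X n w - W w) ^+ 2)%:E)%E @ \oo --> 0%E ->
  0 < a -> (\forall n \near \oo, a <= E (X n)) ->
  (0 < P [set w | (0 < W w)%R])%E.
Proof.
move=> bX mW W0 cX a0 [N _ hN].
have mS : measurable [set w | 0 < W w].
  rewrite (_ : [set w | 0 < W w] = W @^-1` `]0, +oo[); last first.
    by apply/seteqP; split => w /=; rewrite in_itv/= andbT.
  by rewrite -[X in measurable X]setTI; exact: mW.
rewrite lt_neqAle measure_ge0 andbT; apply/negP => /eqP PS0.
have WE n : (\int[P]_w ((X n w - W w) ^+ 2)%:E)%E = (E (fun w => X n w ^+ 2))%:E.
  have mX : measurable_fun setT (X n) by have [] := bX n.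
  rewrite expectE; last exact: bounded_rvX.
  apply: ge0_ae_eq_integral => //.
  - by apply/measurable_EFinP; apply: measurable_funX; exact: measurable_funB.
  - by apply/measurable_EFinP; apply: measurable_funX.
  - by move=> w _; rewrite lee_fin sqr_ge0.
  - by move=> w _; rewrite lee_fin sqr_ge0.
  - exists [set w | 0 < W w]; split => // w /= h; rewrite lt_neqAle W0 andbT.
    by apply/negP => /eqP Ww; apply: h => _; rewrite -Ww subr0.
have /fine_cvgP[_ /cvgrPdist_lt] := cX; have a2 : 0 < a ^+ 2 by rewrite exprn_gt0.
move=> /(_ _ a2)[N' _ hN'].
pose n := (N + N')%N.
have := hN' n (leq_addl _ _); rewrite /= WE/= sub0r normrN -sqr_norm2.
rewrite ger0_norm ?sqr_ge0// ltNge; apply/negP; rewrite negbK.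
rewrite lerXn2r ?nnegrE ?norm2_ge0 ?(ltW a0)//.
apply: le_trans (hN n (leq_addr _ _)) _ => /=.
apply: le_trans (expect_norm_le_norm2 _ (bX n)).
by apply: expect_le => //; [exact: bounded_rv_norm|move=> w; exact: ler_norm].
Qed.

End Limits.

(** * Convergence of the scaled root degree *)

Section NaturalPowers.
Context {R : realType}.

Lemma cvg_natpowRN (t : R) : 0 < t -> (fun n => (n%:R `^ t)^-1 : R) @ \oo --> (0 : R).
Proof.
move=> t0; apply/cvgrPdist_le => e e0; near=> n.
rewrite sub0r normrN ger0_norm ?invr_ge0 ?powR_ge0//.
have y0 : 0 <= (e^-1) `^ t^-1 by exact: powR_ge0.
have hn : (e^-1) `^ t^-1 <= n%:R by near: n; exact: nbhs_infty_ger.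
rewrite -(invrK e) lef_pV2 ?posrE ?invr_gt0 ?powR_gt0//; last first.
  by apply: lt_le_trans hn; rewrite powR_gt0 ?invr_gt0.
have -> : e^-1 = (e^-1 `^ t^-1) `^ t.
  by rewrite -powRrM mulVf ?gt_eqF// powRr1// invr_ge0 ltW.
by rewrite ge0_ler_powR ?nnegrE// ltW.
Unshelve. all: by end_near. Qed.

Lemma cvg_powS p : (0 < p)%N -> (fun k => k.+1 ^ p)%N @ \oo --> \oo.
Proof.
move=> p0; apply/cvgnyPge => A; exists A => // k /= Ak.
apply: leq_trans Ak _; apply: leq_trans (leqnSn _) _.
by rewrite -{1}(expn1 k.+1) leq_pexp2l.
Qed.

End NaturalPowers.

Section RootDegreeLimit.
Context {R : realType} {d : measure_display} {Omega : measurableType d}.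
Variables (P : probability Omega R) (alpha : R).
Variables (M : nat -> Omega -> nat) (pi : nat -> nat -> R).
Hypothesis alpha_gt : -1 < alpha.
Hypothesis pi_ge0 : forall n k, 0 <= pi n k.
Hypothesis pi_sum : forall n, (0 < n)%N -> \sum_(1 <= k < n.+1) pi n k = 1.
Hypothesis M0 : forall w, M 0 w = 0%N.
Hypothesis M1 : forall w, M 1 w = 1%N.
Hypothesis M_step : forall n w, (0 < n)%N ->
  M n.+1 w = M n w \/ M n.+1 w = (M n w).+1.
Hypothesis M_bounded : forall n, bounded_rv (fun w => (M n w)%:R : R).
Hypothesis increment_mean : forall n (F : Omega -> R), (0 < n)%N ->
  bounded_rv F -> adapted M n F ->
  expect P (fun w => F w * increment M n w) =
  expect P (fun w => F w * mean_increment alpha M pi n w).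
Variables K K' : R.
Hypothesis drift_sum : forall n, \sum_(1 <= j < n) drift_bound alpha pi j <= K.
Hypothesis drift_le : forall n, (0 < n)%N -> n%:R * drift_bound alpha pi n <= K'.

Local Notation c := (normaliser alpha).
Local Notation E := (expect P).
Local Notation N2 := (norm2 P).
Local Notation theta := ((2 + alpha)^-1).
Local Notation Y := (scaled_degree alpha M).
Local Notation sig := (drift_bound alpha pi).
Local Notation del := (noise_bound alpha).

Let t0 : 0 < theta := theta_gt0 alpha_gt.
Let t1 : theta < 1 := theta_lt1 alpha_gt.
Let c0 := normaliser_gt0 alpha_gt.
Let sig0 := drift_bound_ge0 alpha_gt pi_ge0.
Let del0 := noise_bound_ge0 alpha_gt.

Let X n w : R := (M n w)%:R / n%:R `^ theta.

Let bY n : bounded_rv (Y n).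
Proof. exact: bounded_scaled_degree. Qed.

Let bX n : bounded_rv (X n).
Proof. by rewrite /X; under eq_fun do rewrite mulrC; exact: bounded_rvZ. Qed.

Let XE n w : (0 < n)%N ->
  X n w = (c n / n%:R `^ theta) * Y n w - alpha * (n%:R `^ theta)^-1.
Proof.
move=> n0; have nt : 0 < n%:R `^ theta :> R by rewrite powR_gt0// ltr0n.
by rewrite /X /scaled_degree /shifted_degree; field; rewrite !gt_eqF.
Qed.

Let M_mono m n w : (m <= n)%N -> (M m w)%:R <= (M n w)%:R :> R.
Proof.
apply: (@homo_leq _ (fun n => (M n w)%:R : R) _ (@lexx _ _) (@le_trans _ _)).
case=> [|k]; rewrite ler_nat ?M0//.
by case: (M_step w (ltn0Sn k)) => ->.
Qed.

Lemma scaled_degree_cauchy (e : R) : 0 < e -> exists2 N, (0 < N)%N &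
  forall n m, (N <= n)%N -> (N <= m)%N -> N2 (fun w => Y m w - Y n w) <= e.
Proof.
move=> e0.
have [C C_gt0 hC] := norm2_scaled_degree_diff alpha_gt pi_ge0 pi_sum M1 M_step
  M_bounded increment_mean drift_sum drift_le.
have [Cd hd] := noise_bound_summable alpha_gt.
have hsum n : \sum_(1 <= j < n) (sig j + del j) <= K + Cd.
  by rewrite big_split/= lerD.
have sd0 j : 0 <= sig j + del j by rewrite addr_ge0.
have e1 : 0 < e / 2 / C by rewrite !divr_gt0.
have e2 : 0 < (e / 2) ^+ 2 / C by rewrite divr_gt0// exprn_gt0// divr_gt0.
have [N1 N1_gt0 h1] := nneg_sum_cauchy sd0 hsum e1.
have [N2' N2_gt0 h2] := nneg_sum_cauchy del0 hd e2.
suff h n m : (N1 + N2' <= n)%N -> (n <= m)%N -> N2 (fun w => Y m w - Y n w) <= e.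
  exists (N1 + N2')%N => [|n m Nn Nm]; first by rewrite addn_gt0 N1_gt0.
  have [nm|/ltnW mn] := leqP n m; first exact: h.
  apply: le_trans (h _ _ Nm mn); apply: norm2_le_mono => [||w].
  - exact: bounded_rvB.
  - exact: bounded_rvB.
  - by rewrite distrC.
move=> Nn nm; have n0 : (0 < n)%N by apply: leq_trans Nn; rewrite addn_gt0 N1_gt0.
apply: le_trans (hC _ _ n0 nm) _.
have h1' := h1 n m (leq_trans (leq_addr _ _) Nn) nm.
have h2' := h2 n m (leq_trans (leq_addl _ _) Nn) nm.
have -> : e = e / 2 + e / 2 by field.
apply: lerD; first by rewrite mulrC -ler_pdivlMr.
have e20 : 0 <= e / 2 by rewrite divr_ge0// ltW.
rewrite -[leRHS]ger0_norm// -sqrtr_sqr; apply: ler_wsqrtr.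
by rewrite mulrC -ler_pdivlMr.
Qed.

Lemma scaled_degree_subseq_cvg : exists2 p, (0 < p)%N &
  {ae P, forall w, cvgn (fun k => Y (k.+1 ^ p)%N w)}.
Proof.
have [C C_gt0 hC] := norm2_scaled_degree_diff alpha_gt pi_ge0 pi_sum M1 M_step
  M_bounded increment_mean drift_sum drift_le.
have [Cd hd] := noise_bound_summable alpha_gt.
have a2 : 0 < 2 + alpha by rewrite -invr_gt0.
(* [p >= 4 / theta] makes [(k+1) ^ 2] at most [j ^ (theta / 2)] for all [j] in block [k]; as
   [del j <= j ^ (-1 - theta)], a summable power of [j] remains. *)
have [p hp] : exists p : nat, 4 * (2 + alpha) <= p%:R.
  by exists (Num.truncn (4 * (2 + alpha))).+1; rewrite ltW// truncnS_gt.
have p0 : (0 < p)%N by rewrite -(ltr0n R); apply: lt_le_trans hp; rewrite mulr_gt0.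
exists p => //.
pose h k := (k.+1 ^ p)%N.
have hmono : {homo h : x y / (x <= y)%N} by move=> x y xy; rewrite /h leq_exp2r.
have h0 k : (0 < h k)%N by rewrite expn_gt0.
pose F k w := Y (h k.+1) w - Y (h k) w.
have bF k : bounded_rv (F k) by exact: bounded_rvB.
have [|C1 hC1] := @sum_powRN_bounded R (theta / 2); first by move: t0 t1; lra.
have [|C2 hC2] := @sum_powRN_bounded R 1; first lra.
have sqh k j : (h k <= j)%N -> k.+1%:R ^+ 2 <= j%:R `^ (theta / 2) :> R.
  move=> hkj; apply: (@le_trans _ _ ((h k)%:R `^ (theta / 2))); last first.
    by rewrite ge0_ler_powR ?nnegrE ?ler_nat// divr_ge0// ltW.
  rewrite /h natrX -powR_mulrn// -[X in _ <= X `^ _]powR_mulrn// -powRrM.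
  apply: ler_powR; first by rewrite ler1n.
  rewrite mulrA ler_pdivlMr// -ler_pdivrMr// invrK; move: hp; lra.
have hs : forall n, \sum_(0 <= k < n) E (fun w => `|F k w|) <=
    C * (K + Cd) + C * C1 + C2.
  move=> n; apply: (@le_trans _ _ (\sum_(0 <= k < n)
      (C * \sum_(h k <= j < h k.+1) (sig j + del j) +
      (C * \sum_(h k <= j < h k.+1) j%:R `^ (-1 - theta / 2) + k.+1%:R `^ (- 1 - 1))))).
    apply: ler_sum => k _; apply: le_trans (expect_norm_le_norm2 _ (bF k)) _.
    apply: le_trans (hC _ _ (h0 k) (hmono _ _ (leqnSn k))) _.
    rewrite lerD2l; have k0R : 0 < k.+1%:R :> R by rewrite ltr0n.
    apply: le_trans (sqrtr_le_weighted _ k0R) _.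
      by rewrite mulr_ge0 ?(ltW C_gt0)// sumr_ge0.
    have -> : -1 - 1 = - 2%:R :> R by ring.
    rewrite powRN powR_mulrn// lerD2r mulrCA ler_pM2l// mulr_sumr.
    rewrite !big_nat; apply: ler_sum => j /andP[hkj _].
    have j0 : 0 < j%:R :> R by rewrite ltr0n (leq_trans (h0 k)).
    apply: (@le_trans _ _ (j%:R `^ (theta / 2) * (j%:R * j%:R `^ theta)^-1)).
      apply: ler_pM; rewrite ?sqr_ge0 ?sqh//.
      rewrite lef_pV2 ?posrE ?mulr_gt0 ?powR_gt0// ler_pM2l//.
      by apply: normaliser_ge_powR => //; rewrite -(ltr0n R).
    apply: eq_ler; rewrite -{2}(powRr1 (ltW j0)) -powRD ?(gt_eqF j0) ?implybT//.
    rewrite -powRN -powRD ?(gt_eqF j0) ?implybT//; congr (_ `^ _).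
    by field; rewrite gt_eqF.
  rewrite big_split/= big_split/= -!mulr_sumr -[leRHS]addrA !sum_blocks// /h exp1n.
  apply: lerD; first by rewrite ler_pM2l// big_split/= lerD.
  apply: lerD; first by rewrite ler_pM2l.
  have := hC2 n.+1; rewrite big_add1/=; exact.
have := ae_series_cvg bF hs; apply: filterS => w Fw.
have YE : (fun k => Y (h k) w) = (fun n => series (F^~ w) n + Y 1 w).
  apply/funext => n; rewrite /series/= /F.
  rewrite (telescope_sumr (fun k => Y (h k) w))// /h exp1n; ring.
rewrite -/h YE; apply: is_cvgD => //; exact: is_cvg_cst.
Qed.

Lemma root_degree_limit : exists W : Omega -> R,
  [/\ measurable_fun setT W, (forall w, 0 <= W w),
      (0 < P [set w | (0 < W w)%R])%E,
      {ae P, forall w, (fun n => (M n w)%:R / n%:R `^ theta) @ \oo --> W w} &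
      (fun n => \int[P]_w (((M n w)%:R / n%:R `^ theta - W w) ^+ 2)%:E)%E
        @ \oo --> 0%E].
Proof.
have [l l1 cl] := normaliser_ratio_cvg alpha_gt.
have cN := cvg_natpowRN t0.
have X0 n w : 0 <= X n w by rewrite divr_ge0// powR_ge0.
have cX : {ae P, forall w, cvgn (X^~ w)}.
  have [p p0] := scaled_degree_subseq_cvg; apply: filterS => w /cvg_ex[y Yy].
  apply/cvg_ex; exists (l * y - alpha * 0).
  apply: (@cvg_power_subseq _ (fun n => (M n w)%:R) _ _ p p0 (ltW t0)).
  - by move=> m n; exact: M_mono.
  - by [].
  rewrite (_ : (fun k => _) = (fun k => X (k.+1 ^ p)%N w))//.
  under eq_fun do rewrite XE ?expn_gt0//.
  apply: cvgB; [apply: cvgM => //|apply: cvgM; first exact: cvg_cst].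
    exact: (@cvg_comp _ _ _ (fun k => (k.+1 ^ p)%N) (fun n => c n / n%:R `^ theta)
      _ _ _ (cvg_powS p0) cl).
  exact: (@cvg_comp _ _ _ (fun k => (k.+1 ^ p)%N) (fun n => (n%:R `^ theta)^-1)
    _ _ _ (cvg_powS p0) cN).
have [C2 C2_gt0 h2] := norm2_shifted_degree_le alpha_gt pi_ge0 pi_sum M1 M_step
  M_bounded increment_mean drift_sum drift_le.
have nY n : (0 < n)%N -> N2 (Y n) <= C2.
  move=> n0; rewrite /scaled_degree; under eq_fun do rewrite mulrC.
  rewrite norm2Z ?gtr0_norm ?invr_gt0//; last exact: bounded_shifted_degree.
  by rewrite mulrC ler_pdivrMr// h2.
have cauchy : forall e : R, 0 < e -> exists N, forall n m, (N <= n)%N -> (N <= m)%N ->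
     E (fun w => (X n w - X m w) ^+ 2) <= e.
  (* [Q] adds up the factors of [q] in [g1], [g2] and [f3]; the minimum with 1 in [q] keeps the
     ratio [rn] below [l + 1]. *)
  move=> e e0; pose Q := l + 1 + 2 * C2 + 2 * `|alpha|.
  have Q0 : 0 < Q by have := normr_ge0 alpha; rewrite /Q; move: C2_gt0 l1; lra.
  have se0 : 0 < Num.sqrt e by rewrite sqrtr_gt0.
  pose q := Num.min 1 (Num.sqrt e / Q).
  have q0 : 0 < q by rewrite lt_min ltr01 divr_gt0.
  have [N1 N1_gt0 h1] := scaled_degree_cauchy q0.
  move/cvgrPdist_le : cl => /(_ _ q0)[N3 _ h3].
  move/cvgrPdist_le : cN => /(_ _ q0)[N4 _ h4].
  exists (N1 + N3 + N4)%N => n m Nn Nm.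
  have n0 : (0 < n)%N by apply: leq_trans Nn; rewrite -addnA addn_gt0 N1_gt0.
  have m0 : (0 < m)%N by apply: leq_trans Nm; rewrite -addnA addn_gt0 N1_gt0.
  have le1 : (N1 <= N1 + N3 + N4)%N by rewrite -addnA leq_addr.
  have le3 : (N3 <= N1 + N3 + N4)%N by rewrite addnAC leq_addl.
  have le4 : (N4 <= N1 + N3 + N4)%N by exact: leq_addl.
  have h1' := h1 m n (leq_trans le1 Nm) (leq_trans le1 Nn).
  have := h3 n (leq_trans le3 Nn); have := h3 m (leq_trans le3 Nm).
  have := h4 n (leq_trans le4 Nn); have := h4 m (leq_trans le4 Nm).
  rewrite /= !sub0r !normrN => k1 k2 k3 k4.
  rewrite -sqr_norm2 -[leRHS]sqr_sqrtr ?(ltW e0)//.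
  rewrite lerXn2r ?nnegrE ?norm2_ge0 ?sqrtr_ge0//.
  apply: (@le_trans _ _ (q * Q)); last by rewrite -ler_pdivlMr// ge_min lexx orbT.
  set rn := c n / _ in k4; set rm := c m / _ in k3.
  set an := (n%:R `^ _)^-1 in k2; set am := (m%:R `^ _)^-1 in k1.
  have -> : (fun w => X n w - X m w) = (fun w => rn * (Y n w - Y m w) +
      ((rn - rm) * Y m w + alpha * (am - an))).
    by apply/funext => w; rewrite !XE// -/rn -/rm -/an -/am; ring.
  have bYY := bounded_rvB (bY n) (bY m).
  apply: le_trans (norm2D _ _ _) _; [exact: bounded_rvZ| |].
    by apply: bounded_rvD; [exact: bounded_rvZ|exact: bounded_rv_cst].
  apply: le_trans (lerD (lexx _) (norm2D _ _ _)) _; [exact: bounded_rvZ|exact: bounded_rv_cst|].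
  rewrite norm2_cst !norm2Z//.
  have q1 : q <= 1 by rewrite ge_min lexx.
  have f1 : `|rn| <= l + 1.
    have := ler_normD (rn - l) l; rewrite subrK distrC (ger0_norm (_ : 0 <= l)); last lra.
    by move: k4 q1; lra.
  have f2 : `|rn - rm| <= 2 * q.
    by have := ler_distD l rn rm; rewrite (distrC rn l); move: k3 k4; lra.
  have f3 : `|alpha * (am - an)| <= `|alpha| * (2 * q).
    rewrite normrM ler_wpM2l//; have := ler_normB am an; move: k1 k2; lra.
  have g1 : `|rn| * N2 (fun w => Y n w - Y m w) <= (l + 1) * q.
    by apply: ler_pM; rewrite ?norm2_ge0.
  have g2 : `|rn - rm| * N2 (Y m) <= 2 * q * C2.
    by apply: ler_pM; rewrite ?norm2_ge0 ?nY.
  by apply: le_trans (lerD g1 (lerD g2 f3)) _; rewrite /Q; apply: eq_ler; ring.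
have [W [mW W0 cW lW]] := L2_limit bX X0 cX cauchy.
exists W; split => //.
have ap : 0 < (1 + alpha) / 2 by rewrite divr_gt0//; move: alpha_gt; lra.
apply: (L2_limit_positive bX mW W0 lW ap).
(* Makes the shift [alpha / n^theta] at most half of the lower bound [1 + alpha] for the scaled
   mean, so the other half remains. *)
pose q := (1 + alpha) / 2 / (`|alpha| + 1).
have q0 : 0 < q by rewrite divr_gt0// ltr_wpDl.
move/cvgrPdist_le : cN => /(_ _ q0)[N4 _ h4].
exists N4.+1 => // n /= Nn; have n0 : (0 < n)%N by exact: leq_trans Nn.
have := h4 n (ltnW Nn); rewrite /= sub0r normrN => k1.
have nt : 0 < n%:R `^ theta :> R by rewrite powR_gt0// ltr0n.
have hE := expect_shifted_degree_ge alpha_gt pi_ge0 pi_sum M1 M_bounded increment_mean n0.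
have -> : X n = fun w => (n%:R `^ theta)^-1 * shifted_degree alpha M n w -
    alpha * (n%:R `^ theta)^-1.
  by apply/funext => w; rewrite /X /shifted_degree; ring.
have bZ : bounded_rv (shifted_degree alpha M n) by exact: bounded_shifted_degree.
rewrite expectB; [|exact: bounded_rvZ|exact: bounded_rv_cst].
rewrite expect_cst expectZ//.
have hc := normaliser_ge_powR alpha_gt n0.
have f1 : 1 + alpha <= (n%:R `^ theta)^-1 * expect P (shifted_degree alpha M n).
  rewrite mulrC ler_pdivlMr//; apply: le_trans hE; rewrite ler_pM2l//.
  by move: alpha_gt; lra.
have f2 : alpha * (n%:R `^ theta)^-1 <= (1 + alpha) / 2.
  apply: le_trans (ler_norm _) _; rewrite normrM.
  have : q * (`|alpha| + 1) = (1 + alpha) / 2 by rewrite /q mulfVK// gt_eqF// ltr_wpDl.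
  move=> <-; have := normr_ge0 alpha; move: k1 q0; set z := `|_ ^-1|; nra.
lra.
Qed.

End RootDegreeLimit.

(** * The tree process *)

Section Tree.
Context {R : realType}.
Variables (alpha beta : R) (xs us : nat -> R).
Implicit Types (k m n : nat) (x u : R).

Local Notation f := (fun k : nat => k%:R + alpha).
Local Notation parents := (tree_parents f beta xs us).
Local Notation M := (proc_deg f beta xs us 1).

Lemma lagged_time_gt0 n x : (0 < lagged_time beta n x)%N.
Proof. by rewrite leq_max. Qed.

Lemma lagged_time_le n x : (0 < n)%N -> 0 <= x -> (lagged_time beta n x <= n)%N.
Proof.
move=> n0 x0; rewrite geq_max n0/= -[leqRHS](@natrK R); apply: le_truncn.
by rewrite lerBlDr lerDl mulr_ge0// powR_ge0.
Qed.

Lemma size_tree_parents n : size (parents n) = n.-1.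
Proof.
elim: n => //= -[//|[//|n]] ih.
by rewrite size_rcons ih.
Qed.

Lemma tree_parentsS n : (1 < n)%N -> parents n.+1 =
  let m := lagged_time beta n (xs n.+1) in
  rcons (parents n) (choose_parent f (take m.-1 (parents n)) m (us n.+1)).
Proof. by case: n => // -[]. Qed.

(** Later vertices only append to the parent list, so the truncated list handed to [choose_parent]
    is the tree at the lagged time. *)
Lemma take_tree_parents k n : (k <= n)%N -> take k.-1 (parents n) = parents k.
Proof.
elim: n => [|n ih]; first by rewrite leqn0 => /eqP ->.
rewrite leq_eqVlt => /predU1P[->|]; first by rewrite -size_tree_parents take_size.
rewrite ltnS => kn; rewrite -ih//.
have [n1|n1] := leqP n 1.
  by case: n n1 kn {ih} => [|[|//]] _; case: k => [|[|]].
rewrite tree_parentsS//= -cats1 takel_cat// size_tree_parents; lia.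
Qed.

Lemma root_degreeE n : (0 < n)%N -> M n = (count (pred1 1%N) (parents n)).+1.
Proof.
by move=> n0; rewrite /proc_deg /tdeg n0/= -size_tree_parents take_size.
Qed.

Lemma root_degreeS n : (1 < n)%N -> M n.+1 = (M n + (choose_parent f
  (take (lagged_time beta n (xs n.+1)).-1 (parents n))
  (lagged_time beta n (xs n.+1)) (us n.+1) == 1%N))%N.
Proof.
move=> n1; rewrite !root_degreeE ?(ltnW n1)// tree_parentsS//= -cats1 count_cat/=.
by rewrite addn0.
Qed.

Lemma root_degree1 : M 1 = 1%N. Proof. by []. Qed.

Lemma choose_parent_bounds (p : seq nat) m u : (0 < m)%N ->
  (0 < choose_parent f p m u <= m)%N.
Proof. by move=> m0; rewrite /choose_parent leq_min m0 geq_minl. Qed.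

Lemma choose_parent_lag1 (p : seq nat) u : choose_parent f p 1 u = 1%N.
Proof. by have /andP[a b] := choose_parent_bounds p u (ltn0Sn 0); apply/eqP; rewrite eqn_leq b. Qed.

(** The root comes first in the inverse transform order, so only the first partial sum matters. A
    tree with one vertex is excluded: there the cap [minn m] returns the root for every [u]. *)
Lemma choose_parent_root (p : seq nat) m u : (1 < m)%N ->
  (choose_parent f p m u == 1%N) =
  (u * (\sum_(1 <= i < m.+1) f (tdeg p m i)) < f (tdeg p m 1)).
Proof.
case: m => // m m1; rewrite /choose_parent/= big_nat1; case: ifPn => _.
  by rewrite minnSS minn0.
by rewrite minnSS eqSS; apply/negbTE; rewrite -lt0n leq_min -ltnS m1.
Qed.

Lemma sum_count (p : seq nat) m : all (fun i => 0 < i <= m)%N p ->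
  (\sum_(1 <= i < m.+1) count (pred1 i) p = size p)%N.
Proof.
elim: p => [_|x p ih /= /andP[/andP[x0 xm] hp]]; first by rewrite big1.
rewrite big_split/= ih// (bigD1_seq x)/= ?mem_index_iota ?x0 ?ltnS ?iota_uniq//.
by rewrite eqxx big1 ?addn0// => i /negbTE; rewrite eq_sym => ->.
Qed.

(** The degrees sum to [2 m - 1]: one for each vertex and one for each of the [m - 1] edges. *)
Lemma tree_weight m (p : seq nat) : (0 < m)%N -> size p = m.-1 ->
  all (fun i => 0 < i <= m)%N p ->
  \sum_(1 <= i < m.+1) f (tdeg p m i) = total_weight alpha m.
Proof.
move=> m0 sp ap; rewrite big_split/= big_const_nat subSS subn0 iter_addr_0.
rewrite -natr_sum (_ : (\sum_(1 <= i < m.+1) tdeg p m i)%N = (m.-1 + m)%N).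
  rewrite /total_weight natrD -subn1 natrB// -mulr_natr; ring.
rewrite big_nat (eq_bigr (fun i => count (pred1 i) p + 1)%N) => [|i].
  by rewrite -big_nat big_split/= sum_count// sp sum_nat_const_nat muln1 subSS subn0.
by rewrite ltnS /tdeg => ->; rewrite -sp take_size addn1.
Qed.

Hypothesis alpha_gt : -1 < alpha.
Hypothesis xs_ge0 : forall k, 0 <= xs k.
Hypothesis us01 : forall k, 0 <= us k < 1.

Lemma all_tree_parents n : all (fun i => 0 < i <= n)%N (parents n).
Proof.
elim: n => // -[//|[//|n]] ih.
rewrite tree_parentsS//= all_rcons; apply/andP; split.
  have /andP[-> h] := choose_parent_bounds (take (lagged_time beta n.+2 (xs n.+3)).-1 (parents n.+2))
    (us n.+3) (lagged_time_gt0 n.+2 (xs n.+3)).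
  rewrite (leq_trans h)//; apply: leq_trans (lagged_time_le _ _) _ => //.
by apply: sub_all ih => i /andP[-> h]; rewrite (leq_trans h).
Qed.

Lemma root_degree_step n : (0 < n)%N ->
  M n.+1 = (M n + (us n.+1 * total_weight alpha (lagged_time beta n (xs n.+1)) <
    (M (lagged_time beta n (xs n.+1)))%:R + alpha)%R)%N.
Proof.
move=> n0; set m := lagged_time beta n _.
have m0 : (0 < m)%N by exact: lagged_time_gt0.
have mn : (m <= n)%N by exact: lagged_time_le.
have ap : 0 < 1 + alpha by move: alpha_gt; lra.
(* At lag 1 the inequality always holds, as the uniform variable is below 1. Hence the recursion
   also covers the deterministic step from time 1 to time 2. *)
have hlag1 : us n.+1 * total_weight alpha 1 < (M 1)%:R + alpha.
  rewrite total_weight1 root_degree1 gtr_pMl//.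
  by have /andP[] := us01 n.+1.
have [n1|n1] := leqP n 1.
  have nE : n = 1%N by lia.
  have -> : m = 1%N by lia.
  by rewrite nE in hlag1 *; rewrite hlag1.
rewrite root_degreeS// -/m; congr (_ + nat_of_bool _)%N.
have [m1|m1] := leqP m 1.
  have -> : m = 1%N by lia.
  by rewrite hlag1 choose_parent_lag1.
rewrite choose_parent_root// take_tree_parents// tree_weight//.
- exact: size_tree_parents.
- exact: all_tree_parents.
Qed.

End Tree.

(** * Measurability of variables with countably many values *)

Section DiscreteMeasurability.
Context {d : measure_display} {T : measurableType d}.

Definition discrete_measurable (S : Type) (g : T -> S) :=
  forall A : set S, measurable (g @^-1` A).

Lemma discrete_measurable1 (S : countType) (g : T -> S) :
  (forall x, measurable (g @^-1` [set x])) -> discrete_measurable g.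
Proof.
move=> mg A; rewrite (_ : g @^-1` A = \bigcup_(x : S) (if pselect (A x) then g @^-1` [set x] else set0)).
  apply: countable_bigcupT_measurable; first exact: countableP.
  by move=> x; case: pselect => _ /=; [exact: mg|exact: measurable0].
apply/seteqP; split => [w Aw|w [x _]]; first by exists (g w) => //; case: pselect.
by case: pselect => //= Ax ->.
Qed.

Lemma discrete_measurable_cst (S : Type) (x : S) : discrete_measurable (fun=> x).
Proof.
by move=> A; rewrite preimage_cst; case: ifP => _; [exact: measurableT|exact: measurable0].
Qed.

Lemma discrete_measurable_bind (S S' : countType) (g : T -> S) (h : S -> T -> S') :
  discrete_measurable g -> (forall x, discrete_measurable (h x)) ->
  discrete_measurable (fun w => h (g w) w).
Proof.
move=> mg mh A.
rewrite (_ : _ @^-1` A = \bigcup_(x : S) (g @^-1` [set x] `&` h x @^-1` A)).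
  apply: countable_bigcupT_measurable; first exact: countableP.
  by move=> x; apply: measurableI; [exact: mg|exact: mh].
by apply/seteqP; split => [w Aw|w [x _ [/= -> //]]]; exists (g w).
Qed.

Lemma discrete_measurable_comp (S S' : Type) (g : T -> S) (h : S -> S') :
  discrete_measurable g -> discrete_measurable (fun w => h (g w)).
Proof. by move=> mg A; exact: (mg (h @^-1` A)). Qed.

Lemma discrete_measurable_realfun (R : realType) (S : Type) (g : T -> S) (h : S -> R) :
  discrete_measurable g -> measurable_fun setT (fun w => h (g w)).
Proof. by move=> mg _ Y mY; rewrite setTI; exact: (mg (h @^-1` Y)). Qed.

Lemma discrete_measurable_bool (b : T -> bool) : measurable [set w | b w] ->
  discrete_measurable b.
Proof.
move=> mb; apply: discrete_measurable1 => -[].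
  by rewrite (_ : _ @^-1` _ = [set w | b w]).
rewrite (_ : _ @^-1` _ = ~` [set w | b w]); first exact: measurableC.
by apply/seteqP; split => w /=; case: (b w).
Qed.

Lemma discrete_measurable_ltr (R : realType) (F G : T -> R) :
  measurable_fun setT F -> measurable_fun setT G ->
  discrete_measurable (fun w => F w < G w).
Proof.
move=> mF mG; apply: discrete_measurable_bool.
have := measurable_fun_ltr mF mG measurableT (Y := [set true]).
by rewrite setTI; apply.
Qed.

Lemma discrete_measurable_truncn (R : realType) (F : T -> R) :
  measurable_fun setT F -> discrete_measurable (fun w => Num.truncn (F w)).
Proof.
move=> mF; apply: discrete_measurable1 => k.
have mlt n : measurable [set w | F w < n%:R].
  have := discrete_measurable_ltr mF (measurable_cst (n%:R : R)) [set true].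
  by apply.
rewrite (_ : _ @^-1` _ = [set w | F w < k.+1%:R] `&`
    (if k is 0 then setT else ~` [set w | F w < k%:R])).
  by apply: measurableI => //; case: k => // k; exact: measurableC.
apply/seteqP; split => [w /= <-|w].
  split; first exact: truncnS_gt.
  case E : (Num.truncn _) => [//|k'] /=; rewrite -E.
  apply/negP; rewrite -leNgt truncn_le; apply: le_trans ler01 _.
  by rewrite -truncn_gt0 E.
case: k => [|k] /= [h1 h2].
  by apply/eqP; rewrite -leqn0 truncn_le_nat.
apply: truncn_def; rewrite h1 andbT leNgt; exact/negP.
Qed.

Lemma discrete_measurable_find (S : Type) (a : S -> T -> bool) (r : seq S) :
  (forall i, discrete_measurable (a i)) ->
  discrete_measurable (fun w => find (a^~ w) r).
Proof.
move=> ma; elim: r => [|x r ih] /=; first exact: discrete_measurable_cst.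
apply: (discrete_measurable_bind (h := fun b w => if b then 0%N else (find (a^~ w) r).+1)) => //.
case; first exact: discrete_measurable_cst.
exact: (discrete_measurable_comp succn ih).
Qed.

End DiscreteMeasurability.

Section TreeMeasurability.
Context {R : realType} {d : measure_display} {T : measurableType d}.
Variables (f : nat -> R) (beta : R) (xs us : nat -> T -> R).
Hypothesis mxs : forall k, measurable_fun setT (xs k).
Hypothesis mus : forall k, measurable_fun setT (us k).

Lemma discrete_measurable_lagged_time n (F : T -> R) : measurable_fun setT F ->
  discrete_measurable (fun w => lagged_time beta n (F w)).
Proof.
move=> mF; apply: (discrete_measurable_comp (maxn 1)).
apply: discrete_measurable_truncn; apply: measurable_funB => //.
by apply: measurable_funM.
Qed.

Lemma discrete_measurable_choose_parent (p : seq nat) m (F : T -> R) :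
  measurable_fun setT F ->
  discrete_measurable (fun w => choose_parent f p m (F w)).
Proof.
move=> mF; apply: (discrete_measurable_comp (fun k => minn m k.+1)).
apply: (discrete_measurable_find (a := fun i w => F w * _ < _)) => i.
by apply: discrete_measurable_ltr => //; exact: measurable_funM.
Qed.

Lemma discrete_measurable_tree_parents n :
  discrete_measurable (fun w => tree_parents f beta (xs^~ w) (us^~ w) n).
Proof.
elim: n => [|n ih]; first exact: discrete_measurable_cst.
have [n1|n1] := leqP n 1.
  by case: n n1 {ih} => [|[|//]] _; exact: discrete_measurable_cst.
rewrite (_ : (fun w => _) = (fun w =>
  let p := tree_parents f beta (xs^~ w) (us^~ w) n in
  let m := lagged_time beta n (xs n.+1 w) in
  rcons p (choose_parent f (take m.-1 p) m (us n.+1 w)))); last first.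
  by apply/funext => w /=; rewrite leqNgt n1.
apply: (discrete_measurable_bind (h := fun p w =>
  rcons p (choose_parent f (take (lagged_time beta n (xs n.+1 w)).-1 p)
   (lagged_time beta n (xs n.+1 w)) (us n.+1 w)))) => // p.
apply: (discrete_measurable_bind (h := fun m w =>
  rcons p (choose_parent f (take m.-1 p) m (us n.+1 w)))).
  exact: discrete_measurable_lagged_time.
move=> m; apply: (discrete_measurable_comp (rcons p)).
exact: discrete_measurable_choose_parent.
Qed.

Lemma discrete_measurable_proc_deg i n :
  discrete_measurable (fun w => proc_deg f beta (xs^~ w) (us^~ w) i n).
Proof.
apply: (discrete_measurable_comp (fun p => tdeg p n i)).
exact: discrete_measurable_tree_parents.
Qed.

End TreeMeasurability.

(** * Independence and the conditional mean of the increments *)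

Section Independence.
Context {R : realType} {d : measure_display} {Omega : measurableType d}.
Variables (P : probability Omega R) (X : (nat + nat)%type -> Omega -> R).
Hypothesis mX : forall i, measurable_fun setT (X i).
Hypothesis indX : mutually_independent P X.
Implicit Types (F G : Omega -> R) (n : nat) (s : seq (nat + nat)%type)
  (B : (nat + nat)%type -> set R).
Local Notation E := (expect P).

Definition rect s B : set Omega := \bigcap_(i in [set` s]) (X i @^-1` B i).

Definition later n (i : (nat + nat)%type) : bool :=
  match i with inl k | inr k => (n < k)%N end.

(** Independence of the variables after time [n], tested on rectangles, the form in which
    [mutually_independent] is given. The property survives linear combinations and, by
    [independent_of_later_step], one step of the process. *)
Definition independent_of_later n F :=
  forall s B, uniq s -> all (later n) s -> (forall i, measurable (B i)) ->
  E (fun w => F w * \1_(rect s B) w) = E F * E \1_(rect s B).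

Lemma measurable_preimage i A : measurable A -> measurable (X i @^-1` A).
Proof. by move=> mA; rewrite -[X in measurable X]setTI; exact: mX. Qed.

Lemma rect_cons i s B : rect (i :: s) B = X i @^-1` B i `&` rect s B.
Proof.
apply/seteqP; split => [w h|w [h1 h2] j /=].
  split; first by apply: h; rewrite /= mem_head.
  by move=> j /= js; apply: h; rewrite /= inE js orbT.
by rewrite inE => /predU1P[->//|js]; exact: h2.
Qed.

Lemma measurable_rect s B : (forall i, measurable (B i)) -> measurable (rect s B).
Proof.
move=> mB; elim: s => [|i s ih].
  rewrite (_ : rect _ _ = setT); first exact: measurableT.
  by apply/seteqP; split => // w _ i /=; rewrite in_nil.
by rewrite rect_cons; apply: measurableI => //; exact: measurable_preimage.
Qed.

Lemma expect_rect s B : uniq s -> (forall i, measurable (B i)) ->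
  E \1_(rect s B) = \prod_(i <- s) E \1_(X i @^-1` B i).
Proof.
move=> us mB; apply: EFin_inj; rewrite expect_indic; last exact: measurable_rect.
rewrite indX// -prodEFin; apply: eq_bigr => i _.
by rewrite expect_indic//; exact: measurable_preimage.
Qed.

Lemma independent_of_later_cst n (a : R) : independent_of_later n (fun=> a).
Proof.
move=> s B _ _ mB; rewrite expectZ ?expect_cst//.
exact/bounded_rv_indic/measurable_rect.
Qed.

Lemma independent_of_laterZ n (a : R) F : bounded_rv F ->
  independent_of_later n F -> independent_of_later n (fun w => a * F w).
Proof.
move=> bF iF s B us ls mB; under eq_fun do rewrite -mulrA.
rewrite !expectZ ?iF ?mulrA//.
by apply: bounded_rvM => //; exact/bounded_rv_indic/measurable_rect.
Qed.

Lemma independent_of_later_sum n (I : eqType) (r : seq I) (F : I -> Omega -> R) :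
  (forall i, bounded_rv (F i)) -> (forall i, independent_of_later n (F i)) ->
  independent_of_later n (fun w => \sum_(i <- r) F i w).
Proof.
move=> bF iF s B us ls mB; under eq_fun do rewrite mulr_suml.
rewrite !expect_sum//.
  by rewrite mulr_suml; apply: eq_bigr => i _; exact: iF.
by move=> i _; apply: bounded_rvM => //; exact/bounded_rv_indic/measurable_rect.
Qed.

Lemma expect_independent_step n F A A' : independent_of_later n F ->
  measurable A -> measurable A' ->
  E (fun w => F w * (\1_(X (inl n.+1) @^-1` A) w * \1_(X (inr n.+1) @^-1` A') w)) =
  E F * (E \1_(X (inl n.+1) @^-1` A) * E \1_(X (inr n.+1) @^-1` A')).
Proof.
move=> iF mA mA'.
pose B (i : (nat + nat)%type) := if i is inl _ then A else A'.
have mB i : measurable (B i) by case: i.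
have := iF [:: inl n.+1; inr n.+1] B isT _ mB.
rewrite /= ltnSn => /(_ isT); rewrite expect_rect// !big_cons big_nil mulr1/=.
move=> <-; congr expect; apply/funext => w.
rewrite !rect_cons (_ : rect [::] B = setT) ?setIT ?indicI//.
by apply/seteqP; split => // w' _ i /=; rewrite in_nil.
Qed.

Lemma independent_of_later_step n F A A' : independent_of_later n F ->
  measurable A -> measurable A' ->
  independent_of_later n.+1
    (fun w => F w * (\1_(X (inl n.+1) @^-1` A) w * \1_(X (inr n.+1) @^-1` A') w)).
Proof.
move=> iF mA mA' s B us ls mB.
pose a : (nat + nat)%type := inl n.+1; pose b : (nat + nat)%type := inr n.+1.
(* Adding the two coordinates of step [n.+1] to the later rectangle reduces the claim to the
   property of [F] at time [n]. *)
pose B' i := if i == a then A else if i == b then A' else B i.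
have mB' i : measurable (B' i) by rewrite /B'; case: ifP => // _; case: ifP.
have as_ : a \notin s by apply/negP => /(allP ls); rewrite /= ltnn.
have bs_ : b \notin s by apply/negP => /(allP ls); rewrite /= ltnn.
have uabs : uniq [:: a, b & s] by rewrite /= inE negb_or as_ bs_ us.
have labs : all (later n) [:: a, b & s].
  by rewrite /= ltnSn/=; apply: sub_all ls => -[] k /= /ltnW.
have rE : rect s B' = rect s B.
  apply: eq_bigcapr => i /= si; rewrite /B'.
  have /negbTE -> : i != a by apply: contra as_ => /eqP <-.
  by have /negbTE -> : i != b by apply: contra bs_ => /eqP <-.
have Ba : B' a = A by rewrite /B' eqxx.
have Bb : B' b = A' by rewrite /B' /= eqxx.
have := iF _ _ uabs labs mB'.
rewrite [in X in _ = X]expect_rect// !big_cons -expect_rect// rE Ba Bb.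
rewrite expect_independent_step// -!mulrA => <-.
congr expect; apply/funext => w; rewrite !rect_cons rE !indicI Ba Bb/=.
by rewrite !mulrA.
Qed.

End Independence.

Section Deltas.
Context {R : realType}.

Lemma sum_delta (I : finType) (g : I -> R) x : \sum_j g j * (x == j)%:R = g x.
Proof.
rewrite (bigD1 x)//= eqxx mulr1 big1 ?addr0// => j /negbTE.
by rewrite eq_sym => ->; rewrite mulr0.
Qed.

Lemma sum_delta_nat (g : nat -> R) m n x : (m <= x < n)%N ->
  \sum_(m <= j < n) g j * (x == j)%:R = g x.
Proof.
move=> xmn; rewrite (bigD1_seq x)/= ?mem_index_iota ?iota_uniq//.
rewrite eqxx mulr1 big1 ?addr0// => j /negbTE.
by rewrite eq_sym => ->; rewrite mulr0.
Qed.

Lemma indic_preimage (T S : Type) (I : eqType) (F : T -> S) (g : S -> I) b w :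
  \1_(F @^-1` [set u | g u = b]) w = (g (F w) == b)%:R :> R.
Proof.
rewrite indicE; congr (_%:R); congr nat_of_bool.
by apply/idP/eqP; rewrite inE.
Qed.

End Deltas.

Section RootProcess.
Context {R : realType} {d : measure_display} {Omega : measurableType d}.
Variables (alpha beta : R) (mu : probability R R) (P : probability Omega R).
Variables (xi U : nat -> Omega -> R).
Hypothesis alpha_gt : -1 < alpha.
Hypothesis mxi : forall k, measurable_fun setT (xi k).
Hypothesis mU : forall k, measurable_fun setT (U k).
Hypothesis law_xi : forall k A, measurable A -> P (xi k @^-1` A) = mu A.
Hypothesis law_U : forall k A, measurable A ->
  P (U k @^-1` A) = lebesgue_measure (A `&` [set` `[0%R, 1%R[]).

Let X (i : (nat + nat)%type) := match i with inl k => xi k | inr k => U k end.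
Hypothesis indX : mutually_independent P X.

Let mX i : measurable_fun setT (X i). Proof. by case: i. Qed.

Definition clamp_delay (x : R) : R := Num.max 0 x.
Definition clamp_unit (u : R) : R := if 0 <= u < 1 then u else 0.

(* Clamping changes the delays and the uniform variables on a null set only,
   and makes the recursion for the root degree hold everywhere. *)
Definition clamped_degree n w : nat :=
  proc_deg (fun k : nat => k%:R + alpha) beta (fun k => clamp_delay (xi k w))
    (fun k => clamp_unit (U k w)) 1 n.

Definition lag n w := lagged_time beta n (clamp_delay (xi n.+1 w)).

Definition lag_set n k : set R := [set x | lagged_time beta n (clamp_delay x) = k].

Definition lag_prob n k : R := fine (mu (lag_set n k)).

Local Notation M := clamped_degree.
Local Notation L := lag.
Local Notation pi := lag_prob.
Local Notation s := (total_weight alpha).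
Local Notation E := (expect P).

Lemma clamp_unit01 u : 0 <= clamp_unit u < 1.
Proof. by rewrite /clamp_unit; case: ifP => //; rewrite lexx ltr01. Qed.

Lemma clamp_delay_ge0 x : 0 <= clamp_delay x.
Proof. by rewrite /clamp_delay le_max lexx. Qed.

Lemma measurable_clamp_unit : measurable_fun setT clamp_unit.
Proof.
apply: measurable_fun_ifT => //; apply: measurable_and; first exact: measurable_fun_ler.
exact: measurable_fun_ltr.
Qed.

Lemma measurable_clamp_delay : measurable_fun setT clamp_delay.
Proof. exact: measurable_maxr. Qed.

Lemma lag_gt0 n w : (0 < L n w)%N. Proof. exact: lagged_time_gt0. Qed.

Lemma lag_le n w : (0 < n)%N -> (L n w <= n)%N.
Proof. by move=> n0; apply: lagged_time_le => //; exact: clamp_delay_ge0. Qed.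

Lemma clamped_degreeS n w : (0 < n)%N ->
  M n.+1 w = (M n w + (clamp_unit (U n.+1 w) * s (L n w) < (M (L n w) w)%:R + alpha)%R)%N.
Proof.
move=> n0; apply: root_degree_step => // k; first exact: clamp_delay_ge0.
exact: clamp_unit01.
Qed.

Lemma clamped_degree_le n w : (M n w <= n)%N.
Proof.
elim: n => [|[_|n ih]]; [by []|by []|].
rewrite clamped_degreeS//; case: (_ < _)%R => /=; lia.
Qed.

Lemma clamped_degree_gt0 n w : (0 < n)%N -> (0 < M n w)%N.
Proof. by move=> n0; rewrite /clamped_degree /proc_deg /tdeg n0. Qed.

Lemma discrete_measurable_clamped_degree n : discrete_measurable (M n).
Proof.
apply: (discrete_measurable_proc_deg _ _ (xs := fun k w => clamp_delay (xi k w))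
  (us := fun k w => clamp_unit (U k w))) => k.
  exact: (measurableT_comp measurable_clamp_delay).
exact: (measurableT_comp measurable_clamp_unit).
Qed.

Lemma bounded_clamped_degree n : bounded_rv (fun w => (M n w)%:R : R).
Proof.
split.
  exact: (discrete_measurable_realfun _ (discrete_measurable_clamped_degree n)).
by exists n%:R => w; rewrite ger0_norm// ler_nat clamped_degree_le.
Qed.

Lemma measurable_lag_set n k : measurable (lag_set n k).
Proof.
have := @discrete_measurable_lagged_time R _ R beta n _ measurable_clamp_delay.
by move=> /(_ [set k]).
Qed.

Lemma lag_prob_ge0 n k : 0 <= pi n k.
Proof. by rewrite fine_ge0. Qed.

Lemma expect_lag_set n k j : E \1_(xi j @^-1` lag_set n k) = pi n k.
Proof.
have m := measurable_lag_set n k.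
apply: EFin_inj; rewrite expect_indic; last by apply: (@measurable_preimage _ _ _ X mX (inl j)).
rewrite law_xi// /lag_prob fineK//; exact: fin_num_measure.
Qed.

Lemma lag_prob_sum n : (0 < n)%N -> \sum_(1 <= k < n.+1) pi n k = 1.
Proof.
move=> n0; rewrite -[RHS](expect_cst P).
under eq_bigr do rewrite -(expect_lag_set _ _ n.+1).
rewrite -expect_sum => [|k _]; last first.
  apply/bounded_rv_indic; apply: (@measurable_preimage _ _ _ X mX (inl n.+1)).
  exact: measurable_lag_set.
congr expect; apply/funext => w.
under eq_bigr do rewrite indic_preimage -[_%:R]mul1r.
by rewrite sum_delta_nat// lagged_time_gt0 ltnS lag_le.
Qed.

Definition threshold_set k (v : R) (b : bool) : set R :=
  [set u | (clamp_unit u * s k < v) = b].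

Lemma measurable_threshold_set k v b : measurable (threshold_set k v b).
Proof.
have mc : measurable_fun setT (fun u : R => clamp_unit u * s k).
  by apply: measurable_funM => //; exact: measurable_clamp_unit.
exact: (@discrete_measurable_ltr _ _ R _ _ mc (measurable_cst v) [set b]).
Qed.

(** The bound [v <= s k] places the interval from 0 to [v / s k] inside the unit interval, where
    clamping is the identity. *)
Lemma expect_threshold_set j k (v : R) : (0 < k)%N -> 0 <= v -> v <= s k ->
  E \1_(U j @^-1` threshold_set k v true) = v / s k.
Proof.
move=> k0 v0 vs; have sk := total_weight_gt0 alpha_gt k0.
have m := measurable_threshold_set k v true.
apply: EFin_inj; rewrite expect_indic; last by apply: (@measurable_preimage _ _ _ X mX (inr j)).
rewrite law_U// (_ : _ `&` _ = [set` `[0%R, (v / s k)%R[]).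
  rewrite lebesgue_measure_itv/= lte_fin; case: ltgtP (divr_ge0 v0 (ltW sk)) => //.
    by rewrite oppr0 adde0.
  by move=> <-.
apply/seteqP; split => u /=; rewrite !in_itv/=.
  move=> [+ u01]; rewrite /threshold_set/= /clamp_unit u01 => h; case/andP: u01 => -> _ /=.
  by rewrite ltr_pdivlMr// h.
move=> /andP[u0 uv]; have u1 : u < 1.
  by apply: lt_le_trans uv _; rewrite ler_pdivrMr// mul1r.
by rewrite /threshold_set/= /clamp_unit u0 u1/= -ltr_pdivlMr.
Qed.

(** The degrees up to time [n] as an element of a finite type, so that conditioning on the past is a
    finite sum. As [M i <= i], [inord] loses nothing. *)
Definition history n w : {ffun 'I_n.+1 -> 'I_n.+1} := [ffun i : 'I_n.+1 => inord (M i w)].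
Local Notation H := history.

Lemma historyE n w k : (k <= n)%N -> H n w (inord k) = M k w :> nat.
Proof.
move=> kn; have e : (inord k : 'I_n.+1) = k :> nat by rewrite inordK.
by rewrite ffunE e inordK// ltnS (leq_trans (clamped_degree_le k w)).
Qed.

Lemma history_inj n w w' : H n w = H n w' -> forall k, (k <= n)%N -> M k w = M k w'.
Proof. by move=> h k kn; rewrite -!(historyE _ kn) h. Qed.

Lemma adapted_history n h : adapted M n (fun w => (H n w == h)%:R : R).
Proof.
move=> w w' e; congr (_%:R); congr (nat_of_bool (_ == _)).
by apply/ffunP => i; rewrite !ffunE e// -ltnS.
Qed.

Let hval n (h : {ffun 'I_n.+1 -> 'I_n.+1}) k : R := (h (inord k))%:R + alpha.

Let lag_indic n k w : \1_(X (inl n.+1) @^-1` lag_set n k) w = (L n w == k)%:R :> R.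
Proof. exact: indic_preimage. Qed.

Let thr_indic n k v b w : \1_(X (inr n.+1) @^-1` threshold_set k v b) w =
  ((clamp_unit (U n.+1 w) * s k < v) == b)%:R :> R.
Proof. exact: (indic_preimage (U n.+1) (fun u => clamp_unit u * s k < v)). Qed.

Let bounded_ab n k k' v b : bounded_rv (fun w =>
  \1_(X (inl n.+1) @^-1` lag_set n k) w *
  \1_(X (inr n.+1) @^-1` threshold_set k' v b) w : R).
Proof.
apply: bounded_rvM; apply/bounded_rv_indic/measurable_preimage => //.
  exact: measurable_lag_set.
exact: measurable_threshold_set.
Qed.

(* The step from [n] to [n.+1] splits [F] over the histories up to time [n], the
   value of the lag and the outcome of the choice; each piece is a function of the past
   times the indicator of a rectangle in [(xi n.+1, U n.+1)]. *)
Lemma adapted_independent n (F : Omega -> R) : adapted M n F ->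
  bounded_rv F /\ independent_of_later P X n F.
Proof.
elim: n F => [|n ih] F aF.
  rewrite (_ : F = fun=> F point); last first.
    by apply/funext => w; apply: aF => k; rewrite leqn0 => /eqP ->.
  by split; [exact: bounded_rv_cst|exact: independent_of_later_cst].
have [nE|n0] := posnP n.
  rewrite nE in aF; rewrite (_ : F = fun=> F point); last first.
    by apply/funext => w; apply: aF => -[|[|//]].
  by split; [exact: bounded_rv_cst|exact: independent_of_later_cst].
pose bit w := (clamp_unit (U n.+1 w) * s (L n w) < (M (L n w) w)%:R + alpha).
(* [F] evaluated at any sample with history [h] and outcome [b]; adaptedness makes the choice of the
   sample irrelevant. *)
pose x h b := F (xget point [set w | H n w = h /\ bit w = b]).
have FE w : F w = x (H n w) (bit w).
  rewrite /x; case: xgetP => [w' _ [hw bw]|/(_ w)[]//].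
  apply: aF => k; rewrite leq_eqVlt => /predU1P[->|]; last first.
    by rewrite ltnS => kn; exact/esym/(history_inj hw).
  by rewrite !clamped_degreeS// -/(bit w) -/(bit w') bw (history_inj hw).
pose t h k b w := x h b * ((H n w == h)%:R *
  (\1_(X (inl n.+1) @^-1` lag_set n k) w *
   \1_(X (inr n.+1) @^-1` threshold_set k (hval h k) b) w)).
have FS : F = fun w => \sum_h \sum_(1 <= k < n.+1) \sum_b t h k b w.
  apply/funext => w.
  transitivity (\sum_h (\sum_(1 <= k < n.+1) (\sum_b x h b *
     ((clamp_unit (U n.+1 w) * s k < hval h k) == b)%:R) * (L n w == k)%:R) *
     (H n w == h)%:R).
    rewrite sum_delta sum_delta_nat ?lag_gt0 ?ltnS ?lag_le//.
    by rewrite sum_delta FE /hval historyE ?lag_le.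
  apply: eq_bigr => h _; rewrite mulr_suml; apply: eq_bigr => k _.
  rewrite !mulr_suml; apply: eq_bigr => b _.
  by rewrite /t lag_indic thr_indic; ring.
have bH h : bounded_rv (fun w => (H n w == h)%:R : R).
  by have [] := ih _ (@adapted_history n h).
have bt0 h k b : bounded_rv (fun w => (H n w == h)%:R *
  (\1_(X (inl n.+1) @^-1` lag_set n k) w *
   \1_(X (inr n.+1) @^-1` threshold_set k (hval h k) b) w) : R).
  exact: bounded_rvM.
have bt h k b : bounded_rv (t h k b) by exact: bounded_rvZ.
rewrite FS; split.
  by apply: bounded_rv_sum => h _; apply: bounded_rv_sum => k _; exact: bounded_rv_sum.
apply: independent_of_later_sum => // h.
  by apply: bounded_rv_sum => k _; exact: bounded_rv_sum.
apply: independent_of_later_sum => // k; first exact: bounded_rv_sum.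
apply: independent_of_later_sum => // b.
apply: independent_of_laterZ => //.
apply: independent_of_later_step => //.
- by have [] := ih _ (@adapted_history n h).
- exact: measurable_lag_set.
- exact: measurable_threshold_set.
Qed.

(** On each history the degrees are constants, so the increment is a sum of indicators of rectangles
    in the next pair, whose probability is [pi n k] times [hval h k / s k]. *)
Lemma clamped_increment_mean n (F : Omega -> R) : (0 < n)%N -> bounded_rv F ->
  adapted M n F -> E (fun w => F w * increment M n w) =
  E (fun w => F w * mean_increment alpha M pi n w).
Proof.
move=> n0 bF aF.
pose G h w := F w * (H n w == h)%:R.
have aG h : adapted M n (G h).
  by move=> w w' e; rewrite /G (aF _ _ e) (adapted_history h e).
have bG h : bounded_rv (G h) by have [] := adapted_independent (aG h).
have -> : (fun w => F w * increment M n w) = (fun w =>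
    \sum_h \sum_(1 <= k < n.+1) G h w *
  (\1_(X (inl n.+1) @^-1` lag_set n k) w *
   \1_(X (inr n.+1) @^-1` threshold_set k (hval h k) true) w)).
  apply/funext => w; transitivity (\sum_h (\sum_(1 <= k < n.+1) F w *
      (clamp_unit (U n.+1 w) * s k < hval h k)%R%:R * (L n w == k)%:R) *
     (H n w == h)%:R).
    rewrite sum_delta sum_delta_nat ?lag_gt0 ?ltnS ?lag_le//.
    rewrite /hval historyE ?lag_le// /increment clamped_degreeS// natrD; ring.
  apply: eq_bigr => h _; rewrite mulr_suml; apply: eq_bigr => k _.
  by rewrite /G lag_indic thr_indic eqb_id; ring.
have bGab h k : bounded_rv (fun w => G h w *
  (\1_(X (inl n.+1) @^-1` lag_set n k) w *
   \1_(X (inr n.+1) @^-1` threshold_set k (hval h k) true) w)).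
  exact: bounded_rvM.
rewrite expect_sum => [|h _]; last by exact: bounded_rv_sum.
have -> : (fun w => F w * mean_increment alpha M pi n w) =
    (fun w => \sum_h (\sum_(1 <= k < n.+1) pi n k * (hval h k / s k)) * G h w).
  apply/funext => w; under eq_bigr do rewrite /G mulrA.
  rewrite sum_delta mulrC; congr (_ * _); rewrite /mean_increment !big_nat.
  by apply: eq_bigr => k /andP[k0 kn]; rewrite /hval historyE.
rewrite expect_sum => [|h _]; last by exact: bounded_rvZ.
apply: eq_bigr => h _; rewrite expectZ// expect_sum// mulrC mulr_sumr !big_nat.
apply: eq_bigr => k /andP[k0 kn].
have [_ iG] := adapted_independent (aG h).
rewrite (expect_independent_step mX indX iG); [|exact: measurable_lag_set|exact: measurable_threshold_set].
rewrite expect_lag_set.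
(* For a history that no sample realises, [hval h k] may lie outside the range from 0 to [s k]; then
   [G h] vanishes. *)
have [[w hw]|nh] := pselect (exists w, H n w = h).
  have a0 : 0 < 1 + alpha by move: alpha_gt; lra.
  have M1 : 1 <= (M k w)%:R :> R by rewrite ler1n clamped_degree_gt0.
  have Mk : (M k w)%:R <= k%:R :> R by rewrite ler_nat clamped_degree_le.
  have k1 : 1 <= k%:R :> R by rewrite ler1n.
  rewrite expect_threshold_set// /hval -hw historyE//.
    by move: a0 M1; lra.
  by rewrite /total_weight; move: a0 M1 Mk k1; nra.
suff -> : E (G h) = 0 by rewrite !mul0r.
rewrite (_ : G h = fun=> 0) ?expect_cst//; apply/funext => w; rewrite /G.
have /negbTE -> : H n w != h by apply/negP => /eqP hw; apply: nh; exists w.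
by rewrite mulr0.
Qed.

End RootProcess.

(** * Consequences of the assumptions on the delay distribution *)

Section Domination.
Context {R : realType} {d : measure_display} {T : measurableType d}.
Variable P : probability T R.

Lemma expect_le_integral (F q : T -> R) (a b k : R) : bounded_rv F ->
  (forall x, 0 <= F x) -> measurable_fun setT q -> (forall x, 0 <= q x) ->
  (\int[P]_x (q x)%:E < +oo)%E -> 0 <= a -> 0 <= b -> 0 <= k ->
  (forall x, F x <= a * (b + k * q x)) ->
  expect P F <= a * (b + k * fine (\int[P]_x (q x)%:E)%E).
Proof.
move=> bF F0 mq q0 iq a0 b0 k0 h; rewrite -lee_fin expectE//.
have IqE : (fine (\int[P]_x (q x)%:E)%E)%:E = (\int[P]_x (q x)%:E)%E.
  by rewrite fineK// ge0_fin_numE// integral_ge0// => x _; rewrite lee_fin.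
apply: (@le_trans _ _ (\int[P]_x ((a * b)%:E + (a * k)%:E * (q x)%:E))%E).
  apply: ge0_le_integral => //.
  - by move=> x _; rewrite lee_fin.
  - by apply/measurable_EFinP; have [] := bF.
  - under eq_fun do rewrite -EFinM -EFinD; apply/measurable_EFinP.
    by apply: measurable_funD => //; exact: measurable_funM.
  - by move=> x _; rewrite -EFinM -EFinD lee_fin -mulrA -mulrDr.
have mq' : measurable_fun setT (EFin \o q) by exact/measurable_EFinP.
have i1 : (\int[P]_x (a * b)%:E)%E = (a * b)%:E.
  by rewrite -(expectE P (bounded_rv_cst (a * b))) expect_cst.
rewrite ge0_integralD//.
- rewrite i1 ge0_integralZl//.
  + by rewrite -IqE -EFinM -EFinD lee_fin mulrDr mulrA.
  + by move=> x _; rewrite lee_fin.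
  + by rewrite lee_fin mulr_ge0.
- by move=> x _; rewrite lee_fin mulr_ge0.
- by move=> x _; rewrite -EFinM lee_fin !mulr_ge0.
- by under eq_fun do rewrite -EFinM; apply/measurable_EFinP; exact: measurable_funM.
Qed.

End Domination.

Section DelayBounds.
Context {R : realType}.
Variables (alpha beta : R) (mu : probability R R).
Hypothesis alpha_gt : -1 < alpha.
Hypothesis beta01 : 0 <= beta < 1.
Hypothesis mu_ge0 : mu [set` `[0%R, +oo[] = 1%E.
Implicit Types (n k : nat) (x : R).

Local Notation E := (expect mu).
Local Notation theta := ((2 + alpha)^-1).
Local Notation pi := (lag_prob beta mu).
Local Notation lagx n x := (lagged_time beta n (clamp_delay x)).

Definition delay_cost n x : R :=
  (n%:R `^ beta) * x * (if 1 <= n%:R - (n%:R `^ beta) * x then 1 else 0)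
    / (lagged_time beta n x)%:R.
Local Notation g := delay_cost.
Local Notation gc := (fun n x => g n (clamp_delay x)).

Lemma ae_delay_ge0 : {ae mu, forall x, 0 <= x}.
Proof.
exists (~` [set` `[0%R, +oo[]); split.
- exact: measurableC.
- by rewrite probability_setC// mu_ge0 subee.
- by move=> x /= h; rewrite in_itv/= andbT.
Qed.

Lemma clamp_delay_id x : 0 <= x -> clamp_delay x = x.
Proof. by move=> x0; rewrite /clamp_delay; apply/max_idPr. Qed.

Lemma delay_cost_clamp_ge0 n x : 0 <= gc n x.
Proof.
have z0 := clamp_delay_ge0 x.
by rewrite /delay_cost divr_ge0// mulr_ge0 ?mulr_ge0 ?powR_ge0//; case: ifP.
Qed.

Lemma measurable_delay_cost n : measurable_fun setT (g n).
Proof.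
rewrite /delay_cost; apply: measurable_funM.
  apply: measurable_funM; first exact: measurable_funM.
  apply: measurable_fun_ifT => //; apply: measurable_fun_ler => //.
  by apply: measurable_funB => //; exact: measurable_funM.
apply: (discrete_measurable_realfun (fun k => (k%:R)^-1)).
exact: discrete_measurable_lagged_time.
Qed.

Lemma bounded_delay_cost n : bounded_rv (gc n).
Proof.
split; first exact: (measurableT_comp (measurable_delay_cost n) measurable_clamp_delay).
exists n%:R => x; rewrite ger0_norm ?delay_cost_clamp_ge0//.
rewrite /delay_cost; set y := _ `^ _ * _; set m := lagged_time _ _ _.
have y0 : 0 <= y by rewrite mulr_ge0 ?powR_ge0 ?clamp_delay_ge0.
have m1 : 1 <= m%:R :> R by rewrite ler1n lagged_time_gt0.
rewrite ler_pdivrMr; last by apply: lt_le_trans m1.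
apply: (@le_trans _ _ n%:R); last by rewrite ler_peMr.
by case: ifPn => h; rewrite ?mulr1 ?mulr0//; lra.
Qed.

Lemma integral_delay_cost n : (\int[mu]_x (g n x)%:E)%E = (E (gc n))%:E.
Proof.
have bg := bounded_delay_cost n.
rewrite expectE//; apply: ae_eq_integral => //.
- by apply/measurable_EFinP; exact: measurable_delay_cost.
- by apply/measurable_EFinP; have [] := bg.
- by apply: filterS ae_delay_ge0 => x x0 _ /=; rewrite clamp_delay_id.
Qed.

Lemma lag_prob_expect n k : pi n k = E \1_(lag_set beta n k).
Proof.
have m := measurable_lag_set beta n k.
by apply: EFin_inj; rewrite expect_indic// /lag_prob fineK// fin_num_measure.
Qed.

Let bounded_lag n k : bounded_rv (\1_(lag_set beta n k) : R -> R).
Proof. by apply: bounded_rv_indic; exact: measurable_lag_set. Qed.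

Let lag_indic n k x : \1_(lag_set beta n k) x = (lagx n x == k)%:R :> R.
Proof. exact: (indic_preimage id (fun x => lagx n x)). Qed.

(** Rounding costs less than 1. A shortfall of at least 2 is thus at most twice the delay [y]; a
    shortfall of at most 1 is paid for by [2 / n], since then [n <= m + 1 <= 2 m]. *)
Lemma lag_shortfall_le n x : (1 < lagx n x)%N -> (0 < n)%N ->
  (n%:R - (lagx n x)%:R) / (lagx n x)%:R <= 2 * gc n x + 2 / n%:R.
Proof.
move=> m2 n0; rewrite /delay_cost; set z := clamp_delay x; set y := _ `^ _ * _.
have n0R : 0 < n%:R :> R by rewrite ltr0n.
have mn : (lagged_time beta n z <= n)%N by apply: lagged_time_le => //; exact: clamp_delay_ge0.
rewrite -/z in m2 *.
have y0 : 0 <= y by rewrite mulr_ge0 ?powR_ge0 ?clamp_delay_ge0.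
have mE : lagged_time beta n z = Num.truncn (n%:R - y).
  by move: m2; rewrite /lagged_time -/y; lia.
have m0 : (0 < lagged_time beta n z)%N by exact: ltnW.
have y1 : 1 <= n%:R - y by rewrite -truncn_gt0 -mE.
have ym : n%:R - y < (lagged_time beta n z).+1%:R by rewrite mE; exact: truncnS_gt.
rewrite y1 mulr1; move: (lagged_time beta n z) m2 mn m0 ym => m m2 mn m0 ym {mE}.
have m0R : 0 < m%:R :> R by rewrite ltr0n.
have [h|h] := leqP (m + 2) n.
  apply: (@le_trans _ _ (2 * (y / m%:R))); last by rewrite lerDl divr_ge0.
  rewrite mulrA ler_pM2r ?invr_gt0//.
  have : (m + 2)%:R <= n%:R :> R by rewrite ler_nat.
  by rewrite natrD; move: ym; rewrite -natr1; lra.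
apply: (@le_trans _ _ (2 / n%:R)); last by rewrite lerDr mulr_ge0// divr_ge0// ltW.
rewrite ler_pdivrMr// mulrAC ler_pdivlMr//.
have hn : n%:R <= m%:R + 1 :> R by rewrite natr1 ler_nat; move: h; rewrite addn2 ltnS.
have m2R : 2 <= m%:R :> R by rewrite ler_nat.
have mnR : m%:R <= n%:R :> R by rewrite ler_nat.
nra.
Qed.

Lemma lag_defect_le n : (0 < n)%N -> lag_defect pi n <= 2 * E (gc n) + 2 / n%:R.
Proof.
move=> n0; rewrite /lag_defect; under eq_bigr do rewrite lag_prob_expect mulrC -expectZ//.
rewrite -expect_sum => [|k _]; last exact: bounded_rvZ.
rewrite -expectZ; last exact: bounded_delay_cost.
rewrite -[X in _ + X](expect_cst mu) -expectD; last first.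
- exact: bounded_rv_cst.
- by apply: bounded_rvZ; exact: bounded_delay_cost.
apply: expect_le.
- by apply: bounded_rv_sum => k _; exact: bounded_rvZ.
- apply: bounded_rvD; last exact: bounded_rv_cst.
  by apply: bounded_rvZ; exact: bounded_delay_cost.
move=> x; under eq_bigr do rewrite lag_indic.
have mn : (lagx n x <= n)%N by apply: lagged_time_le => //; exact: clamp_delay_ge0.
have [m1|m2] := leqP (lagx n x) 1.
  rewrite big_nat big1 => [|k /andP[k2 _]].
    by rewrite addr_ge0 ?divr_ge0// mulr_ge0// delay_cost_clamp_ge0.
  by rewrite (negbTE (_ : lagx n x != k)) ?mulr0//; rewrite neq_ltn (leq_ltn_trans m1 k2).
rewrite (@sum_delta_nat _ (fun k => (n%:R - k%:R) / k%:R)) ?m2 ?ltnS//.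
exact: lag_shortfall_le.
Qed.

Let gam : R := (1 - beta)^-1.
Let Xf x : R := x `^ gam.

Definition delay_horizon x : R := 2 `^ gam * Xf x.
Local Notation Lam := delay_horizon.

(** Lag 1 means [n - n^beta x < 2]. For [n >= 4] this gives [n / 2 <= n^beta x], that is
    [n^(1 - beta) <= 2 x]. *)
Lemma lag1_le n x : lagx n x = 1%N -> (n <= 3)%N \/ n%:R <= Lam x.
Proof.
move=> L1; have [n3|n4] := leqP n 3; [by left|right].
have b1 : 0 < 1 - beta by move: beta01 => /andP[]; lra.
have n0R : 0 < n%:R :> R by rewrite ltr0n; exact: leq_trans n4.
have n4R : 4 <= n%:R :> R by rewrite ler_nat.
have yt : (Num.truncn (n%:R - n%:R `^ beta * clamp_delay x) <= 1)%N.
  by rewrite -L1 /lagged_time leq_maxr.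
rewrite truncn_le_nat in yt.
have nb0 : 0 < n%:R `^ beta :> R by rewrite powR_gt0.
have x0 : 0 < x.
  rewrite ltNge; apply/negP => x0; move: yt; rewrite /clamp_delay (max_idPl x0) mulr0 subr0; lra.
rewrite clamp_delay_id ?(ltW x0)// in yt.
have h : n%:R `^ (1 - beta) <= 2 * x.
  have -> : n%:R `^ (1 - beta) = n%:R / n%:R `^ beta :> R.
    by rewrite powRB ?(gt_eqF n0R) ?implybT// powRr1.
  by rewrite ler_pdivrMr//; move: yt; lra.
rewrite /delay_horizon /Xf -powRM ?(ltW x0)//.
have -> : n%:R = (n%:R `^ (1 - beta)) `^ gam :> R.
  by rewrite -powRrM mulfV ?gt_eqF// powRr1// ltW.
rewrite ge0_ler_powR ?nnegrE ?powR_ge0 ?invr_ge0 ?(ltW b1)//.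
by rewrite mulr_ge0// ltW.
Qed.

Let q x : R := (Xf x) `^ (1 - theta).
Let t0 : 0 < theta := theta_gt0 alpha_gt.
Let t1 : theta < 1 := theta_lt1 alpha_gt.
Let kap : R := (2 `^ gam) `^ (1 - theta).

Let LamE x : Lam x `^ (1 - theta) = kap * q x.
Proof. by rewrite /delay_horizon powRM ?powR_ge0. Qed.

Let pow3 : (3 : R) `^ (1 - theta) <= 3.
Proof. by apply: ler1_powR; [lra|rewrite lerBlDr lerDl ltW]. Qed.

Lemma lag1_powR_le n x : (0 < n)%N ->
  n%:R `^ (1 - theta) * (lagx n x == 1%N)%:R <= 3 + kap * q x.
Proof.
move=> n0; have kq : 0 <= kap * q x by rewrite mulr_ge0 ?powR_ge0.
have u0 : 0 <= 1 - theta by move: t1; lra.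
case: eqP => [/lag1_le h|_]; last by rewrite mulr0 addr_ge0.
rewrite mulr1; case: h => h.
  apply: (@le_trans _ _ (3 `^ (1 - theta))); last by move: pow3 kq; lra.
  by rewrite ge0_ler_powR ?nnegrE// (ler_nat _ _ 3).
rewrite -LamE; apply: (@le_trans _ _ (Lam x `^ (1 - theta))); last by rewrite lerDr.
by rewrite ge0_ler_powR ?nnegrE// mulr_ge0// powR_ge0.
Qed.

(** For a given delay, lag 1 can occur only up to time [K], and the sum of [n ^ (- theta)] up to [K]
    is of order [K ^ (1 - theta)]. This is where the moment of order [1 - theta] of [X] comes
    from. *)
Lemma lag1_sum_le N x :
  \sum_(1 <= n < N) n%:R `^ (- theta) * (lagx n x == 1%N)%:R <=
  (1 - theta)^-1 * (3 + kap * q x).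
Proof.
pose K := maxn 3 (Num.truncn (Lam x)).
have L0 : 0 <= Lam x by rewrite mulr_ge0// powR_ge0.
have u0 : 0 < 1 - theta by move: t1; lra.
have kq : 0 <= kap * q x by rewrite mulr_ge0 ?powR_ge0.
apply: (@le_trans _ _ (\sum_(1 <= n < K.+1) n%:R `^ (- theta))).
  have h0 n : 0 <= n%:R `^ (- theta) :> R by exact: powR_ge0.
  apply: (@le_trans _ _ (\sum_(1 <= n < N) n%:R `^ (- theta) * (n <= K)%:R)).
    rewrite !big_nat; apply: ler_sum => n _; apply: ler_wpM2l => //.
    case: eqP => //= /lag1_le h; rewrite ler1n lt0b leq_max.
    by case: h => [->//|h]; rewrite truncn_ge_nat// h orbT.
  have [NK|KN] := leqP N K.+1.
    rewrite [leRHS](big_cat_nat (n := maxn 1 N)) ?leq_max// ?geq_max ?NK//=.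
    have -> : \sum_(1 <= i < maxn 1 N) i%:R `^ (- theta) = \sum_(1 <= i < N) i%:R `^ (- theta) :> R.
      by case: N {NK} => [|N]; [rewrite !big_geq|rewrite maxnSS max0n].
    apply: le_trans (_ : \sum_(1 <= i < N) i%:R `^ (- theta) <= _).
      by apply: ler_sum => n _; case: (n <= K)%N; rewrite ?mulr1 ?mulr0.
    by rewrite lerDl sumr_ge0.
  rewrite (big_cat_nat (n := K.+1)) ?(ltnW KN)//= [X in _ + X]big_nat.
  rewrite [X in _ + X]big1 ?addr0 => [|n /andP[Kn _]]; last by rewrite leqNgt Kn mulr0.
  by apply: ler_sum => n _; case: (n <= K)%N; rewrite ?mulr1 ?mulr0.
apply: le_trans (sum_powRN_le _ _) _; first by rewrite (ltW t0) t1.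
rewrite ler_pM2l ?invr_gt0// /K /maxn; case: ifP => _.
  rewrite -LamE; apply: (@le_trans _ _ (Lam x `^ (1 - theta))); last by rewrite lerDr.
  by rewrite ge0_ler_powR ?nnegrE ?(ltW u0)// truncn_le.
by move: pow3 kq; lra.
Qed.

Hypothesis q_int : (\int[mu]_x (q x)%:E < +oo)%E.

Let Iq : R := fine (\int[mu]_x (q x)%:E)%E.

Lemma expect_le_moment (F : R -> R) (a b : R) : bounded_rv F -> (forall x, 0 <= F x) ->
  0 <= a -> 0 <= b -> (forall x, F x <= a * (b + kap * q x)) ->
  E F <= a * (b + kap * Iq).
Proof.
move=> bF F0 a0 b0 h; apply: expect_le_integral => //.
- by apply: (measurableT_comp (measurable_powR (1 - theta))); exact: measurable_powR.
- by move=> x; exact: powR_ge0.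
- exact: powR_ge0.
Qed.

Hypothesis g_cvg : (fun n => (\int[mu]_x (g n x)%:E)%E) @ \oo --> 0%E.
Hypothesis g_sum : (\sum_(1 <= n <oo) ((n%:R)^-1%:E * \int[mu]_x (g n x)%:E) < +oo)%E.

Local Notation c := (normaliser alpha).
Let c0 := normaliser_gt0 alpha_gt.

Lemma lag1_prob_le n : (0 < n)%N -> pi n 1 / c n <= n%:R `^ (- theta) * pi n 1.
Proof.
move=> n0; rewrite mulrC ler_wpM2r ?lag_prob_ge0// powRN lef_pV2 ?posrE//.
  exact: normaliser_ge_powR.
by rewrite powR_gt0// ltr0n.
Qed.

Lemma drift_bound_summable : exists K, forall N,
  \sum_(1 <= n < N) drift_bound alpha pi n <= K.
Proof.
have [|C2 hC2] := @sum_powRN_bounded R 1; first lra.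
pose Sg := fine (\sum_(1 <= n <oo) ((n%:R)^-1%:E * \int[mu]_x (g n x)%:E))%E.
have gg0 n : (0 <= (n%:R)^-1%:E * \int[mu]_x (g n x)%:E)%E.
  rewrite integral_delay_cost -EFinM lee_fin mulr_ge0// expect_ge0// => x.
  exact: delay_cost_clamp_ge0.
have SgE N : \sum_(1 <= n < N) (n%:R)^-1 * E (gc n) <= Sg.
  rewrite -lee_fin /Sg fineK.
    apply: le_trans (nneseries_lim_ge N (P := xpredT) (fun n _ _ => gg0 n)).
    by rewrite -sumEFin; apply: lee_sum => n _; rewrite integral_delay_cost EFinM.
  by rewrite ge0_fin_numE// nneseries_ge0.
exists ((1 - theta)^-1 * (3 + kap * Iq) + (2 * Sg + 2 * C2)) => N.
rewrite /drift_bound big_split/=; apply: lerD.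
  apply: (@le_trans _ _ (\sum_(1 <= n < N) n%:R `^ (- theta) * pi n 1)).
    by rewrite !big_nat; apply: ler_sum => n /andP[n0 _]; exact: lag1_prob_le.
  under eq_bigr do rewrite lag_prob_expect -expectZ//.
  rewrite -expect_sum => [|n _]; last exact: bounded_rvZ.
  have u0 : 0 <= (1 - theta)^-1 by rewrite invr_ge0; move: t1; lra.
  apply: expect_le_moment => //.
  - by apply: bounded_rv_sum => n _; exact: bounded_rvZ.
  - by move=> x; apply: sumr_ge0 => n _; rewrite lag_indic mulr_ge0// powR_ge0.
  - by move=> x; under eq_bigr do rewrite lag_indic; exact: lag1_sum_le.
apply: (@le_trans _ _ (\sum_(1 <= n < N) (2 * ((n%:R)^-1 * E (gc n)) + 2 * n%:R `^ (-1 - 1)))).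
  rewrite !big_nat; apply: ler_sum => n /andP[n0 _].
  have n0R : 0 < n%:R :> R by rewrite ltr0n.
  rewrite ler_pdivrMr//; apply: le_trans (lag_defect_le n0) _.
  have -> : -1 - 1 = - 2%:R :> R by ring.
  rewrite powRN powR_mulrn//; apply: eq_ler; field; rewrite gt_eqF//.
by rewrite big_split/= -!mulr_sumr lerD// ler_pM2l.
Qed.

Lemma drift_bound_le : exists K, forall n, (0 < n)%N ->
  n%:R * drift_bound alpha pi n <= K.
Proof.
have : cvgn (fun n => E (gc n)).
  apply/cvg_ex; exists 0; have /fine_cvgP[_] := g_cvg.
  by apply: cvg_trans; apply: near_eq_cvg; apply: nearW => n /=; rewrite integral_delay_cost.
(* Boundedness is given for every constant above [B], hence [B + 1]. *)
move=> /cvg_seq_bounded [B [_ /(_ (B + 1))]]; rewrite ltrDl => /(_ ltr01) hB.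
exists (1 * (3 + kap * Iq) + (2 * (B + 1) + 2)) => n n0.
have n0R : 0 < n%:R :> R by rewrite ltr0n.
rewrite /drift_bound mulrDr; apply: lerD.
  apply: (@le_trans _ _ (n%:R `^ (1 - theta) * pi n 1)).
    apply: le_trans (ler_wpM2l (ltW n0R) (lag1_prob_le n0)) _; rewrite mulrA.
    apply: eq_ler; congr (_ * _); rewrite powRD ?(gt_eqF n0R) ?implybT//.
    by rewrite powRr1// ltW.
  rewrite lag_prob_expect -expectZ//.
  apply: expect_le_moment => //.
  - exact: bounded_rvZ.
  - by move=> x; rewrite lag_indic mul1r; exact: lag1_powR_le.
rewrite mulrC mulfVK ?gt_eqF//; apply: le_trans (lag_defect_le n0) _.
apply: lerD; last by rewrite ler_pdivrMr// ler_peMr// ler1n.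
rewrite ler_pM2l//; apply: le_trans (ler_norm _) _; exact: (hB n).
Qed.

End DelayBounds.

(** * Heavy-tailed delays *)

(** A layer-cake bound. Counting starts at 2, the first step with a random choice, so the constant 2
    stands for the layers below it. *)
Lemma min_le_count (R : realType) (y : R) n : 0 <= y ->
  Num.min y n.+2%:R <= 2 + \sum_(2 <= k < n.+2) (k%:R <= y)%R%:R.
Proof.
move=> y0; elim: n => [|n ih]; first by rewrite big_geq// addr0 ge_min lexx orbT.
rewrite big_nat_recr//= addrA; move: ih; set S := 2 + _.
have -> : n.+3%:R = n.+2%:R + 1 :> R by rewrite natr1.
case: (leP n.+2%:R y) => h /=.
  by move=> ih; rewrite ge_min lerD2r ih orbT.
by move=> ih; rewrite addr0 ge_min ih.
Qed.

Section LongDelays.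
Context {R : realType}.
Variables (alpha beta : R).
Hypothesis beta01 : 0 <= beta < 1.

Local Notation Xf := (fun x : R => x `^ (1 - beta)^-1).

Let b1 : 0 < 1 - beta. Proof. by move: beta01 => /andP[]; lra. Qed.

Lemma lagged_time_long n (x : R) : (1 < n)%N -> n%:R <= Xf x ->
  lagged_time beta n x = 1%N.
Proof.
move=> n1 nX; have n1R : 1 < n%:R :> R by rewrite ltr1n.
have n0R : 0 < n%:R :> R by exact: lt_trans n1R.
(* The power of a negative number is 1 by default, which is below [n]. *)
have x0 : 0 <= x.
  by rewrite leNgt; apply/negP => x0; move: nX; rewrite lt0_powR1// leNgt n1R.
have h : n%:R `^ (1 - beta) <= x.
  have -> : x = (x `^ (1 - beta)^-1) `^ (1 - beta).
    by rewrite -powRrM mulVf ?gt_eqF// powRr1.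
  by rewrite ge0_ler_powR ?nnegrE ?powR_ge0 ?(ltW b1) ?(ltW n0R).
have -> : lagged_time beta n x = maxn 1 (Num.truncn (n%:R - n%:R `^ beta * x)) by [].
have -> : Num.truncn (n%:R - n%:R `^ beta * x) = 0%N; last by rewrite maxn0.
apply/eqP; rewrite -leqn0 truncn_le_nat; apply: (@le_lt_trans _ _ 0) => //.
rewrite subr_le0; apply: (@le_trans _ _ (n%:R `^ beta * n%:R `^ (1 - beta))).
  by rewrite -powRD ?(gt_eqF n0R) ?implybT// addrC subrK powRr1// ltW.
by rewrite ler_wpM2l// powR_ge0.
Qed.

Lemma root_degree_ge (xs us : nat -> R) n :
  (2 + \sum_(2 <= k < n.+2) (k%:R <= Xf (xs k.+1))%R <=
   proc_deg (fun k : nat => (k%:R + alpha)%R) beta xs us 1 n.+2)%N.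
Proof.
elim: n => [|n ih]; first by rewrite big_geq.
rewrite big_nat_recr//= addnA root_degreeS//; apply: leq_add => //.
case: (leP n.+2%:R (Xf (xs n.+3))) => // h.
by rewrite lagged_time_long//= choose_parent_lag1.
Qed.

End LongDelays.

Section HeavyTail.
Context {R : realType} {d : measure_display} {Omega : measurableType d}.
Variables (alpha beta : R) (mu : probability R R) (P : probability Omega R).
Variables (xi U : nat -> Omega -> R).
Hypothesis beta01 : 0 <= beta < 1.
Hypothesis mxi : forall k, measurable_fun setT (xi k).
Hypothesis mU : forall k, measurable_fun setT (U k).
Hypothesis law_xi : forall k A, measurable A -> P (xi k @^-1` A) = mu A.
Let X (i : (nat + nat)%type) := match i with inl k => xi k | inr k => U k end.
Hypothesis indX : mutually_independent P X.
Let mX i : measurable_fun setT (X i). Proof. by case: i. Qed.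

Local Notation Xf := (fun x : R => x `^ (1 - beta)^-1).
Local Notation E := (expect P).

Definition long_set k : set R := [set x | k%:R <= Xf x].

Lemma measurable_long_set k : measurable (long_set k).
Proof.
rewrite (_ : long_set k = Xf @^-1` `[k%:R, +oo[); last first.
  by apply/seteqP; split => x /=; rewrite in_itv/= andbT.
by rewrite -[X in measurable X]setTI; exact: measurable_powR.
Qed.

(** The index is shifted: the step from time [k] to [k.+1] uses the delay [xi k.+1]. *)
Definition long_delay k w : R := \1_(xi k.+1 @^-1` long_set k) w.
Definition long_prob k : R := E (long_delay k).
Definition long_mean n : R := \sum_(2 <= k < n) long_prob k.
Definition long_count n w : R := \sum_(2 <= k < n) long_delay k w.

Let m_long k : measurable (xi k.+1 @^-1` long_set k).
Proof. by apply: (@measurable_preimage _ _ _ X mX (inl k.+1)); exact: measurable_long_set. Qed.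

Lemma bounded_long_delay k : bounded_rv (long_delay k).
Proof. exact: bounded_rv_indic. Qed.

Lemma long_probE k : long_prob k = expect mu \1_(long_set k).
Proof.
have ml := measurable_long_set k.
by apply: EFin_inj; rewrite !expect_indic// law_xi.
Qed.

Lemma expect_long_delayM k n : k != n ->
  E (fun w => long_delay k w * long_delay n w) = long_prob k * long_prob n.
Proof.
move=> kn.
pose B (i : (nat + nat)%type) := if i == inl k.+1 then long_set k else long_set n.
have mB i : measurable (B i) by rewrite /B; case: ifP => _; exact: measurable_long_set.
have u : uniq [:: inl k.+1; inl n.+1 : (nat + nat)%type].
  by rewrite /= inE andbT; apply: contra kn => /eqP[->].
have := expect_rect mX indX u mB; rewrite !big_cons big_nil mulr1 /= /B eqxx.
have -> : (inl n.+1 == inl k.+1 :> (nat + nat)%type) = false.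
  by apply/negbTE; apply: contra kn => /eqP[->].
move=> <-; congr expect; apply/funext => w; rewrite !rect_cons.
rewrite (_ : rect X [::] _ = setT) ?setIT ?indicI /B ?eqxx//; last first.
  by apply/seteqP; split => // w' _ i /=; rewrite in_nil.
have -> // : (inl n.+1 == inl k.+1 :> (nat + nat)%type) = false.
by apply/negbTE; apply: contra kn => /eqP[->].
Qed.

Lemma long_delay_sqr k w : long_delay k w * long_delay k w = long_delay k w.
Proof. by rewrite /long_delay indicE; case: (_ \in _); rewrite ?mulr1 ?mulr0. Qed.

Let S n w : R := \sum_(2 <= k < n) (long_delay k w - long_prob k).

Let bounded_S n : bounded_rv (S n).
Proof.
apply: bounded_rv_sum => k _; apply: bounded_rvB; last exact: bounded_rv_cst.
exact: bounded_long_delay.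
Qed.

(** Independence removes the cross terms, and each indicator of probability [p] contributes
    [p - p ^ 2 <= p]. *)
Lemma long_count_variance n :
  E (fun w => (long_count n w - long_mean n) ^+ 2) <= long_mean n.
Proof.
rewrite (_ : (fun w => _) = (fun w => S n w ^+ 2)); last first.
  by apply/funext => w; rewrite /S sumrB.
elim: n => [|n ih].
  by rewrite /long_mean big_geq// (_ : (fun w => _) = fun=> 0) ?expect_cst//;
    apply/funext => w; rewrite /S big_geq// expr0n.
have [n1|n2] := leqP n 1.
  by rewrite /long_mean big_geq// (_ : (fun w => _) = fun=> 0) ?expect_cst//;
    apply/funext => w; rewrite /S big_geq// expr0n.
rewrite /long_mean big_nat_recr//= -/(long_mean n).
have bl := bounded_long_delay; have bSl := bounded_rvM (bounded_S n) (bl n).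
have -> : (fun w => S n.+1 w ^+ 2) = (fun w => S n w ^+ 2 +
    (2 * (S n w * long_delay n w) + (- (2 * long_prob n) * S n w +
      ((1 - 2 * long_prob n) * long_delay n w + long_prob n ^+ 2)))).
  apply/funext => w; rewrite /S big_nat_recr//= -/(S n w).
  by have := long_delay_sqr n w; move: (long_delay n w) (S n w) => a b; nra.
have bS2 := bounded_rvX 2 (bounded_S n).
have b1 : bounded_rv (fun w => (1 - 2 * long_prob n) * long_delay n w + long_prob n ^+ 2).
  by apply: bounded_rvD; [exact: bounded_rvZ|exact: bounded_rv_cst].
have b2 := bounded_rvD (bounded_rvZ (- (2 * long_prob n)) (bounded_S n)) b1.
have b3 := bounded_rvD (bounded_rvZ 2 bSl) b2.
rewrite expectD// expectD//; [|exact: bounded_rvZ].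
rewrite expectD//; [|exact: bounded_rvZ].
rewrite expectD//; [|exact: bounded_rvZ|exact: bounded_rv_cst].
rewrite expect_cst !expectZ// -/(long_prob n).
have bc k : bounded_rv (fun w => long_delay k w - long_prob k).
  by apply: bounded_rvB => //; exact: bounded_rv_cst.
have ES : E (S n) = 0.
  rewrite /S expect_sum// big1// => k _.
  by rewrite expectB ?expect_cst ?subrr//; exact: bounded_rv_cst.
have ESl : E (fun w => S n w * long_delay n w) = 0.
  rewrite /S; under eq_fun do rewrite mulr_suml.
  rewrite expect_sum => [|k _]; last exact: bounded_rvM.
  rewrite big_nat big1// => k /andP[_ kn].
  under eq_fun do rewrite mulrBl.
  rewrite expectB; [|exact: bounded_rvM|exact: bounded_rvZ].
  by rewrite expect_long_delayM ?expectZ ?subrr// neq_ltn kn.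
rewrite ES ESl !mulr0 !add0r; apply: lerD => //.
have := sqr_ge0 (long_prob n); rewrite -/(long_prob n); nra.
Qed.

Lemma truncated_moment_le n :
  fine (\int[mu]_x (Num.min (Xf x) n.+2%:R)%:E)%E <= 2 + long_mean n.+2.
Proof.
have mXf : measurable_fun setT Xf by exact: measurable_powR.
rewrite -/(expect mu (fun x => Num.min (Xf x) n.+2%:R)).
have -> : 2 + long_mean n.+2 = expect mu (fun x => 2 +
    \sum_(2 <= k < n.+2) \1_(long_set k) x).
  have bl k : bounded_rv (\1_(long_set k) : R -> R).
    by apply: bounded_rv_indic; exact: measurable_long_set.
  rewrite expectD ?expect_cst ?expect_sum//.
  - by congr (_ + _); apply: eq_bigr => k _; exact: long_probE.
  - exact: bounded_rv_cst.
  - exact: bounded_rv_sum.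
apply: expect_le.
- split; first by apply: measurable_minr.
  exists n.+2%:R => x; rewrite ger0_norm ?ge_min ?lexx ?orbT//.
  by rewrite le_min powR_ge0/=.
- apply: bounded_rvD; first exact: bounded_rv_cst.
  by apply: bounded_rv_sum => k _; apply: bounded_rv_indic; exact: measurable_long_set.
move=> x; have /le_trans := @min_le_count R (x `^ (1 - beta)^-1) n (powR_ge0 _ _); apply.
rewrite lerD2l; apply: ler_sum => k _; rewrite indicE.
by rewrite (_ : (x \in long_set k) = (k%:R <= Xf x))//; apply/idP/idP; rewrite inE.
Qed.

Hypothesis Xf_int : (\int[mu]_x (Xf x)%:E = +oo)%E.

(** The truncated moments tend to infinity by monotone convergence, and [long_mean] is at most 2
    below them. *)
Lemma long_mean_cvgy : long_mean n.+2 @[n --> \oo] --> +oo.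
Proof.
have mXf : measurable_fun setT Xf by exact: measurable_powR.
pose f n x : \bar R := (Num.min (Xf x) n.+2%:R)%:E.
have mf n : measurable_fun setT (f n) by apply/measurable_EFinP; exact: measurable_minr.
have f0 n x : (0 <= f n x)%E by rewrite lee_fin le_min powR_ge0/=.
have fnd x : nondecreasing_seq (f^~ x).
  move=> n m nm; rewrite lee_fin le_min ge_min lexx/= ge_min ler_nat !ltnS nm orbT//.
have lf x : limn (f^~ x) = (Xf x)%:E.
  apply/cvg_lim => //; apply: cvg_EFin; first exact: nearW.
  apply/cvgrPdist_le => e e0; exists (Num.truncn (Xf x)) => // n /= hn.
  rewrite /f/= (min_idPl _) ?subrr ?normr0 ?ltW//.
  apply: lt_le_trans (truncnS_gt (Xf x)) _; rewrite ler_nat ltnS.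
  exact: leq_trans hn _.
have := cvg_monotone_convergence (mu := mu) measurableT mf (fun n x _ => f0 n x) (fun x _ => fnd x).
under eq_integral do rewrite lf.
rewrite Xf_int => /cvgeyPge h.
apply/cvgryPge => A; have [N _ hN] := h (A + 2); exists N => // n /= Nn.
have := hN n Nn => {}hN.
have := truncated_moment_le n.
suff : A + 2 <= fine (\int[mu]_x (Num.min (Xf x) n.+2%:R)%:E)%E by lra.
rewrite -lee_fin fineK//.
have bf : bounded_rv (fun x => Num.min (Xf x) n.+2%:R).
  split; first by apply: measurable_minr.
  exists n.+2%:R => x; rewrite ger0_norm ?ge_min ?lexx ?orbT//.
  by rewrite le_min powR_ge0/=.
by rewrite -(expectE mu bf).
Qed.

Lemma root_degree_heavy_tail (eps : R) : 0 < eps ->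
  (fun n : nat => P [set w | (1 - eps) *
      fine (\int[mu]_x (Num.min (Xf x) n%:R)%:E)%E <=
      (proc_deg (fun k : nat => k%:R + alpha) beta (fun k => xi k w) (fun k => U k w) 1 n)%:R])
    @ \oo --> 1%E.
Proof.
move=> e0; pose M n w :=
  proc_deg (fun k : nat => k%:R + alpha) beta (fun k => xi k w) (fun k => U k w) 1 n.
pose m n := fine (\int[mu]_x (Num.min (Xf x) n%:R)%:E)%E.
pose A n := [set w | (1 - eps) * m n <= (M n w)%:R].
have mA n : measurable (A n).
  have := @discrete_measurable_proc_deg R _ _ (fun k : nat => k%:R + alpha) beta xi U mxi mU 1 n.
  by move=> /(_ [set j | (1 - eps) * m n <= j%:R]).
rewrite (_ : (fun n => _) = (fun n => (E \1_(A n))%:E)); last first.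
  by apply/funext => n; rewrite expect_indic.
apply: cvg_EFin; first exact: nearW.
rewrite -(cvg_shiftn 2) /=.
apply/cvgrPdist_le => t t0.
(* Chebyshev bounds the failure probability by [1 / (eps^2 b)], which is at most [t] once [b]
   reaches this level. *)
have h0 : 0 < (eps ^+ 2 * t)^-1 by rewrite invr_gt0 mulr_gt0// exprn_gt0.
move/cvgryPge : long_mean_cvgy => /(_ (eps ^+ 2 * t)^-1)[N _ hN].
exists N => // n /= /hN {}hN; rewrite addn2.
set b := long_mean n.+2 in hN *.
have bp : 0 < b by exact: lt_le_trans hN.
have mC : measurable (~` A n.+2) by exact: measurableC.
have -> : 1 - E \1_(A n.+2) = E \1_(~` A n.+2).
  rewrite -(expect_cst P 1) -expectB; [|exact: bounded_rv_cst|exact: bounded_rv_indic].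
  congr expect; apply/funext => w; rewrite !indicE in_setC.
  by case: (_ \in _) => /=; rewrite ?subrr ?subr0.
rewrite ger0_norm; last by apply: expect_ge0 => w; rewrite indicE.
have bcount : bounded_rv (fun w => long_count n.+2 w - b).
  apply: bounded_rvB; last exact: bounded_rv_cst.
  by apply: bounded_rv_sum => k _; exact: bounded_long_delay.
have T0 : 0 < (eps * b) ^+ 2 by rewrite exprn_gt0// mulr_gt0.
have : (eps * b) ^+ 2 * E \1_(~` A n.+2) <= b.
  apply: le_trans (long_count_variance n.+2).
  rewrite -expectZ; last exact: bounded_rv_indic.
  apply: expect_le; [by apply: bounded_rvZ; exact: bounded_rv_indic|exact: bounded_rvX|].
  move=> w; rewrite indicE; have [|_] := boolP (w \in ~` A n.+2); last first.
    by rewrite mulr0 sqr_ge0.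
  rewrite inE /A/= mulr1 => /negP; rewrite -ltNge => hM.
  have hcount : 2 + long_count n.+2 w <= (M n.+2 w)%:R.
    have := root_degree_ge alpha beta01 (fun k => xi k w) (fun k => U k w) n.
    rewrite -(ler_nat R) natrD natr_sum => /(le_trans _); apply.
    rewrite lerD2l; apply: ler_sum => k _.
    rewrite /long_delay indicE (_ : (w \in _) = (k%:R <= Xf (xi k.+1 w)))//.
    by apply/idP/idP; rewrite inE.
  have hm := truncated_moment_le n; rewrite -/(m n.+2) -/b in hm.
  have c0 : 0 <= long_count n.+2 w.
    by apply: sumr_ge0 => k _; rewrite /long_delay indicE.
  (* On the failure event [(1 - eps) m] exceeds a non-negative degree, so [1 - eps] is positive and
     can multiply the moment bound [hm]. *)
  have e1 : eps < 1.
    rewrite ltNge; apply/negP => e1.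
    have m0 : 0 <= m n.+2.
      by apply: fine_ge0; apply: integral_ge0 => x _; rewrite lee_fin le_min powR_ge0/=.
    have : (1 - eps) * m n.+2 <= 0 by rewrite mulr_le0_ge0// subr_le0.
    by move: hM hcount c0; lra.
  have hb : (1 - eps) * m n.+2 <= (1 - eps) * (2 + b).
    by rewrite ler_wpM2l// subr_ge0 ltW.
  (* The 2 in the pathwise bound [hcount] compensates the 2 lost in the truncated moment. *)
  have h1 : eps * b <= b - long_count n.+2 w by move: hM hcount hb e0; lra.
  rewrite -[leRHS]sqrrN opprB lerXn2r ?nnegrE//; first by rewrite mulr_ge0 ?ltW.
  by apply: le_trans h1; rewrite mulr_ge0 ?ltW.
rewrite mulrC -ler_pdivlMr// => /le_trans; apply.
rewrite ler_pdivrMr// exprMn.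
have : 1 <= eps ^+ 2 * t * b.
  by rewrite mulrC -ler_pdivrMr ?mul1r// mulr_gt0// exprn_gt0.
move=> h1; have := ler_wpM2r (ltW bp) h1; rewrite mul1r => /le_trans; apply.
by apply: eq_ler; ring.
Qed.

End HeavyTail.

(** * From the clamped process back to the given one *)

Section Unclamping.
Context {R : realType} {d : measure_display} {Omega : measurableType d}.
Variables (alpha beta : R) (mu : probability R R) (P : probability Omega R).
Variables (xi U : nat -> Omega -> R).
Hypothesis mu_ge0 : mu [set` `[0%R, +oo[] = 1%E.
Hypothesis mxi : forall k, measurable_fun setT (xi k).
Hypothesis mU : forall k, measurable_fun setT (U k).
Hypothesis law_xi : forall k A, measurable A -> P (xi k @^-1` A) = mu A.
Hypothesis law_U : forall k A, measurable A ->
  P (U k @^-1` A) = lebesgue_measure (A `&` [set` `[0%R, 1%R[]).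

Lemma ae_clamped_degree : {ae P, forall w, forall n,
  proc_deg (fun k : nat => k%:R + alpha) beta (fun k => xi k w) (fun k => U k w) 1 n =
  clamped_degree alpha beta xi U n w}.
Proof.
have hxi : {ae P, forall w, forall k, clamp_delay (xi k w) = xi k w}.
  apply/ae_foralln => k; exists (xi k @^-1` ~` [set` `[0%R, +oo[]); split.
  - by rewrite -[X in measurable X]setTI; apply: mxi => //; exact: measurableC.
  - apply: etrans (law_xi k (measurableC (measurable_itv `[0%R, +oo[))) _.
    by rewrite probability_setC// mu_ge0 subee.
  - move=> w /= h; rewrite in_itv/= andbT => x0; apply: h.
    exact: clamp_delay_id.
have hU : {ae P, forall w, forall k, clamp_unit (U k w) = U k w}.
  apply/ae_foralln => k; exists (U k @^-1` ~` [set` `[0%R, 1%R[]); split.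
  - by rewrite -[X in measurable X]setTI; apply: mU => //; exact: measurableC.
  - apply: etrans (law_U k (measurableC (measurable_itv `[0%R, 1%R[))) _.
    by rewrite setICl measure0.
  - move=> w /= h; rewrite in_itv/= => u01; apply: h.
    by rewrite /clamp_unit u01.
apply: filterS2 hxi hU => w h1 h2 n; rewrite /clamped_degree.
by congr proc_deg; apply/funext => k.
Qed.

End Unclamping.

Theorem mainTheorem5 (R : realType) (alpha beta : R)
  (mu : probability R R)
  (d : measure_display) (Omega : measurableType d) (P : probability Omega R)
  (xi U : nat -> Omega -> R) :
  -1 < alpha -> 0 <= beta < 1 ->
  (* mu is a probability distribution on [0, oo) *)
  mu [set` `[0%R, +oo[] = 1%E ->
  (* xi_k has law mu, U_k is uniform on [0,1), all of them independent *)
  (forall k, measurable_fun setT (xi k)) ->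
  (forall k, measurable_fun setT (U k)) ->
  (forall k A, measurable A -> P (xi k @^-1` A) = mu A) ->
  (forall k A, measurable A ->
     P (U k @^-1` A) = lebesgue_measure (A `&` [set` `[0%R, 1%R[])) ->
  mutually_independent P
    (fun i : (nat + nat)%type => match i with inl k => xi k | inr k => U k end) ->
  (* assumptions on the delay distribution *)
  let g := fun (n : nat) (x : R) =>
    ((n%:R `^ beta) * x * (if 1 <= n%:R - (n%:R `^ beta) * x then 1 else 0)
       / (lagged_time beta n x)%:R) in
  ((fun n : nat => (\int[mu]_x (g n x)%R%:E)%E) @ \oo --> 0%E) ->
  (\sum_(1 <= n <oo) ((n%:R)^-1%:E * \int[mu]_x (g n x)%R%:E) < +oo)%E ->
  let f := fun k : nat => k%:R + alpha in
  let theta := (2 + alpha)^-1 in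
  (* X := xi^(1/(1-beta)) *)
  let Xf := fun x : R => x `^ (1 - beta)^-1 in
  (* root degree M(rho, n) = deg(v_1, n) *)
  let M := fun (n : nat) (w : Omega) =>
    proc_deg f beta (fun k => xi k w) (fun k => U k w) 1 n in
  (* (i) *)
  ((\int[mu]_x ((Xf x) `^ (1 - theta))%R%:E < +oo)%E ->
    exists W : Omega -> R,
      [/\ measurable_fun setT W, (forall w, 0 <= W w),
          (0 < P [set w | (0 < W w)%R])%E,
          {ae P, forall w, ((fun n : nat => (M n w)%:R / n%:R `^ theta) @ \oo
                             --> W w)%R} &
          (fun n : nat =>
             (\int[P]_w ((((M n w)%:R / n%:R `^ theta - W w) ^+ 2)%R%:E))%E)
            @ \oo --> 0%E])
  /\
  (* (ii) *)
  ((\int[mu]_x (Xf x)%:E = +oo)%E ->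
    forall eps : R, 0 < eps ->
      (fun n : nat =>
         P [set w | (1 - eps) * fine (\int[mu]_x (Num.min (Xf x) n%:R)%R%:E)%E
                      <= (M n w)%:R]) @ \oo --> 1%E).
Proof.
move=> alpha_gt beta01 mu_ge0 mxi mU law_xi law_U indX g g_cvg g_sum f theta Xf M.
split=> [q_int|Xf_int eps eps0]; last first.
  exact: (root_degree_heavy_tail alpha beta01 mxi mU law_xi indX Xf_int eps0).
have [K hK] := drift_bound_summable alpha_gt beta01 mu_ge0 q_int g_sum.
have [K' hK'] := drift_bound_le alpha_gt beta01 mu_ge0 q_int g_cvg.
have stepM n w : (0 < n)%N ->
    clamped_degree alpha beta xi U n.+1 w = clamped_degree alpha beta xi U n w \/
    clamped_degree alpha beta xi U n.+1 w = (clamped_degree alpha beta xi U n w).+1.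
  move=> n0; rewrite clamped_degreeS//; case: (_ < _)%R; rewrite ?addn0 ?addn1.
    by right.
  by left.
have [W [mW W0 PW cW lW]] := @root_degree_limit R d Omega P alpha
  (clamped_degree alpha beta xi U) (lag_prob beta mu) alpha_gt
  (lag_prob_ge0 beta mu) (lag_prob_sum beta mxi mU law_xi) (fun=> erefl) (fun=> erefl)
  stepM (bounded_clamped_degree beta alpha_gt mxi mU)
  (clamped_increment_mean alpha_gt mxi mU law_xi law_U indX) K K' hK hK'.
have aeM := ae_clamped_degree alpha beta mu_ge0 mxi mU law_xi law_U.
exists W; split => //.
  apply: filterS2 aeM cW => w hM; rewrite /M.
  by under [in X in _ -> X]eq_fun do rewrite hM.
(* For each [n] the two integrands agree almost everywhere, so the L2 distances to [W] coincide. *)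
rewrite (_ : (fun n : nat => _) = (fun n => \int[P]_w
    (((clamped_degree alpha beta xi U n w)%:R / n%:R `^ theta - W w) ^+ 2)%:E)%E)//.
apply/funext => n.
have mMn (N : nat -> Omega -> nat) : (forall n, discrete_measurable (N n)) ->
    measurable_fun setT (fun w => (((N n w)%:R / n%:R `^ theta - W w) ^+ 2)%:E).
  move=> mN; apply/measurable_EFinP; apply: measurable_funX.
  apply: measurable_funB => //; apply: measurable_funM => //.
  exact: (discrete_measurable_realfun (fun k => k%:R) (mN n)).
apply: ge0_ae_eq_integral => //.
- by apply: mMn => k; exact: discrete_measurable_proc_deg.
- by apply: mMn => k; exact: discrete_measurable_clamped_degree.
- by move=> w _; rewrite lee_fin sqr_ge0.
- by move=> w _; rewrite lee_fin sqr_ge0.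
- by apply: filterS aeM => w hM _; rewrite /M hM.
Qed.
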